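(* Let $\Omega\subset\mathbb{C}^n$ be a bounded convex domain and $0\le M\le N$ integers. For $\varepsilon$ in a neighborhood of $0$ in $\mathbb{C}$, let $S(\varepsilon)=\{a_j(\varepsilon),1\le j\le M;\ a'_j(\varepsilon),a''_j(\varepsilon),M+1\le j\le N\}\subset\Omega$ be a finite set of points which are pairwise distinct for each fixed $\varepsilon$, with $\lim_{\varepsilon\to0}a_j(\varepsilon)=a_j\in\Omega$ ($1\le j\le M$), $\lim_{\varepsilon\to0}a'_j(\varepsilon)=\lim_{\varepsilon\to0}a''_j(\varepsilon)=a_j\in\Omega$ ($M+1\le j\le N$), the points $a_1,\dots,a_N$ being pairwise distinct, and $\lim_{\varepsilon\to0}[a''_j(\varepsilon)-a'_j(\varepsilon)]=[v_j]$ in $\mathbb{P}^{n-1}$ for $M+1\le j\le N$, where $v_j$ is chosen with $\|v_j\|=1$. Let $\Psi_j(z)=\log\|z\|$ for $1\le j\le M$, and for $M+1\le j\le N$ let $\pi_j$ be the orthogonal projection onto $\{v_j\}^\perp$ and $\Psi_j(z)=\max(\log\|\pi_j(z)\|,2\log|z\cdot\bar v_j|)$. Let $S=\{(a_j,\Psi_j):1\le j\le N\}$. Then for all $z\in\Omega$, $$\lim_{\varepsilon\to0}\ell_{S(\varepsilon)}(z)=\lim_{\varepsilon\to0}\mathcal{L}_{S(\varepsilon)}(z)=\mathcal{L}_S(z).$$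
   Context: $\mathbb{D}$ is the unit disk, $z\cdot\bar w=\sum_jz_j\bar w_j$, $\|z\|=(z\cdot\bar z)^{1/2}$, and $[z]$ is the class of $z\neq0$ in $\mathbb{P}^{n-1}$. Coman's Lempert function: for distinct points $b_1,\dots,b_K\in\Omega$, $\ell_{\{b_1,\dots,b_K\}}(z)=\inf\{\sum_{k}\log|\zeta_k|:\exists\varphi\in Hol(\mathbb{D},\Omega),\varphi(0)=z,\varphi(\zeta_k)=b_k,1\le k\le K\}$. Multiplicity: for a function $\Psi$ near $0$ with Monge–Ampère mass $\tau_\Psi$ at $0$ (here $\tau=1$ for $\log\|z\|$ and $\tau=2$ for $\max(\log\|\pi_j z\|,2\log|z\cdot\bar v_j|)$), $\varphi\in Hol(\mathbb{D},\Omega)$, $\alpha\in\mathbb{D}$, $a\in\Omega$: if $\varphi(\alpha)=a$, $m_{\varphi,a,\Psi}(\alpha)=\min\big(\tau_\Psi,\liminf_{\zeta\to0}\Psi(\varphi(\alpha+\zeta)-a)/\log|\zeta|\big)$; else $0$. Generalized Lempert function of a system $T=\{(b_k,\Phi_k)\}$ (distinct points $b_k\in\Omega$, indicators $\Phi_k$ with masses $\tau_k$): $(\varphi,(A_k))$, $\varphi\in Hol(\mathbb{D},\Omega)$, $A_k\subset\mathbb{D}$, is admissible for $T,z$ if $\varphi(0)=z$, $A_k\subset\varphi^{-1}(b_k)$ and $\sum_{\alpha\in A_k}m_{\varphi,b_k,\Phi_k}(\alpha)\le\tau_k$ (empty $A_k$ allowed); $\mathcal{L}_T(z)=\inf\sum_k\sum_{\alpha\in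 A_k}m_{\varphi,b_k,\Phi_k}(\alpha)\log|\alpha|$ over admissible pairs (with $0\cdot\infty=0$). For the point set $S(\varepsilon)$, $\mathcal{L}_{S(\varepsilon)}$ means $\mathcal{L}_T$ with each point of $S(\varepsilon)$ equipped with $\Phi(z)=\log\|z\|$ (mass $1$). *)

(* Defs.v *)
From HB Require Import structures.
From mathcomp Require Import all_boot all_order all_algebra.
From mathcomp Require Import complex.
From mathcomp Require Import all_classical all_reals all_analysis.
Import Order.TTheory GRing.Theory Num.Theory.
Import numFieldNormedType.Exports.
Import ComplexField.

Set Implicit Arguments.
Unset Strict Implicit.
Unset Printing Implicit Defensive.

Local Open Scope classical_set_scope.
Local Open Scope ring_scope.

(* R[i] as a normed module over itself (its norm is the complex modulus),
   so that [derivable] on R[i] is complex differentiability. *)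
HB.instance Definition _ (R : realType) := NormedModule.copy R[i] R[i]^o.

Section Defs.
Variable R : realType.
Local Notation C := (R[i]).

Definition cmod (x : C) : R := Num.sqrt (complex.Re x ^+ 2 + complex.Im x ^+ 2).

Definition elog (x : R) : \bar R := if x == 0 then (-oo)%E else (ln x)%:E.

Variable n : nat.
Local Notation Cn := 'rV[C]_n.

Definition hdot (z w : Cn) : C := \sum_(i < n) z 0 i * (w 0 i)^*.

Definition enorm (z : Cn) : R := Num.sqrt (\sum_(i < n) cmod (z 0 i) ^+ 2).

(* orthogonal projection onto {v}^perp, for ||v|| = 1 *)
Definition projperp (v z : Cn) : Cn := z - hdot z v *: v.

Definition Psi_pt (z : Cn) : \bar R := elog (enorm z).

Definition Psi_dir (v : Cn) (z : Cn) : \bar R :=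
  maxe (elog (enorm (projperp v z))) (2%:E * elog (cmod (hdot z v)))%E.

Definition convex_domain (Om : set Cn) :=
  forall x y, Om x -> Om y -> forall t : R, 0 <= t <= 1 ->
    Om ((1 - t)%:C%C *: x + t%:C%C *: y).

Definition bounded_convex_domain (Om : set Cn) :=
  [/\ Om !=set0, open Om, connected Om, bounded_set Om & convex_domain Om].

Definition hol_disk (Om : set Cn) (phi : C -> Cn) :=
  forall zeta : C, cmod zeta < 1 -> Om (phi zeta) /\ derivable phi zeta 1.

Definition liminf0 (f : C -> \bar R) : \bar R :=
  ereal_sup [set ereal_inf [set f zeta | zeta in [set zeta | 0 < cmod zeta < r]]
            | r in [set r : R | 0 < r]].

Definition mult (tau : R) (Psi : Cn -> \bar R) (phi : C -> Cn) (a : Cn)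
    (alpha : C) : \bar R :=
  if phi alpha == a then
    mine tau%:E
      (liminf0 (fun zeta => Psi (phi (alpha + zeta)%R - a)%R
                            * ((ln (cmod zeta))^-1)%:E))%E
  else 0%E.

Definition coman_lempert (Om : set Cn) (bs : seq Cn) (z : Cn) : \bar R :=
  ereal_inf [set x : \bar R | exists (phi : C -> Cn) (zs : seq C),
    [/\ hol_disk Om phi, phi 0 = z, size zs = size bs,
        forall k, (k < size bs)%N ->
          cmod (nth 0 zs k) < 1 /\ phi (nth 0 zs k) = nth 0 bs k &
        x = (\sum_(zeta <- zs) elog (cmod zeta))%E]].

Record pole := Pole { pole_pt : Cn; pole_ind : Cn -> \bar R; pole_mass : R }.

Definition pole0 : pole := Pole 0 (fun _ => -oo%E) 0.

Definition admissible (Om : set Cn) (T : seq pole) (z : Cn)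
    (phi : C -> Cn) (As : seq (seq C)) :=
  [/\ hol_disk Om phi, phi 0 = z, size As = size T &
      forall k, (k < size T)%N ->
        let p := nth pole0 T k in let A := nth [::] As k in
        [/\ uniq A,
            forall alpha, alpha \in A -> cmod alpha < 1 /\ phi alpha = pole_pt p &
            (\sum_(alpha <- A)
               mult (pole_mass p) (pole_ind p) phi (pole_pt p) alpha
               <= (pole_mass p)%:E)%E]].

(* generalized Lempert function L_T(z)  (mule has 0 * oo = 0) *)
Definition gen_lempert (Om : set Cn) (T : seq pole) (z : Cn) : \bar R :=
  ereal_inf [set x : \bar R | exists phi As, admissible Om T z phi As /\
    x = (\sum_(k < size T) \sum_(alpha <- nth [::] As k)
           mult (pole_mass (nth pole0 T k)) (pole_ind (nth pole0 T k)) phi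
                (pole_pt (nth pole0 T k)) alpha * elog (cmod alpha))%E].

(* convergence in P^{n-1}: [w eps] -> [v] as eps -> 0 (eps <> 0), i.e. some
   nonzero rescalings of the representatives converge to v *)
Definition proj_cvg0 (w : C -> Cn) (v : Cn) :=
  exists lam : C -> C, (forall eps, lam eps != 0) /\
    (lam eps *: w eps) @[eps --> (0 : C)^'] --> v.

Definition Seps (M N : nat) (a a' a'' : nat -> C -> Cn) (eps : C) : seq Cn :=
  [seq a j eps | j <- iota 0 M] ++
  flatten [seq [:: a' j eps; a'' j eps] | j <- iota M (N - M)].

Definition pt_system (s : seq Cn) : seq pole := [seq Pole p Psi_pt 1 | p <- s].

Definition limit_system (M N : nat) (b v : nat -> Cn) : seq pole :=
  [seq Pole (b j) Psi_pt 1 | j <- iota 0 M] ++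
  [seq Pole (b j) (Psi_dir (v j)) 2 | j <- iota M (N - M)].

End Defs.

(* Main.v *)
(** For [z] not a pole, both limits are compared with the infimum of
    [sum log |x_i|] over configurations: maps [phi] with [phi 0 = z] and at most
    one node [x_i] per point of [S eps], the two nodes of a pair being allowed to
    coincide only if [phi'] is parallel to [v_j] there.

    Upper bound: by Harnack's inequality, [phi (r .)] stays away from the
    complement of the convex set [Om], so small interpolation polynomials can be
    added to make it pass through the points of [S eps]; an unused point is hit
    near the unit circle, by dragging the map along a segment of [Om] with the
    help of a peak function.

    Lower bound: along an ultrafilter, competitors for [S eps] converge locally
    uniformly to a map which stays in [Om], again by Harnack's inequality.  Nodes
    escaping to the unit circle cost nothing in the limit.  If both nodes of a
    pair converge to the same point, the secants force the derivative of the
    limit to be parallel to [v_j]; two distinct limit nodes are made transverse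
    to [v_j] by a small perturbation, so that each has multiplicity one.

    Goursat's lemma is proved with dyadic Riemann sums along segments, and the
    Cauchy estimates and the Poisson formula follow from discrete circle means. *)
Require Import Defs.
From HB Require Import structures.
From mathcomp Require Import all_boot all_order all_algebra.
From mathcomp Require Import complex.
From mathcomp Require Import all_classical all_reals all_analysis.
From mathcomp Require Import ring lra zify.
Import Order.TTheory GRing.Theory Num.Theory.
Import numFieldNormedType.Exports.
Import ComplexField.
Import Normc.
Set Implicit Arguments.
Unset Strict Implicit.
Unset Printing Implicit Defensive.
Local Open Scope classical_set_scope.
Local Open Scope ring_scope.

(** [gen_lempert] may leave poles out and caps the sum of the multiplicities at each pole, while
    [coman_lempert] must hit every point. Configurations mediate, and their form follows the cap: at
    a pole of mass 2 every node has multiplicity between 1 and 2, so at most two nodes fit, two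
    distinct ones only with multiplicity 1 each, and a derivative along [v_j] gives multiplicity 2.

    The obstacle in the upper bound is that the two nodes of a merged pair approach each other while
    the map is corrected. Their gap is therefore prescribed by the secant of the pair, which keeps
    the divided differences to be corrected small.

    Integrals are replaced by differences of finite sums that tend to 0. Dyadic sums make bisection
    an exact identity, and composing with the exponential turns an annulus into a rectangle whose
    horizontal sides cancel by periodicity.

    If [z] is itself a pole, a constant map shows that the common limit is [-oo]; this is treated
    separately, since nodes at 0 have logarithm [-oo]. *)

(** * The modulus of complex numbers *)

Section Modulus.
Variable R : realType.
Local Notation C := (R[i]).
Implicit Types x y z : C.

Lemma cmodE z : `|z| = (cmod z)%:C%C.
Proof. by rewrite normc_def. Qed.

Lemma cmod_normc z : cmod z = normc z.
Proof. by case: z. Qed.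

Lemma cmod_ge0 z : 0 <= cmod z.
Proof. exact: sqrtr_ge0. Qed.
Hint Extern 0 (is_true (@Order.le _ _ _ (cmod _))) => (apply: cmod_ge0) : core.

Lemma cmodM x y : cmod (x * y) = cmod x * cmod y.
Proof. by rewrite !cmod_normc normcM. Qed.

Lemma cmodN x : cmod (- x) = cmod x.
Proof. by rewrite !cmod_normc normcN. Qed.

Lemma cmodV x : cmod x^-1 = (cmod x)^-1.
Proof. by rewrite !cmod_normc normcV. Qed.

Lemma cmod_distC x y : cmod (x - y) = cmod (y - x).
Proof. by rewrite -cmodN opprB. Qed.

Lemma cmodD x y : cmod (x + y) <= cmod x + cmod y.
Proof. by rewrite !cmod_normc le_normcD. Qed.

Lemma cmodB x y : cmod (x - y) <= cmod x + cmod y.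
Proof. by rewrite (le_trans (cmodD _ _))// cmodN. Qed.

Lemma cmod_sub_ge x y : cmod x - cmod y <= cmod (x - y).
Proof. by rewrite lerBlDr (le_trans _ (cmodD _ _)) ?subrK. Qed.

Lemma cmod0 : cmod (0 : C) = 0.
Proof. by rewrite cmod_normc normc0. Qed.

Lemma cmod1 : cmod (1 : C) = 1.
Proof. by rewrite cmod_normc normc1. Qed.

Lemma cmod_eq0 x : (cmod x == 0) = (x == 0).
Proof.
rewrite cmod_normc; apply/eqP/eqP => [/eq0_normc//|->]; exact: normc0.
Qed.

Lemma cmod_gt0 x : (0 < cmod x) = (x != 0).
Proof. by rewrite lt_def cmod_eq0 cmod_ge0 andbT. Qed.

Lemma cmod_real (r : R) : cmod r%:C%C = `|r|.
Proof. by rewrite /cmod /= expr0n /= addr0 sqrtr_sqr. Qed.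

Lemma cmod_nat n : cmod (n%:R : C) = n%:R.
Proof. by rewrite -(rmorph_nat (real_complex R)) cmod_real normr_nat. Qed.

Lemma cmodX x n : cmod (x ^+ n) = cmod x ^+ n.
Proof. by elim: n => [|n IH]; rewrite ?expr0 ?cmod1// !exprS cmodM IH. Qed.

Lemma cmod_Re x : `|complex.Re x| <= cmod x.
Proof.
by rewrite -sqrtr_sqr ler_sqrt ?addr_ge0 ?sqr_ge0// lerDl sqr_ge0.
Qed.

Lemma cmod_Im x : `|complex.Im x| <= cmod x.
Proof.
by rewrite -sqrtr_sqr ler_sqrt ?addr_ge0 ?sqr_ge0// lerDr sqr_ge0.
Qed.

Lemma cmod_le_ReIm x : cmod x <= `|complex.Re x| + `|complex.Im x|.
Proof.
rewrite -(@ler_pXn2r _ 2)// ?nnegrE ?addr_ge0//.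
rewrite /cmod sqr_sqrtr ?addr_ge0 ?sqr_ge0// sqrrD !real_normK ?num_real//.
by rewrite addrAC lerDl mulrn_wge0// mulr_ge0.
Qed.

Lemma cmod_sum (I : Type) (s : seq I) (P : pred I) (F : I -> C) :
  cmod (\sum_(i <- s | P i) F i) <= \sum_(i <- s | P i) cmod (F i).
Proof.
elim/big_rec2 : _ => [|i y1 y2 _ IH]; first by rewrite cmod0.
by rewrite (le_trans (cmodD _ _))// lerD2l.
Qed.

Lemma cmod_sqr x : cmod x ^+ 2 = complex.Re x ^+ 2 + complex.Im x ^+ 2.
Proof. by rewrite sqr_sqrtr ?addr_ge0 ?sqr_ge0. Qed.

Lemma cmod_conj x : cmod (x^*) = cmod x.
Proof. by case: x => a b; rewrite /cmod /= sqrrN. Qed.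

End Modulus.
#[global] Hint Extern 0 (is_true (@Order.le _ _ _ (cmod _))) => (apply: cmod_ge0) : core.

(** * Complex differentiability in remainder form *)

Section ComplexDerivative.
Variable R : realType.
Local Notation C := (R[i]).
Implicit Types (f g : C -> C) (a l m : C).

(** The remainder form needs no division, so [h = 0], or [g (a + h) = g a] inside a composition, is
    not a special case. *)
Definition cder f a l := forall e : R, 0 < e ->
  exists2 d : R, 0 < d & forall h, cmod h < d ->
    cmod (f (a + h) - f a - l * h) <= e * cmod h.

Definition ccont f a := forall e : R, 0 < e ->
  exists2 d : R, 0 < d & forall h, cmod h < d -> cmod (f (a + h) - f a) <= e.

Lemma cder_lip f a l : cder f a l -> exists2 d : R, 0 < d & forall h, cmod h < d ->
    cmod (f (a + h) - f a) <= (cmod l + 1) * cmod h.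
Proof.
move=> /(_ 1 ltr01)[d d0 H]; exists d => // h /H{}H.
rewrite -[X in cmod X](subrK (l * h)) (le_trans (cmodD _ _))// cmodM mulrDl addrC.
by rewrite lerD.
Qed.

Lemma cder_cont f a l : cder f a l -> ccont f a.
Proof.
move=> /cder_lip[d d0 H] e e0.
have l0 : 0 < cmod l + 1 by rewrite ltr_wpDl ?ltr01 ?cmod_ge0.
exists (Num.min d (e / (cmod l + 1))); first by rewrite lt_min d0 divr_gt0.
move=> h; rewrite lt_min => /andP[/H{}H he]; apply: (le_trans H).
by rewrite mulrC -ler_pdivlMr// ltW.
Qed.

Lemma cder_eq f g a l : (exists2 d : R, 0 < d & forall h, cmod h < d -> f (a + h) = g (a + h)) ->
  cder f a l -> cder g a l.
Proof.
move=> [r r0 fg] df e /df[d d0 H]; exists (Num.min d r); first by rewrite lt_min d0 ?r0 ?d'0.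
move=> h; rewrite lt_min => /andP[hd hr]; rewrite -fg// -[in g a](addr0 a) -fg ?cmod0// addr0.
exact: H.
Qed.

Lemma cder_cst (c : C) a : cder (fun=> c) a 0.
Proof.
move=> e e0; exists 1 => // h _.
by rewrite subrr mul0r subr0 cmod0 mulr_ge0// ltW.
Qed.

Lemma cder_id a : cder id a 1.
Proof.
move=> e e0; exists 1 => // h _.
by rewrite mul1r (addrC a) addrK subrr cmod0 mulr_ge0// ltW.
Qed.

Lemma cderD f g a l m : cder f a l -> cder g a m -> cder (fun x => f x + g x) a (l + m).
Proof.
move=> df dg e e0; have e2 : 0 < e / 2 by rewrite divr_gt0.
have [d d0 H] := df _ e2; have [d' d'0 H'] := dg _ e2.
exists (Num.min d d'); first by rewrite lt_min d0 ?r0 ?d'0.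
move=> h; rewrite lt_min => /andP[/H{}H /H'{}H'].
rewrite (_ : _ - _ - _ = (f (a + h) - f a - l * h) + (g (a + h) - g a - m * h)); last by ring.
by rewrite (le_trans (cmodD _ _))// (le_trans (lerD H H'))// -mulrDl -splitr.
Qed.

Lemma cder_comp f g a l m : cder g a m -> cder f (g a) l -> cder (f \o g) a (l * m).
Proof.
move=> dg df e e0.
have [d1 d10 H1] := cder_lip dg.
have m1 : 0 < cmod m + 1 by rewrite ltr_wpDl ?ltr01 ?cmod_ge0.
have l1 : 0 < cmod l + 1 by rewrite ltr_wpDl ?ltr01 ?cmod_ge0.
have [d2 d20 H2] := df (e / 2 / (cmod m + 1)) ltac:(by rewrite !divr_gt0).
have [d3 d30 H3] := dg (e / 2 / (cmod l + 1)) ltac:(by rewrite !divr_gt0).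
exists (Num.min (Num.min d1 d3) (d2 / (cmod m + 1))); first by rewrite !lt_min d10 d30 divr_gt0.
move=> h; rewrite !lt_min => /andP[/andP[/H1{}H1 /H3{}H3] hd2] /=.
have gd2 : cmod (g (a + h) - g a) < d2.
  by apply: (le_lt_trans H1); rewrite mulrC -ltr_pdivlMr.
have := H2 _ gd2; rewrite (addrC (g a)) subrK => H4.
rewrite (_ : _ - _ - _ = (f (g (a + h)) - f (g a) - l * (g (a + h) - g a))
  + l * (g (a + h) - g a - m * h)); last by ring.
rewrite (le_trans (cmodD _ _))// [leRHS](_ : _ = (e / 2) * cmod h + (e / 2) * cmod h); last by field.
apply: lerD.
  apply: (le_trans H4); rewrite -mulrA ler_pM2l ?divr_gt0// mulrC ler_pdivrMr// mulrC//.
rewrite cmodM; apply: le_trans (ler_wpM2l (cmod_ge0 _) H3) _.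
rewrite mulrA ler_wpM2r// mulrA ler_pdivrMr// mulrC ler_pM2l ?divr_gt0//.
by rewrite lerDl.
Qed.

Lemma cder_sqr a : cder (fun x => x * x) a (2 * a).
Proof.
move=> e e0; exists e => // h he.
rewrite (_ : _ - _ - _ = h * h); last by ring.
by rewrite cmodM ler_wpM2r// ltW.
Qed.

Lemma cder_scale f a l (c : C) : cder f a l -> cder (fun x => c * f x) a (c * l).
Proof.
move=> df; apply: (@cder_comp ( *%R c) f) => //.
move=> e e0; exists 1 => // h _.
by rewrite (_ : _ - _ - _ = 0); [rewrite cmod0 mulr_ge0// ltW|rewrite /=; ring].
Qed.

(* Polarization: f g = ((f + g)^2 - (f - g)^2) / 4. *)
Lemma cderM f g a l m : cder f a l -> cder g a m ->
  cder (fun x => f x * g x) a (f a * m + g a * l).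
Proof.
move=> df dg.
have ds := cderD df dg; have dd := cderD df (cder_scale (-1) dg).
have dss := cder_comp ds (cder_sqr (f a + g a)).
have dds := cder_comp dd (cder_sqr (f a + -1 * g a)).
have := cderD (cder_scale 4^-1 dss) (cder_scale (- 4^-1) dds).
rewrite (_ : 4^-1 * _ + _ = f a * m + g a * l); last by field.
by apply: cder_eq; exists 1 => // h _ /=; field.
Qed.

Lemma cderV a : a != 0 -> cder GRing.inv a (- a^-2).
Proof.
move=> a0 e e0; have ca0 : 0 < cmod a by rewrite cmod_gt0.
exists (Num.min (cmod a / 2) (e * cmod a ^+ 3 / 2)).
  by rewrite lt_min !divr_gt0// mulr_gt0// exprn_gt0.
move=> h; rewrite lt_min => /andP[h1 h2].
have ah : cmod a / 2 <= cmod (a + h).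
  have := cmod_sub_ge a (- h); rewrite opprK cmodN; lra.
have ah0 : a + h != 0 by rewrite -cmod_gt0 (lt_le_trans _ ah)// divr_gt0.
rewrite (_ : _ - _ - _ = h ^+ 2 / (a ^+ 2 * (a + h))); last by field; rewrite a0 ah0.
rewrite cmodM cmodV (cmodM (a ^+ 2)) !cmodX (exprS (cmod h)) expr1 -mulrA (mulrC e) ler_wpM2l//.
rewrite ler_pdivrMr; last by rewrite mulr_gt0// ?exprn_gt0// (lt_le_trans _ ah)// divr_gt0.
apply: ltW; apply: (lt_le_trans h2).
rewrite (_ : _ / 2 = e * (cmod a ^+ 2 * (cmod a / 2))); last by field.
by rewrite ler_pM2l// ler_pM2l// exprn_gt0.
Qed.

Definition cdiff f a := exists l, cder f a l.

Lemma cdiff_cont f a : cdiff f a -> ccont f a.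
Proof. by case=> l; apply: cder_cont. Qed.

Lemma cdiff_cst c a : cdiff (fun=> c) a.
Proof. by exists 0; apply: cder_cst. Qed.

Lemma cdiff_id a : cdiff id a.
Proof. by exists 1; apply: cder_id. Qed.

Lemma cdiffD f g a : cdiff f a -> cdiff g a -> cdiff (fun x => f x + g x) a.
Proof. by move=> [l fl] [m gm]; exists (l + m); apply: cderD. Qed.

Lemma cdiffM f g a : cdiff f a -> cdiff g a -> cdiff (fun x => f x * g x) a.
Proof. by move=> [l fl] [m gm]; eexists; apply: cderM fl gm. Qed.

Lemma cdiffN f a : cdiff f a -> cdiff (fun x => - f x) a.
Proof.
move=> [l fl]; exists (-1 * l); apply: cder_eq (cder_scale (-1) fl).
by exists 1 => [|h _]; rewrite ?ltr01// mulN1r.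
Qed.

Lemma cdiffB f g a : cdiff f a -> cdiff g a -> cdiff (fun x => f x - g x) a.
Proof. by move=> fl /cdiffN; apply: cdiffD. Qed.

Lemma cdiff_subc c a : cdiff (fun x => x - c) a.
Proof. exact: cdiffB (cdiff_id _) (cdiff_cst _ _). Qed.

Lemma cdiff_comp f g a : cdiff g a -> cdiff f (g a) -> cdiff (f \o g) a.
Proof. by move=> [l fl] [m gm]; eexists; apply: cder_comp fl gm. Qed.

Lemma cdiffV f a : f a != 0 -> cdiff f a -> cdiff (fun x => (f x)^-1) a.
Proof. by move=> fa df; apply: (@cdiff_comp GRing.inv f) => //; exact: (ex_intro _ _ (cderV fa)). Qed.

Lemma cdiffX f a n : cdiff f a -> cdiff (fun x => f x ^+ n) a.
Proof.
move=> fa; elim: n => [|n IH].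
  by rewrite (_ : (fun x => _) = (fun=> 1)); [exact: cdiff_cst|apply/funext => x; rewrite expr0].
rewrite (_ : (fun x => _) = (fun x => f x * f x ^+ n)); first exact: cdiffM.
by apply/funext => x; rewrite exprS.
Qed.

Lemma cdiff_sum (I : Type) (s : seq I) (P : pred I) (F : I -> C -> C) a :
  (forall i, cdiff (F i) a) -> cdiff (fun x => \sum_(i <- s | P i) F i x) a.
Proof.
move=> H; elim: s => [|i s IH].
  by rewrite (_ : (fun x => _) = (fun=> 0)); [exact: cdiff_cst|apply/funext => x; rewrite big_nil].
case: (boolP (P i)) => Pi.
  rewrite (_ : (fun x => _) = (fun x => F i x + \sum_(i <- s | P i) F i x)); first exact: cdiffD.
  by apply/funext => x; rewrite big_cons Pi.
rewrite (_ : (fun x => _) = (fun x => \sum_(i <- s | P i) F i x))//.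
by apply/funext => x; rewrite big_cons (negbTE Pi).
Qed.

Lemma cdiff_prod (I : Type) (s : seq I) (P : pred I) (F : I -> C -> C) a :
  (forall i, cdiff (F i) a) -> cdiff (fun x => \prod_(i <- s | P i) F i x) a.
Proof.
move=> H; elim: s => [|i s IH].
  by rewrite (_ : (fun x => _) = (fun=> 1)); [exact: cdiff_cst|apply/funext => x; rewrite big_nil].
case: (boolP (P i)) => Pi.
  rewrite (_ : (fun x => _) = (fun x => F i x * \prod_(i <- s | P i) F i x)); first exact: cdiffM.
  by apply/funext => x; rewrite big_cons Pi.
rewrite (_ : (fun x => _) = (fun x => \prod_(i <- s | P i) F i x))//.
by apply/funext => x; rewrite big_cons (negbTE Pi).
Qed.

Lemma cdiff_eq f g a : (exists2 d : R, 0 < d & forall h, cmod h < d -> f (a + h) = g (a + h)) ->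
  cdiff f a -> cdiff g a.
Proof. by move=> H [l fl]; exists l; apply: cder_eq H fl. Qed.

Lemma cder_uniq f a l m : cder f a l -> cder f a m -> l = m.
Proof.
move=> fl fm; apply/eqP; rewrite -subr_eq0 -cmod_eq0 eq_le cmod_ge0 andbT.
apply/ler_addgt0Pr => e e0; rewrite add0r.
have e2 : 0 < e / 2 by rewrite divr_gt0.
have [d d0 H] := fl _ e2; have [d' d'0 H'] := fm _ e2.
set t := Num.min d d' / 2.
have t0 : 0 < t by rewrite divr_gt0// lt_min d0.
have td : t < Num.min d d' by rewrite ltr_pdivrMr// ltr_pMr ?ltr1n// lt_min d0.
have ct : cmod t%:C%C = t by rewrite cmod_real gtr0_norm.
move: td; rewrite lt_min -ct => /andP[/H{}H /H'{}H'].
have := le_trans (cmodB _ _) (lerD H' H).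
rewrite (_ : _ - _ - _ - _ = (l - m) * t%:C%C); last by ring.
by rewrite -mulrDl -splitr cmodM ler_pM2r// ct.
Qed.

End ComplexDerivative.

(** * Remainder form of derivatives in normed modules *)

Section DerivativeExpansion.
Variables (K : numFieldType) (V : normedModType K).

Definition first_order (f : K -> V) (a : K) (l : V) := forall e : K, 0 < e ->
  exists2 d : K, 0 < d & forall h, `|h| < d -> `|f (h + a) - f a - h *: l| <= e * `|h|.

Lemma is_derive_first_order (f : K -> V) (a : K) (l : V) : is_derive a 1 f l -> first_order f a l.
Proof.
move=> [df /=]; rewrite /derive => fl e e0.
have : (fun h : K => h^-1 *: (f (h *: 1 + a) - f a)) @ 0^' --> l.
  by rewrite -fl; exact: df.
move=> /cvgrPdist_le /(_ _ e0) /= [d /= d0 H].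
exists d => // h hd; have [->|h0] := eqVneq h 0.
  by rewrite add0r subrr scale0r subr0 normr0 normr0 mulr0.
have := H h; rewrite /ball_ /= sub0r normrN => /(_ hd h0).
rewrite [h *: 1]mulr1 distrC -[X in X - l]/(h^-1 *: (f (h + a) - f a)) => H1.
rewrite (_ : _ - _ = h *: (h^-1 *: (f (h + a) - f a) - l)); last first.
  by rewrite [RHS]scalerBr scalerA divff// scale1r.
by rewrite normrZ mulrC ler_wpM2r.
Qed.

Lemma first_order_derivable (f : K -> V) (a : K) (l : V) : first_order f a l -> derivable f a 1.
Proof.
move=> H; apply/cvg_ex; exists l; apply/cvgrPdist_le => e e0 /=.
have [d d0 Hd] := H e e0; exists d => //= h.
rewrite /ball_ /= sub0r normrN => hd h0.
have := Hd h hd; rewrite [h *: 1]mulr1 => H1.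
rewrite distrC (_ : _ - l = h^-1 *: (f (h + a) - f a - h *: l)); last first.
  by rewrite [RHS]scalerBr scalerA mulVf// scale1r.
by rewrite normrZ normfV mulrC ler_pdivrMr ?normr_gt0.
Qed.

End DerivativeExpansion.

(** * The complex exponential and its derivative *)

Section Exponential.
Variable R : realType.
Local Notation C := (R[i]).

Lemma is_derive_real_expansion (f : R -> R) (a l : R) : is_derive a 1 f l ->
  forall e : R, 0 < e -> exists2 d : R, 0 < d &
    forall h, `|h| < d -> `|f (h + a) - f a - h * l| <= e * `|h|.
Proof. exact: (@is_derive_first_order R R^o). Qed.

Definition cexp (w : C) : C :=
  (expR (complex.Re w))%:C%C * Complex (cos (complex.Im w)) (sin (complex.Im w)).

Lemma cexpD (w h : C) : cexp (w + h) = cexp w * cexp h.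
Proof.
case: w h => [a b] [c d]; rewrite /cexp /= expRD cosD sinD; apply/eqP.
by rewrite eq_complex /=; apply/andP; split; apply/eqP; ring.
Qed.

Lemma cexp0 : cexp 0 = 1.
Proof. by rewrite /cexp /= expR0 cos0 sin0 mul1r. Qed.

Lemma cmod_cos_sin (t : R) : cmod (Complex (cos t) (sin t)) = 1.
Proof. by rewrite /cmod /= cos2Dsin2 sqrtr1. Qed.

Lemma cmod_cexp w : cmod (cexp w) = expR (complex.Re w).
Proof. by rewrite cmodM cmod_cos_sin mulr1 cmod_real gtr0_norm ?expR_gt0. Qed.

Lemma cexp_neq0 w : cexp w != 0.
Proof. by rewrite -cmod_gt0 cmod_cexp expR_gt0. Qed.

Lemma cexp_real (x : R) : cexp x%:C%C = (expR x)%:C%C.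
Proof. by rewrite /cexp /= cos0 sin0 mulr1. Qed.

Lemma cexp_2pi : cexp (Complex 0 (pi *+ 2)) = 1.
Proof. by rewrite /cexp /= expR0 cos2pi sin2pi mul1r. Qed.

Lemma cder_cexp0 : cder cexp 0 1.
Proof.
(* The three error terms receive [e / 8], [e / 4] and [e / 2]. The cap 1 bounds [|u - 1|] by
   [3 |h|], so that the product term [a (u - 1)] is quadratic in [h]. *)
move=> e e0; have e8 : 0 < Num.min (e / 8) 1 by rewrite lt_min divr_gt0 ?ltr01 ?ltr0n.
have [d1 d10 H1] := is_derive_real_expansion (is_derive_expR 0) e8.
have [d2 d20 H2] := is_derive_real_expansion (is_derive_cos 0) e8.
have [d3 d30 H3] := is_derive_real_expansion (is_derive_sin 0) e8.
exists (Num.min (Num.min d1 d2) (Num.min d3 (e / 8))).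
  by rewrite !lt_min d10 d20 d30 divr_gt0.
move=> h; rewrite !lt_min => /andP[/andP[h1 h2] /andP[h3 h4]].
have {}h1 := H1 _ (le_lt_trans (cmod_Re h) h1).
have {}h2 := H2 _ (le_lt_trans (cmod_Im h) h2).
have {}h3 := H3 _ (le_lt_trans (cmod_Im h) h3).
have aR := cmod_Re h; have aI := cmod_Im h.
set a := complex.Re h in h1 aR; set b := complex.Im h in h2 h3 aI.
move: h1 h2 h3; rewrite !addr0 expR0 cos0 sin0 oppr0 mulr0 !mulr1 !subr0 !addr0 => h1 h2 h3.
have hE : h = Complex a b by rewrite /a /b; case: (h).
pose u : C := Complex (cos b) (sin b).
rewrite add0r cexp0 mul1r.
rewrite (_ : _ - _ - _ = (expR a - 1 - a)%:C%C * u + (Complex (cos b - 1) (sin b - b)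
  + a%:C%C * (u - 1))); last first.
  rewrite [in LHS]hE /cexp /u; apply/eqP; rewrite eq_complex /=.
  by apply/andP; split; apply/eqP; ring.
have m0 : Num.min (e / 8) 1 <= e / 8 by rewrite ge_min lexx.
have m1 : Num.min (e / 8) 1 <= 1 by rewrite ge_min lexx orbT.
set m := Num.min _ _ in h1 h2 h3 m0 m1 e8.
have b0 := normr_ge0 b; have a0 := normr_ge0 a.
have k1 : cmod ((expR a - 1 - a)%:C%C * u) <= e / 8 * cmod h.
  rewrite cmodM cmod_cos_sin mulr1 cmod_real (le_trans h1)// ler_pM// ltW//.
have k2 : cmod (Complex (cos b - 1) (sin b - b)) <= e / 4 * cmod h.
  apply: (le_trans (cmod_le_ReIm _)) => /=.
  have k : m * `|b| <= e / 8 * cmod h by rewrite ler_pM// ltW.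
  by lra.
have k3 : cmod (a%:C%C * (u - 1)) <= e / 2 * cmod h.
  rewrite cmodM cmod_real mulrC.
  apply: (@le_trans _ _ (cmod (u - 1) * cmod h)); first by rewrite ler_wpM2l.
  rewrite ler_wpM2r//; apply: (le_trans (cmod_le_ReIm _)) => /=.
  rewrite subr0; have k : m * `|b| <= 1 * cmod h by rewrite ler_pM// ltW.
  have := ler_normD (sin b - b) b; rewrite subrK => ?.
  lra.
apply: (le_trans (cmodD _ _)); have := cmodD (Complex (cos b - 1) (sin b - b)) (a%:C%C * (u - 1)).
have := cmod_ge0 h; nra.
Qed.

Lemma cder_cexp w : cder cexp w (cexp w).
Proof.
move=> e e0; have w0 : 0 < cmod (cexp w) by rewrite cmod_gt0 cexp_neq0.
have [d d0 H] := cder_cexp0 (divr_gt0 e0 w0).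
exists d => // h /H; rewrite add0r cexp0 mul1r => {}H.
rewrite cexpD (_ : _ - _ - _ = cexp w * (cexp h - 1 - h)); last by ring.
by rewrite cmodM mulrC -ler_pdivlMr// (le_trans H)// mulrAC.
Qed.

End Exponential.

(** * Eventual properties and null sequences *)

Section Eventually.
Variable R : realType.
Local Notation C := (R[i]).

Definition ev (P : nat -> Prop) := exists k0, forall k, (k0 <= k)%N -> P k.

Lemma ev_and (P Q : nat -> Prop) : ev P -> ev Q -> ev (fun k => P k /\ Q k).
Proof.
move=> [k1 H1] [k2 H2]; exists (maxn k1 k2) => k; rewrite geq_max => /andP[h1 h2].
by split; [apply: H1|apply: H2].
Qed.

Lemma ev_mono (P Q : nat -> Prop) : (forall k, P k -> Q k) -> ev P -> ev Q.
Proof. by move=> PQ [k0 H]; exists k0 => k /H/PQ. Qed.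

Lemma ev_all (P : nat -> Prop) : (forall k, P k) -> ev P.
Proof. by move=> H; exists 0%N. Qed.

(** Bisection expresses a sum of level [k.+1] through sums of level [k], so estimates are first
    obtained at [k.+1]. *)
Lemma ev_pred (P : nat -> Prop) : ev (fun k => P k.+1) -> ev P.
Proof. by move=> [k0 H]; exists k0.+1 => -[//|k] /H. Qed.

Lemma ev_ex (P : nat -> Prop) : ev P -> exists k, P k.
Proof. by move=> [k0 H]; exists k0; apply: H. Qed.

Definition null_seq (u : nat -> C) := forall e : R, 0 < e -> ev (fun k => cmod (u k) <= e).

Lemma null_seqD u v : null_seq u -> null_seq v -> null_seq (fun k => u k + v k).
Proof.
move=> Hu Hv e e0; have e2 : 0 < e / 2 by rewrite divr_gt0.
apply: ev_mono (ev_and (Hu _ e2) (Hv _ e2)) => k [h1 h2].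
by rewrite (le_trans (cmodD _ _))// (le_trans (lerD h1 h2))// -splitr.
Qed.

Lemma null_seqZ c u : null_seq u -> null_seq (fun k => c * u k).
Proof.
move=> Hu e e0; have c0 : 0 < cmod c + 1 by rewrite ltr_wpDl ?ltr01 ?cmod_ge0.
apply: ev_mono (Hu _ (divr_gt0 e0 c0)) => k h.
rewrite cmodM (le_trans (ler_wpM2l (cmod_ge0 _) h))// mulrA ler_pdivrMr// mulrC.
by rewrite ler_pM2l// lerDl.
Qed.

Lemma null_seqN u : null_seq u -> null_seq (fun k => - u k).
Proof. by move=> Hu e /Hu; apply: ev_mono => k; rewrite cmodN. Qed.

Lemma null_seqB u v : null_seq u -> null_seq v -> null_seq (fun k => u k - v k).
Proof. by move=> Hu /null_seqN; apply: null_seqD. Qed.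

Lemma null_seq_eq u v : u =1 v -> null_seq u -> null_seq v.
Proof. by move=> uv Hu e /Hu; apply: ev_mono => k; rewrite uv. Qed.

(** This is the way back from discrete means: a bound valid for every mean is inherited by the
    number they approximate. *)
Lemma null_seq_bound (c : C) (B : R) u : null_seq (fun k => c - u k) ->
  (forall k, cmod (u k) <= B) -> cmod c <= B.
Proof.
move=> H HB; apply/ler_addgt0Pr => e e0; have [k hk] := ev_ex (H _ e0).
by rewrite -[c](subrK (u k)) (le_trans (cmodD _ _))// addrC lerD.
Qed.

End Eventually.

(** * Goursat's lemma on parallelograms *)

Section Goursat.
Variable R : realType.
Local Notation C := (R[i]).
Implicit Types (g : C -> C) (w p q d : C).

(** Left Riemann sum of the integral of [g] over the segment from [w] to [w + d]. With [2 ^ k]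
    nodes, cutting the segment in two halves is an exact identity. *)
Definition line_sum g (k : nat) w d : C :=
  d * ((2 ^+ k)^-1 * \sum_(j < 2 ^ k) g (w + d * (j%:R / 2 ^+ k))).

Lemma line_sumS g k w d :
  line_sum g k.+1 w d = line_sum g k w (d / 2) + line_sum g k (w + d / 2) (d / 2).
Proof.
have n2 : (2 ^+ k : C) != 0 by rewrite expf_neq0// pnatr_eq0.
rewrite /line_sum (_ : (2 ^ k.+1)%N = (2 ^ k + 2 ^ k)%N); last by rewrite expnS mul2n addnn.
rewrite big_split_ord /= exprS -mulrDr.
rewrite (eq_bigr (fun j : 'I_(2 ^ k) => g (w + d / 2 * (j%:R / 2 ^+ k)))); last first.
  by move=> j _; congr g; congr (_ + _); field; rewrite ?n2.
rewrite [X in _ * (_ * (_ + X)) = _](eq_bigr (fun j : 'I_(2 ^ k) =>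
   g (w + d / 2 + d / 2 * (j%:R / 2 ^+ k)))); last first.
  by move=> j _; congr g; rewrite natrD natrX -[RHS]addrA; congr (_ + _); field; rewrite ?n2.
by field; rewrite ?n2.
Qed.

Lemma line_sum_bound g k w d (B : R) :
  (forall s : R, 0 <= s <= 1 -> cmod (g (w + s%:C%C * d)) <= B) ->
  cmod (line_sum g k w d) <= cmod d * B.
Proof.
move=> H; rewrite cmodM ler_wpM2l// cmodM cmodV cmodX cmod_nat.
rewrite mulrC ler_pdivrMr ?exprn_gt0//; apply: (le_trans (cmod_sum _ _ _)).
apply: (@le_trans _ _ (\sum_(j < 2 ^ k) B)); last first.
  by rewrite sumr_const card_ord -[_ *+ _]mulr_natr natrX.
apply: ler_sum => j _.
have -> : d * (j%:R / 2 ^+ k) = (j%:R / 2 ^+ k : R)%:C%C * d.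
  by rewrite mulrC rmorphM fmorphV rmorphXn /= !rmorph_nat.
apply: H; rewrite divr_ge0 ?exprn_ge0//= ler_pdivrMr ?exprn_gt0// mul1r -natrX ler_nat.
exact: ltnW.
Qed.

(** The discretisation error depends on [d] and [k] but not on [w]. It therefore cancels between
    parallel sides, and the sum of an affine map around a parallelogram is exactly 0 at each
    level. *)
Lemma line_sum_affine (c l : C) k w d : line_sum (fun z => c + l * z) k w d =
  d * (c + l * w) + l * d ^+ 2 * ((2 ^+ k)^-1 * \sum_(j < 2 ^ k) (j%:R / 2 ^+ k)).
Proof.
rewrite /line_sum.
rewrite (eq_bigr (fun j : 'I_(2 ^ k) => (c + l * w) + (l * d) * (j%:R / 2 ^+ k))); last first.
  by move=> j _; ring.
have n2 : (2 ^+ k : C) != 0 by rewrite expf_neq0// pnatr_eq0.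
by rewrite big_split /= -mulr_sumr sumr_const card_ord -[(c + l * w) *+ _]mulr_natr natrX; field; rewrite ?n2.
Qed.

Lemma line_sumB g1 g2 k w d :
  line_sum (fun z => g1 z - g2 z) k w d = line_sum g1 k w d - line_sum g2 k w d.
Proof. by rewrite /line_sum sumrB !mulrBr. Qed.

Definition para_sum g k w p q : C :=
  line_sum g k w p + line_sum g k (w + p) q - line_sum g k (w + q) p - line_sum g k w q.

Lemma para_sumS g k w p q : para_sum g k.+1 w p q =
  para_sum g k w (p / 2) (q / 2) + para_sum g k (w + p / 2) (p / 2) (q / 2)
  + para_sum g k (w + q / 2) (p / 2) (q / 2)
  + para_sum g k (w + p / 2 + q / 2) (p / 2) (q / 2).
Proof.
rewrite /para_sum !line_sumS.
rewrite -[w + p / 2 + p / 2]addrA -splitr -[w + q / 2 + q / 2]addrA -splitr.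
rewrite (_ : w + p / 2 + q / 2 + q / 2 = w + q + p / 2); last by field.
rewrite (_ : w + p / 2 + q / 2 + p / 2 = w + p + q / 2); last by field.
rewrite (_ : w + q / 2 + p / 2 = w + p / 2 + q / 2); last by ring.
ring.
Qed.

Definition para w p q : set C := [set z | exists s t : R,
  [/\ 0 <= s <= 1, 0 <= t <= 1 & z = w + s%:C%C * p + t%:C%C * q]].

Lemma para_sum_bound g k w p q (B : R) :
  (forall z, para w p q z -> cmod (g z) <= B) ->
  cmod (para_sum g k w p q) <= 2 * (cmod p + cmod q) * B.
Proof.
move=> H; rewrite /para_sum.
have i0 : 0 <= (0 : R) <= 1 by rewrite lexx ler01.
have i1 : 0 <= (1 : R) <= 1 by rewrite lexx ler01.
have H1 : cmod (line_sum g k w p) <= cmod p * B.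
  apply: line_sum_bound => s hs; apply: H; exists s, 0; split=> //.
  by rewrite mul0r addr0.
have H2 : cmod (line_sum g k (w + p) q) <= cmod q * B.
  apply: line_sum_bound => s hs; apply: H; exists 1, s; split=> //.
  by rewrite mul1r.
have H3 : cmod (line_sum g k (w + q) p) <= cmod p * B.
  apply: line_sum_bound => s hs; apply: H; exists s, 1; split=> //.
  by rewrite mul1r; ring.
have H4 : cmod (line_sum g k w q) <= cmod q * B.
  apply: line_sum_bound => s hs; apply: H; exists 0, s; split=> //.
  by rewrite mul0r; ring.
have A1 := cmodB (line_sum g k w p + line_sum g k (w + p) q - line_sum g k (w + q) p) (line_sum g k w q).
have A2 := cmodB (line_sum g k w p + line_sum g k (w + p) q) (line_sum g k (w + q) p).
have A3 := cmodD (line_sum g k w p) (line_sum g k (w + p) q).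
lra.
Qed.

Lemma para_sum_affine (c l : C) k w p q : para_sum (fun z => c + l * z) k w p q = 0.
Proof. by rewrite /para_sum !line_sum_affine; ring. Qed.

Lemma para_sumB g1 g2 k w p q :
  para_sum (fun z => g1 z - g2 z) k w p q = para_sum g1 k w p q - para_sum g2 k w p q.
Proof. by rewrite /para_sum !line_sumB; ring. Qed.

Lemma bisection_point (a : nat -> R) (b : nat -> bool) : a 0%N = 0 ->
  (forall n, a n.+1 = a n + (b n)%:R / 2 ^+ n.+1) ->
  exists2 x : R, 0 <= x <= 1 & forall n, a n <= x <= a n + (2 ^+ n)^-1.
Proof.
move=> a0 aS.
have pos n : (0 : R) < 2 ^+ n by rewrite exprn_gt0.
have up n : a n <= a n.+1 by rewrite aS lerDl divr_ge0// ?ler0n// ltW.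
have dn n : a n.+1 + (2 ^+ n.+1)^-1 <= a n + (2 ^+ n)^-1.
  rewrite aS -addrA lerD2l.
  have -> : (2 ^+ n)^-1 = (2 ^+ n.+1)^-1 + (2 ^+ n.+1)^-1 :> R.
    by rewrite exprS; field; rewrite gt_eqF.
  rewrite lerD2r; case: (b n); first by rewrite mul1r.
  by rewrite mul0r invr_ge0 ltW.
have H n m : a n <= a m + (2 ^+ m)^-1.
  have mono i j : (i <= j)%N -> a i <= a j.
    by apply: (@homo_leq _ a (fun x y => x <= y)) => // x y z; apply: le_trans.
  have anti i j : (i <= j)%N -> a j + (2 ^+ j)^-1 <= a i + (2 ^+ i)^-1.
    apply: (@homo_leq _ (fun i => a i + (2 ^+ i)^-1) (fun x y => y <= x)) => // x y z h1 h2.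
    exact: le_trans h2 h1.
  case: (leqP n m) => [/mono h|/ltnW/anti h].
    by apply: (le_trans h); rewrite lerDl invr_ge0 ltW.
  by apply: le_trans h; rewrite lerDl invr_ge0 ltW.
have hs : has_sup (range a).
  by split; [exists (a 0%N), 0%N|exists (a 0%N + (2 ^+ 0)^-1) => _ [n _ <-]].
have K n : a n <= sup (range a) <= a n + (2 ^+ n)^-1.
  apply/andP; split; first by apply: ub_le_sup; [exact: hs.2|exists n].
  by apply: ge_sup; [exact: hs.1|move=> _ [m _ <-]].
exists (sup (range a)) => //.
by have := K 0%N; rewrite a0 expr0 invr1 add0r.
Qed.

Lemma exists_half_pow_lt (e : R) : 0 < e -> exists n, (2 ^+ n)^-1 < e.
Proof.
move=> e0; exists (Num.truncn e^-1); rewrite invf_plt ?posrE ?exprn_gt0//.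
apply: (lt_le_trans (truncnS_gt _)); rewrite -natrX ler_nat.
by rewrite ltn_expl.
Qed.

(** Quadrisection, with an eventual bound in [k] in the role of a bound on the integral. A box is
    good at depth [n] if its sums are eventually at most [c / 4 ^ n]; four good children make a good
    parent, so bad boxes shrink to a point [z], where the first-order expansion makes a small box
    good. *)
Theorem goursat g w p q : (forall z, para w p q z -> cdiff g z) ->
  null_seq (fun k => para_sum g k w p q).
Proof.
move=> Hg c c0; apply: contrapT => bad0.
pose box (n : nat) (x : R * R) : C := w + x.1%:C%C * p + x.2%:C%C * q.
pose good (n : nat) (x : R * R) := ev (fun k =>
  cmod (para_sum g k (box n x) (p / 2 ^+ n) (q / 2 ^+ n)) <= c / 4 ^+ n).
pose child n (x : R * R) (b : bool * bool) : R * R :=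
  (x.1 + b.1%:R / 2 ^+ n.+1, x.2 + b.2%:R / 2 ^+ n.+1).
(* The implication sits under the existential so that choice gives a total function: a good box may
   take any child. *)
have step (nx : nat * (R * R)) : exists b, ~ good nx.1 nx.2 -> ~ good nx.1.+1 (child nx.1 nx.2 b).
  case: nx => n x /=; apply: contrapT => /forallNP H.
  have Hc b : good n.+1 (child n x b).
    by apply: contrapT => Hb; apply: (H b).
  apply: (H (false, false)) => Hn; exfalso; apply: Hn; apply: ev_pred.
  apply: ev_mono (ev_and (ev_and (Hc (false, false)) (Hc (true, false)))
     (ev_and (Hc (false, true)) (Hc (true, true)))) => k [[h1 h2] [h3 h4]].
  rewrite para_sumS.
  have hp : p / 2 ^+ n / 2 = p / 2 ^+ n.+1 by rewrite -mulrA -invfM -exprSr.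
  have hq : q / 2 ^+ n / 2 = q / 2 ^+ n.+1 by rewrite -mulrA -invfM -exprSr.
  have c4 : c / 4 ^+ n = c / 4 ^+ n.+1 * 4.
    by rewrite exprS; field; rewrite expf_neq0.
  rewrite c4 hp hq.
  have e (b : bool * bool) : box n.+1 (child n x b) =
     box n x + b.1%:R * (p / 2 ^+ n.+1) + b.2%:R * (q / 2 ^+ n.+1).
    rewrite /box /child /= !rmorphD !rmorphM !fmorphV !rmorphXn /= !rmorph_nat.
    by ring.
  move: h1 h2 h3 h4; rewrite !e /= !mul0r !mul1r !addr0 => h1 h2 h3 h4.
  apply: (le_trans (cmodD _ _)).
  have A2 := cmodD (para_sum g k (box n x) (p / 2 ^+ n.+1) (q / 2 ^+ n.+1)
    + para_sum g k (box n x + p / 2 ^+ n.+1) (p / 2 ^+ n.+1) (q / 2 ^+ n.+1))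
    (para_sum g k (box n x + q / 2 ^+ n.+1) (p / 2 ^+ n.+1) (q / 2 ^+ n.+1)).
  have A3 := cmodD (para_sum g k (box n x) (p / 2 ^+ n.+1) (q / 2 ^+ n.+1))
    (para_sum g k (box n x + p / 2 ^+ n.+1) (p / 2 ^+ n.+1) (q / 2 ^+ n.+1)).
  lra.
have [F HF] := choice step.
pose fix f n : R * R := if n is m.+1 then child m (f m) (F (m, f m)) else (0, 0).
have fbad n : ~ good n (f n).
  elim: n => [|n IH]; last exact: (HF (n, f n)).
  rewrite /good /box /= !mul0r !addr0 !expr0; apply: contra_not bad0.
  by apply: ev_mono => k; rewrite !divr1.
have [s s01 Hs] := @bisection_point (fun n => (f n).1) (fun n => (F (n, f n)).1) erefl (fun n => erefl).
have [t t01 Ht] := @bisection_point (fun n => (f n).2) (fun n => (F (n, f n)).2) erefl (fun n => erefl).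
pose z := w + s%:C%C * p + t%:C%C * q.
have [l Hl] : cdiff g z by apply: Hg; exists s, t.
pose T := cmod p + cmod q; have T0 : 0 <= T by rewrite addr_ge0.
have T1 : 0 < T + 1 by rewrite ltr_wpDl ?ltr01.
(* A perimeter [2 T / 2 ^ n] times a remainder [e T / 2 ^ n] must stay below [c / 4 ^ n]; [T + 1]
   avoids dividing by 0. *)
pose e := c / (2 * (T + 1) ^+ 2).
have e0 : 0 < e by rewrite divr_gt0// mulr_gt0// exprn_gt0.
have [d d0 Hd] := Hl e e0.
have [n Hn] := exists_half_pow_lt (divr_gt0 d0 T1).
have n0 : (0 : R) < (2 ^+ n)^-1 by rewrite invr_gt0 exprn_gt0.
apply: (fbad n); apply: ev_all => k.
(* The affine part of the expansion at [z] is subtracted at no cost. *)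
have -> : para_sum g k (box n (f n)) (p / 2 ^+ n) (q / 2 ^+ n) =
  para_sum (fun y => g y - ((g z - l * z) + l * y)) k (box n (f n)) (p / 2 ^+ n) (q / 2 ^+ n).
  by rewrite para_sumB para_sum_affine subr0.
have cd (x : C) : cmod (x / 2 ^+ n) = cmod x * (2 ^+ n)^-1.
  by rewrite cmodM cmodV cmodX cmod_nat.
apply: (@le_trans _ _ (2 * (cmod (p / 2 ^+ n) + cmod (q / 2 ^+ n)) * (e * (T * (2 ^+ n)^-1)))).
  apply: para_sum_bound => y [s' [t' [/andP[s'0 s'1] /andP[t'0 t'1] ->]]].
  pose h := ((f n).1 + s' * (2 ^+ n)^-1 - s)%:C%C * p + ((f n).2 + t' * (2 ^+ n)^-1 - t)%:C%C * q.
  have yE : box n (f n) + s'%:C%C * (p / 2 ^+ n) + t'%:C%C * (q / 2 ^+ n) = z + h.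
    rewrite /box /z /h !rmorphB !rmorphD !rmorphM !fmorphV !rmorphXn /= !rmorph_nat.
    by ring.
  have hT : cmod h <= T * (2 ^+ n)^-1.
    apply: (le_trans (cmodD _ _)); rewrite !cmodM !cmod_real /T mulrDl.
    rewrite ![_ * (2 ^+ n)^-1]mulrC; apply: lerD; apply: ler_wpM2r => //; rewrite ler_norml.
      have /andP[a1 a2] := Hs n; apply/andP; split; first nra. nra.
    have /andP[a1 a2] := Ht n; apply/andP; split; first nra. nra.
  rewrite yE (_ : _ - _ = g (z + h) - g z - l * h); last by ring.
  apply: (le_trans (Hd _ _)); last by rewrite ler_wpM2l// ltW.
  apply: (le_lt_trans hT); move: Hn; rewrite ltr_pdivlMr// => Hn; nra.
rewrite !cd -mulrDl -/T /e.
have -> : c / 4 ^+ n = c * ((2 ^+ n)^-1 * (2 ^+ n)^-1) by rewrite -invfM -exprMn -natrM.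
rewrite (_ : _ * _ * _ = c * ((2 ^+ n)^-1 * (2 ^+ n)^-1) * (T ^+ 2 / (T + 1) ^+ 2)); last first.
  by field; rewrite gt_eqF//= expf_neq0.
rewrite ler_piMr// ?mulr_ge0 ?(ltW c0) ?(ltW n0)//.
rewrite ler_pdivrMr ?exprn_gt0// mul1r ler_pXn2r ?nnegrE// ?(ltW T1)//.
by rewrite lerDl.
Qed.


Definition free_pair p q := forall s t : R, s%:C%C * p + t%:C%C * q = 0 -> s = 0 /\ t = 0.

Lemma free_pair_half p q : free_pair p q -> free_pair (p / 2) (q / 2).
Proof.
move=> H s t e; apply: H; apply/eqP; rewrite -(mulIr_eq0 _ (@mulIf _ 2^-1 _)) ?invr_eq0 ?pnatr_eq0//.
by rewrite mulrDl -!mulrA e.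
Qed.

Lemma para_child (a b : bool) w p q z :
  para (w + a%:R * (p / 2) + b%:R * (q / 2)) (p / 2) (q / 2) z -> para w p q z.
Proof.
move=> [s [t [/andP[s0 s1] /andP[t0 t1] ->]]].
exists ((a%:R + s) / 2), ((b%:R + t) / 2); split.
- by case: a; apply/andP; split => /=; lra.
- by case: b; apply/andP; split => /=; lra.
rewrite !rmorphM !rmorphD !fmorphV /= !rmorph_nat; by field.
Qed.

(* Cutting into four and recursing into the child containing the singular
   corner, the other three children contribute nothing. *)
Lemma goursat_corner g (a b : bool) (B : R) w p q : free_pair p q ->
  (forall z, para w p q z -> cmod (g z) <= B) ->
  (forall z, para w p q z -> z != w + a%:R * p + b%:R * q -> cdiff g z) ->
  null_seq (fun k => para_sum g k w p q).
Proof.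
(* After [n] cuts the trivial bound on the box at the singular corner is [2 ^ n] times smaller,
   hence the induction on [n] with [c] arbitrary. *)
move=> Fpq gB gd; suff H n c : 2 * (cmod p + cmod q) * B / 2 ^+ n < c ->
    ev (fun k => cmod (para_sum g k w p q) <= c).
  have B0 : 0 <= B.
    apply: le_trans (gB w _) => //; exists 0, 0; rewrite lexx ler01; split=> //.
    by rewrite !mul0r !addr0.
  move=> c c0; set T := 2 * (cmod p + cmod q) * B in H.
  have T0 : 0 <= T by rewrite !mulr_ge0 ?addr_ge0.
  have [n Hn] := exists_half_pow_lt (divr_gt0 c0 (ltr_wpDl T0 ltr01)).
  apply: (H n); move: Hn; rewrite ltr_pdivlMr ?ltr_wpDl ?ltr01// => Hn.
  have i0 : (0 : R) < (2 ^+ n)^-1 by rewrite invr_gt0 exprn_gt0.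
  by nra.
elim: n c w p q Fpq gB gd => [|n IH] c w p q Fpq gB gd.
  rewrite expr0 divr1 => /ltW Bc; apply: ev_all => k.
  by apply: le_trans Bc; apply: para_sum_bound.
move=> Hc.
(* The singular child gets [c']; the margin [c - c'] is split among the three regular children. *)
have [c' [cc' c'c]] : exists c', 2 * (cmod (p / 2) + cmod (q / 2)) * B / 2 ^+ n < c' /\ c' < c.
  exists ((2 * (cmod (p / 2) + cmod (q / 2)) * B / 2 ^+ n + c) / 2).
  have n2 : (2 : R) ^+ n != 0 by rewrite expf_neq0.
  suff : 2 * (cmod (p / 2) + cmod (q / 2)) * B / 2 ^+ n < c by move=> ?; lra.
  apply: le_lt_trans Hc; rewrite !cmodM !cmodV cmod_nat exprS le_eqVlt; apply/orP; left.
  by apply/eqP; field; rewrite n2.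
have Hch (x : bool * bool) : ev (fun k => cmod (para_sum g k
    (w + x.1%:R * (p / 2) + x.2%:R * (q / 2)) (p / 2) (q / 2)) <= 
    (if x == (a, b) then c' else (c - c') / 3)).
  case: eqP => [->|xab] /=.
    apply: IH cc'.
    - exact: free_pair_half.
    - by move=> z /para_child/gB.
    - move=> z zp zn; apply: gd; first exact: para_child zp.
      apply: contra_neq zn => ->.
      by field.
  apply: goursat; last by rewrite divr_gt0// subr_gt0.
  move=> z zp; apply: gd; first exact: para_child zp.
  apply/negP => /eqP ze; apply: xab; case: zp => s [t [/andP[s0 s1] /andP[t0 t1] zE]].
  (* If [z] were the singular corner, independence of the sides would identify its coordinates with
     those of the corner, which only one child attains. *)
  have := Fpq ((x.1%:R + s) / 2 - a%:R) ((x.2%:R + t) / 2 - b%:R).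
  case: x zE => x1 x2 /= zE [].
    rewrite !rmorphB !rmorphM !rmorphD !fmorphV /= !rmorph_nat.
    rewrite [LHS](_ : _ = z - (w + a%:R * p + b%:R * q)); last by rewrite zE; field.
    by rewrite ze subrr.
  clear -s0 s1 t0 t1; case: a x1 => -[] /=; case: b x2 => -[] //= *; exfalso; lra.
apply: ev_pred.
apply: ev_mono (ev_and (ev_and (Hch (false, false)) (Hch (true, false)))
     (ev_and (Hch (false, true)) (Hch (true, true)))) => k [[h1 h2] [h3 h4]].
rewrite para_sumS.
move: h1 h2 h3 h4; rewrite /= !mul0r !mul1r !addr0 => h1 h2 h3 h4.
apply: (le_trans (cmodD _ _)).
have A2 := cmodD (para_sum g k w (p / 2) (q / 2)
    + para_sum g k (w + p / 2) (p / 2) (q / 2))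
    (para_sum g k (w + q / 2) (p / 2) (q / 2)).
have A3 := cmodD (para_sum g k w (p / 2) (q / 2))
    (para_sum g k (w + p / 2) (p / 2) (q / 2)).
clear -h1 h2 h3 h4 A2 A3; move: h1 h2 h3 h4; case: a; case: b; rewrite /= => *; lra.
Qed.

End Goursat.

(** * Discrete means over circles *)

Section CircleMean.
Variable R : realType.
Local Notation C := (R[i]).
Implicit Types (f g h : C -> C) (z : C).

Definition tau : C := Complex 0 (pi *+ 2).

(** Discretises the integral of [h(z) / (2 pi i z)] over the circle of radius [r]. *)
Definition cmean h k (r : R) : C :=
  (2 ^+ k)^-1 * \sum_(j < 2 ^ k) h (r%:C%C * cexp (tau * (j%:R / 2 ^+ k))).

Lemma tau_neq0 : tau != 0.
Proof. by rewrite eq_complex /= eqxx /= mulrn_eq0 /= gt_eqF ?pi_gt0. Qed.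

Lemma cexp_tau z : cexp (z + tau) = cexp z.
Proof. by rewrite cexpD cexp_2pi mulr1. Qed.

Lemma cmod_cexp_tau k (j : nat) : cmod (cexp (tau * (j%:R / 2 ^+ k))) = 1.
Proof.
rewrite cmod_cexp (_ : _ / _ = (j%:R / 2 ^+ k : R)%:C%C); last first.
  by rewrite rmorphM fmorphV rmorphXn /= !rmorph_nat.
by rewrite /= mul0r mulr0 subrr expR0.
Qed.

Lemma cmod_circle_pt k (j : nat) (r : R) : 0 <= r ->
  cmod (r%:C%C * cexp (tau * (j%:R / 2 ^+ k))) = r.
Proof. by move=> r0; rewrite cmodM cmod_cexp_tau mulr1 cmod_real ger0_norm. Qed.

Lemma cmean_bound h k (r B : R) : 0 <= r ->
  (forall z, cmod z = r -> cmod (h z) <= B) -> cmod (cmean h k r) <= B.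
Proof.
move=> r0 H; rewrite cmodM cmodV cmodX cmod_nat.
rewrite mulrC ler_pdivrMr ?exprn_gt0//; apply: (le_trans (cmod_sum _ _ _)).
apply: (@le_trans _ _ (\sum_(j < 2 ^ k) B)); last first.
  by rewrite sumr_const card_ord -[_ *+ _]mulr_natr natrX.
by apply: ler_sum => j _; apply: H; rewrite cmod_circle_pt.
Qed.

Lemma cmeanB g h k r : cmean (fun z => g z - h z) k r = cmean g k r - cmean h k r.
Proof. by rewrite /cmean sumrB mulrBr. Qed.

Lemma cmeanD g h k r : cmean (fun z => g z + h z) k r = cmean g k r + cmean h k r.
Proof. by rewrite /cmean big_split mulrDr. Qed.

Lemma cmeanZ (c : C) h k r : cmean (fun z => c * h z) k r = c * cmean h k r.
Proof. by rewrite /cmean -mulr_sumr mulrCA. Qed.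

Lemma cmean_cst (c : C) k r : cmean (fun=> c) k r = c.
Proof.
rewrite /cmean sumr_const card_ord -[c *+ _]mulr_natr natrX mulrC mulfK//.
Qed.

Lemma eq_cmean g h k r : 0 <= r -> (forall z, cmod z = r -> g z = h z) -> cmean g k r = cmean h k r.
Proof.
move=> r0 H; rewrite /cmean; congr (_ * _); apply: eq_bigr => j _.
by rewrite H// cmod_circle_pt.
Qed.

Lemma line_sum_cexp h k (s : R) :
  line_sum (h \o @cexp R) k s%:C%C tau = tau * cmean h k (expR s).
Proof.
rewrite /line_sum /cmean; do 2 congr (_ * _); apply: eq_bigr => j _ /=.
by rewrite cexpD cexp_real.
Qed.

(** The two horizontal sides differ by the period [tau] and cancel, so only the two vertical sides,
    that is the two circles, remain. *)
Lemma para_sum_cexp h k (s d : R) :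
  para_sum (h \o @cexp R) k s%:C%C d%:C%C tau =
  tau * (cmean h k (expR (s + d)) - cmean h k (expR s)).
Proof.
rewrite /para_sum -rmorphD !line_sum_cexp.
rewrite (_ : line_sum _ k (_ + tau) _ = line_sum (h \o @cexp R) k s%:C%C d%:C%C).
  by ring.
rewrite /line_sum; do 2 congr (_ * _); apply: eq_bigr => j _ /=.
by congr h; rewrite addrAC cexp_tau.
Qed.

Lemma null_seq_mulI (c : C) u : c != 0 -> null_seq (fun k => c * u k) -> null_seq u.
Proof.
move=> c0 /(null_seqZ c^-1); apply: null_seq_eq => k.
by rewrite mulrA mulVf// mul1r.
Qed.

Lemma para_strip (s d c : R) z : 0 <= d -> para s%:C%C d%:C%C (Complex 0 c) z ->
  s <= complex.Re z <= s + d /\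
  exists2 t : R, 0 <= t <= 1 & complex.Im z = t * c.
Proof.
move=> d0 [x [t [/andP[x0 x1] t01 ->]]] /=; split.
  by rewrite !mul0r !mulr0 !subr0 addr0; apply/andP; split; nra.
by exists t => //; rewrite !mul0r !mulr0 !add0r addr0.
Qed.

Lemma annulus_mean h (r1 r2 : R) : 0 < r1 -> r1 <= r2 ->
  (forall z, r1 <= cmod z <= r2 -> cdiff h z) ->
  null_seq (fun k => cmean h k r2 - cmean h k r1).
Proof.
move=> r10 r12 H; apply: (null_seq_mulI tau_neq0).
have r20 : 0 < r2 by apply: lt_le_trans r12.
have d0 : 0 <= ln r2 - ln r1 by rewrite subr_ge0 ler_ln ?posrE.
have : null_seq (fun k => para_sum (h \o @cexp R) k (ln r1)%:C%C (ln r2 - ln r1)%:C%C tau).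
  apply: goursat => z /(para_strip d0)[/andP[z1 z2] _].
  apply: cdiff_comp; first by eexists; apply: cder_cexp.
  apply: H; rewrite cmod_cexp -{1}(lnK r10) -(lnK r20) !ler_expR z1 /=.
  by move: z2; rewrite addrC subrK.
by apply: null_seq_eq => k; rewrite para_sum_cexp [ln r1 + _]addrC subrK !lnK.
Qed.

Lemma cos_eq1 (y : R) : 0 <= y <= pi -> cos y = 1 -> y = 0.
Proof.
move=> y0 cy; apply: (@cos_inj R); rewrite ?cos0// in_itv /= ?lexx ?pi_ge0//.
Qed.

(** The radii [b ^ 2 / r] and [r] are symmetric about [b] on the logarithmic scale. The logarithms
    of [b] in the rectangle, [ln b] and [ln b + tau], are thus the midpoints of the horizontal
    sides, and one subdivision turns them into corners, where [goursat_corner] applies. *)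
Lemma annulus_mean_sing h (b r B : R) : 0 < b -> b <= r ->
  (forall z, b ^+ 2 / r <= cmod z <= r -> z != b%:C%C -> cdiff h z) ->
  (forall z, b ^+ 2 / r <= cmod z <= r -> cmod (h z) <= B) ->
  null_seq (fun k => cmean h k r - cmean h k (b ^+ 2 / r)).
Proof.
move=> b0 br Hd HB; apply: (null_seq_mulI tau_neq0).
have r0 : 0 < r by apply: lt_le_trans br.
pose d := ln r - ln b.
have [rb|dn0] := eqVneq r b.
  have -> : b ^+ 2 / r = r by rewrite rb expr2 mulfK// gt_eqF.
  by move=> e e0; apply: ev_all => k; rewrite subrr mulr0 cmod0 ltW.
have {}dn0 : d != 0.
  by apply: contra_neq dn0 => d0; apply: ln_inj; rewrite ?posrE//; move: d0; rewrite /d; lra.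
have d0 : 0 <= d by rewrite subr_ge0 ler_ln ?posrE.
have r1 : b ^+ 2 / r = expR (ln b - d).
  rewrite (_ : ln b - d = ln b + ln b - ln r); last by rewrite /d; ring.
  by rewrite !expRD expRN !lnK// expr2.
have r2 : r = expR (ln b - d + (d + d)) by rewrite addrA subrK /d addrC subrK lnK.
suff : null_seq (fun k => para_sum (h \o @cexp R) k.+1 (ln b - d)%:C%C (d + d)%:C%C tau).
  move=> Hs e e0; apply: ev_pred; have := Hs e e0; apply: ev_mono => k.
  by rewrite para_sum_cexp -r2 -r1.
have dh : (d + d)%:C%C / 2 = d%:C%C :> C by rewrite rmorphD /=; field.
have th : tau / 2 = Complex 0 pi.
  apply: (@mulIf _ 2); rewrite ?pnatr_eq0// divfK ?pnatr_eq0// mulr_natr mulr2n.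
  by apply/eqP; rewrite eq_complex /= addr0 mulr2n !eqxx.
have Fp : free_pair d%:C%C (Complex 0 pi).
  move=> s t /eqP; rewrite eq_complex /= => /andP[/eqP e1 /eqP e2].
  have pi0 := @pi_gt0 R.
  split.
    have : s * d = 0 by rewrite -e1; ring.
    by move=> /eqP; rewrite mulf_eq0 (negbTE dn0) orbF => /eqP.
  have : t * pi = 0 by rewrite -e2; ring.
  by move=> /eqP; rewrite mulf_eq0 (gt_eqF pi0) orbF => /eqP.
have Q (x1 x2 : bool) : null_seq (fun k => para_sum (h \o @cexp R) k
    ((ln b - d)%:C%C + x1%:R * d%:C%C + x2%:R * Complex 0 pi) d%:C%C (Complex 0 pi)).
  have strip z : para ((ln b - d)%:C%C + x1%:R * d%:C%C + x2%:R * Complex 0 pi) d%:C%C (Complex 0 pi) z ->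
    ln b - d <= complex.Re z <= ln r /\ exists2 t : R, 0 <= t <= 1 & complex.Im z = x2%:R * pi + t * pi.
    move=> [x [t [/andP[s0 s1] t01 ->]]].
    rewrite -!(rmorph_nat (real_complex R)) /=.
    rewrite !mul0r !mulr0 !subr0 !addr0 !add0r.
    have lnr : ln r = ln b + d by rewrite /d addrC subrK.
    split; first by rewrite lnr; apply/andP; split; case: x1 => /=; nra.
    by exists t.
  (* The left quarters have the singular corner on their right, the lower quarters at their
     bottom. *)
  apply: (@goursat_corner _ _ (~~ x1) x2 B) => // z /strip [/andP[z1 z2] [t t01 zI]].
    apply: HB; rewrite cmod_cexp r1 -(lnK r0) !ler_expR z1//.
  move=> zn; apply: cdiff_comp; first by eexists; apply: cder_cexp.
  apply: Hd; first by rewrite cmod_cexp r1 -(lnK r0) !ler_expR z1.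
  apply: contra_neq zn => zb.
  have zR : complex.Re z = ln b.
    by have := cmod_cexp z; rewrite zb cmod_real gtr0_norm// => ->; rewrite expRK.
  have cI : cos (complex.Im z) = 1.
    move: zb => /(congr1 (@complex.Re R)); rewrite /= mul0r subr0 zR lnK//.
    by rewrite -[RHS]mulr1 => /(mulfI (lt0r_neq0 b0)).
  have tE : t = x2%:R.
    move: cI t01 => + /andP[t0 t1]; rewrite zI => cI; have pi0 := @pi_gt0 R.
    case: (x2) cI => /=; rewrite ?mul1r ?mul0r ?add0r => cI.
      have : cos (pi - t * pi) = 1.
        rewrite -[RHS]cI -[RHS]cosN -[RHS]cosD2pi; congr cos; ring.
      move=> /cos_eq1 H; have := H _; have -> : 0 <= pi - t * pi <= pi by apply/andP; split; nra.
      move=> /(_ isT) K; apply: (mulIf (lt0r_neq0 pi0)); lra.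
    have := cos_eq1 _ cI; have -> : 0 <= t * pi <= pi by apply/andP; split; nra.
    by move=> /(_ isT) /eqP; rewrite mulf_eq0 (gt_eqF pi0) orbF => /eqP.
  rewrite (_ : z = Complex (complex.Re z) (complex.Im z)); last by case: (z).
  rewrite zR zI tE -!(rmorph_nat (real_complex R)); apply/eqP; rewrite eq_complex /=.
  by apply/andP; split; apply/eqP; case: (x1); case: (x2); rewrite /=; ring.
have := null_seqD (null_seqD (null_seqD (Q false false) (Q true false)) (Q false true)) (Q true true).
by apply: null_seq_eq => k; rewrite para_sumS dh th /= !mul0r !mul1r !addr0.
Qed.

(** Only continuity is asked at the centre, so that the lemma applies to a difference quotient
    completed there by the derivative. *)
Lemma mean_value h (r : R) : 0 < r -> ccont h 0 ->
  (forall z, 0 < cmod z <= r -> cdiff h z) ->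
  null_seq (fun k => cmean h k r - h 0).
Proof.
move=> r0 hc hd e e0; have [d d0 Hd] := hc _ (divr_gt0 e0 (ltr0n _ 2)).
pose s := Num.min (d / 2) r.
have s0 : 0 < s by rewrite lt_min divr_gt0.
have sr : s <= r by rewrite ge_min lexx orbT.
have sd : s < d by rewrite gt_min ltr_pdivrMr// ltr_pMr// ltr1n.
have := @annulus_mean h s r s0 sr _ _ (divr_gt0 e0 (ltr0n _ 2)).
have H1 z : s <= cmod z <= r -> cdiff h z.
  by move=> /andP[z1 z2]; apply: hd; rewrite z2 (lt_le_trans s0).
move=> /(_ H1); apply: ev_mono => k Hk.
have := @cmean_bound (fun z => h z - h 0) k s (e / 2) (ltW s0).
have H2 z : cmod z = s -> cmod (h z - h 0) <= e / 2.
  by move=> zs; have := Hd z; rewrite add0r zs; apply.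
move=> /(_ H2); rewrite cmeanB cmean_cst => H3.
rewrite -(subrKA (cmean h k s)) (le_trans (cmodD _ _))// (le_trans (lerD Hk H3))//.
by rewrite -splitr.
Qed.

End CircleMean.

(** * Cauchy's formula and estimates *)

Section Cauchy.
Variable R : realType.
Local Notation C := (R[i]).
Implicit Types (f g : C -> C) (z : C).

Lemma pole_neq0 (b z : C) : cmod b < cmod z -> z - b != 0.
Proof. by rewrite subr_eq0; apply: contraTneq => ->; rewrite ltxx. Qed.

(** The means over two circles differ by a null sequence, and on a large circle the integrand is
    uniformly small. [pole_mean] uses in the same way that [z / (z - b)] tends to 1. *)
Lemma inv_mean0 (r : R) : 0 < r -> null_seq (fun k => cmean (@GRing.inv C) k r).
Proof.
move=> r0 e e0; pose s := Num.max r (2 / e).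
have rs : r <= s by rewrite le_max lexx.
have s0 : 0 < s by apply: lt_le_trans rs.
have es : 2 / e <= s by rewrite le_max lexx orbT.
have := @annulus_mean R GRing.inv r s r0 rs _ _ (divr_gt0 e0 (ltr0n _ 2)).
have H1 z : r <= cmod z <= s -> cdiff GRing.inv z.
  move=> /andP[z1 _]; eexists; apply: cderV.
  by rewrite -cmod_gt0 (lt_le_trans r0).
move=> /(_ H1); apply: ev_mono => k; rewrite cmod_distC => Hk.
have := @cmean_bound R GRing.inv k s (e / 2) (ltW s0).
have H2 z : cmod z = s -> cmod z^-1 <= e / 2.
  by move=> zs; rewrite cmodV zs -[leRHS]invrK lef_pV2 ?posrE ?invr_gt0 ?divr_gt0// invf_div.
move=> /(_ H2) H3.
rewrite -[cmean _ _ _](subrK (cmean GRing.inv k s)) (le_trans (cmodD _ _))//.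
by rewrite (le_trans (lerD Hk H3))// -splitr.
Qed.

Lemma pole_mean (b : C) (r : R) : cmod b < r ->
  null_seq (fun k => cmean (fun z => z / (z - b)) k r - 1).
Proof.
move=> br; have r0 : 0 < r by apply: le_lt_trans br.
move=> e e0; pose s := Num.max r (cmod b + 2 * (cmod b + 1) / e).
have rs : r <= s by rewrite le_max lexx.
have s0 : 0 < s by apply: lt_le_trans rs.
have es : cmod b + 2 * (cmod b + 1) / e <= s by rewrite le_max lexx orbT.
have := @annulus_mean R (fun z => z / (z - b)) r s r0 rs _ _ (divr_gt0 e0 (ltr0n _ 2)).
have H1 z : r <= cmod z <= s -> cdiff (fun z => z / (z - b)) z.
  move=> /andP[z1 _]; apply: cdiffM; first exact: cdiff_id.
  apply: cdiffV; first by rewrite pole_neq0// (lt_le_trans br).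
  exact: cdiff_subc.
move=> /(_ H1); apply: ev_mono => k; rewrite cmod_distC => Hk.
have := @cmean_bound R (fun z => z / (z - b) - 1) k s (e / 2) (ltW s0).
have H2 z : cmod z = s -> cmod (z / (z - b) - 1) <= e / 2.
  move=> zs; have bz : cmod b < cmod z by rewrite zs (lt_le_trans br).
  rewrite (_ : _ - 1 = b / (z - b)); last by field; rewrite pole_neq0.
  have zb : s - cmod b <= cmod (z - b) by rewrite -zs cmod_sub_ge.
  have c1 : 0 < cmod b + 1 by rewrite ltr_wpDl ?ltr01.
  have sb : 2 * (cmod b + 1) / e <= s - cmod b by rewrite lerBrDl.
  have sp : 0 < s - cmod b by rewrite (lt_le_trans _ sb)// divr_gt0// mulr_gt0.
  rewrite cmodM cmodV ler_pdivrMr ?(lt_le_trans sp)//.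
  apply: (@le_trans _ _ (e / 2 * (s - cmod b))); last by rewrite ler_wpM2l// divr_ge0// ltW.
  move: sb; rewrite ler_pdivrMr// => sb; have := cmod_ge0 b; nra.
move=> /(_ H2); rewrite cmeanB cmean_cst => H3.
rewrite -(subrKA (cmean (fun z => z / (z - b)) k s)) (le_trans (cmodD _ _))//.
by rewrite (le_trans (lerD Hk H3))// -splitr.
Qed.

(** The function [h] is bounded, singular at most at [b], and vanishes at 0. Its means can be moved
    across [b] to the radius [b ^ 2 / r < b], where the mean value property makes them null; the
    constant [f b] then contributes through [pole_mean]. *)
Lemma cauchy_real f (b r K : R) : 0 < b -> b < r ->
  (forall z, cmod z <= r -> cdiff f z) -> (forall z, cmod z <= r -> cmod (f z) <= K) ->
  null_seq (fun k => cmean (fun z => f z * (z / (z - b%:C%C))) k r - f b%:C%C).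
Proof.
move=> b0 br fd fK; have r0 : 0 < r by apply: lt_trans br.
have cb : cmod b%:C%C = b by rewrite cmod_real gtr0_norm.
pose h z := z * ((f z - f b%:C%C) / (z - b%:C%C)).
have [l Hl] : cdiff f b%:C%C by apply: fd; rewrite cb ltW.
have [d d0 Hd] := cder_lip Hl.
have K0 : 0 <= K by rewrite (le_trans _ (fK 0 _))// cmod0 ltW.
have hB z : cmod z <= r -> cmod (h z) <= r * (cmod l + 1) + r * (2 * K / d).
  move=> zr; have lp : 0 <= r * (cmod l + 1) by rewrite mulr_ge0 ?addr_ge0 ?(ltW r0)// ?ler01.
  have dp : 0 <= r * (2 * K / d) by rewrite !mulr_ge0 ?invr_ge0 ?(ltW r0) ?(ltW d0)//.
  rewrite /h; have [->|zb] := eqVneq z b%:C%C.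
    by rewrite !subrr mul0r mulr0 cmod0 addr_ge0.
  have zb0 : 0 < cmod (z - b%:C%C) by rewrite cmod_gt0 subr_eq0.
  rewrite cmodM cmodM cmodV; case: (ltP (cmod (z - b%:C%C)) d) => zd.
    apply: (@le_trans _ _ (r * (cmod l + 1))); last by rewrite lerDl.
    rewrite ler_pM ?divr_ge0// ler_pdivrMr//.
    by have := Hd _ zd; rewrite [b%:C%C + _]addrC subrK.
  apply: (@le_trans _ _ (r * (2 * K / d))); last by rewrite lerDr.
  rewrite ler_pM ?divr_ge0// ler_pM ?invr_ge0// ?lef_pV2 ?posrE//.
  apply: (le_trans (cmodB _ _)); have := fK _ zr; have := fK b%:C%C; rewrite cb.
  by move=> /(_ (ltW br)); lra.
have hd z : cmod z <= r -> z != b%:C%C -> cdiff h z.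
  move=> zr zb; apply: cdiffM; first exact: cdiff_id.
  apply: cdiffM; first by apply: cdiffB; [exact: fd|exact: cdiff_cst].
  by apply: cdiffV; [rewrite subr_eq0|exact: cdiff_subc].
have H1 : null_seq (fun k => cmean h k r - cmean h k (b ^+ 2 / r)).
  by apply: (annulus_mean_sing b0 (ltW br)) => z /andP[_ zr]; [exact: hd|exact: hB].
have br2 : b ^+ 2 / r < b by rewrite ltr_pdivrMr// expr2 ltr_pM2l.
have r20 : 0 < b ^+ 2 / r by rewrite divr_gt0// exprn_gt0.
have hd2 z : cmod z <= b ^+ 2 / r -> cdiff h z.
  move=> zr; apply: hd; first by rewrite (le_trans zr)// ltW// (lt_trans br2).
  by apply: contraTneq zr => ->; rewrite cb -ltNge.
have H2 : null_seq (fun k => cmean h k (b ^+ 2 / r) - h 0).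
  apply: mean_value => //; first by apply: cdiff_cont; apply: hd2; rewrite cmod0 ltW.
  by move=> z /andP[_ zr]; apply: hd2.
have H3 : null_seq (fun k => cmean h k r).
  apply: null_seq_eq (null_seqD H1 H2) => k; rewrite subrKA /h mul0r subr0 //.
have H4 := @pole_mean b%:C%C r; rewrite cb in H4; have {}H4 := H4 br.
apply: null_seq_eq (null_seqD H3 (null_seqZ (f b%:C%C) H4)) => k.
rewrite mulrBr mulr1 -cmeanZ addrA -cmeanD; congr (_ - _).
by apply: eq_cmean => [|z _]; [exact: ltW|rewrite /h; ring].
Qed.

Lemma unit_arg (b : C) : exists2 u : C, cmod u = 1 & b = u * (cmod b)%:C%C.
Proof.
have [->|b0] := eqVneq b 0; first by exists 1; rewrite ?cmod1// cmod0 mulr0.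
have cb : (cmod b)%:C%C != 0 :> C by rewrite -cmod_gt0 cmod_real normr_gt0 cmod_eq0.
exists (b / (cmod b)%:C%C); last by rewrite divfK.
by rewrite cmodM cmodV cmod_real ger0_norm// divff// cmod_eq0.
Qed.

Lemma cder_affine f (a u b l : C) : cder f (a + u * b) l ->
  cder (fun z => f (a + u * z)) b (l * u).
Proof.
move=> df; apply: (@cder_comp _ f (fun z => a + u * z)) => //.
have := cderD (cder_cst a b) (cder_scale u (cder_id b)).
by rewrite add0r mulr1.
Qed.

Lemma cdiff_affine f (a u b : C) : cdiff f (a + u * b) -> cdiff (fun z => f (a + u * z)) b.
Proof. by move=> [l /cder_affine ?]; exists (l * u). Qed.

Section Estimates.
Variables (f : C -> C) (a : C) (r K : R).
Hypothesis r0 : 0 < r.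
Hypothesis fd : forall z, cmod z <= r -> cdiff f (a + z).
Hypothesis fK : forall z, cmod z <= r -> cmod (f (a + z)) <= K.

Let K0 : 0 <= K.
Proof. by rewrite (le_trans _ (fK (z := 0) _))// cmod0 ltW. Qed.

Let pole_bound (b : R) z : 0 < b -> b < r -> cmod z = r ->
  (cmod (z - b%:C%C))^-1 <= (r - b)^-1.
Proof.
move=> b0 br zr; have h : r - b <= cmod (z - b%:C%C).
  by rewrite (le_trans _ (cmod_sub_ge _ _))// zr cmod_real gtr0_norm.
have rb : 0 < r - b by rewrite subr_gt0.
by rewrite lef_pV2 ?posrE ?(lt_le_trans rb h).
Qed.

(** Subtracting the mean value at the centre from Cauchy's formula leaves the kernel
    [z / (z - b) - 1 = b / (z - b)]. A rotation makes the increment a positive real [b]. *)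
Lemma cauchy_lipschitz (h : C) : cmod h < r -> cmod (f (a + h) - f a) <= K * cmod h / (r - cmod h).
Proof.
move=> hr; have [->|h0] := eqVneq h 0.
  by rewrite addr0 subrr cmod0 mulr0 mul0r.
have [u cu hu] := unit_arg h; rewrite hu; set b := cmod h in hr *.
have b0 : 0 < b by rewrite cmod_gt0.
rewrite cmodM cu mul1r cmod_real gtr0_norm//.
pose F z := f (a + u * z).
have Fd z : cmod z <= r -> cdiff F z.
  by move=> zr; apply: cdiff_affine; apply: fd; rewrite cmodM cu mul1r.
have FK z : cmod z <= r -> cmod (F z) <= K by move=> zr; apply: fK; rewrite cmodM cu mul1r.
have Fc : ccont F 0 by apply: cdiff_cont; apply: Fd; rewrite cmod0 ltW.
have H1 := cauchy_real b0 hr Fd FK.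
have H2 := mean_value r0 Fc (fun z zr => Fd z (proj2 (andP zr))).
have F0 : F 0 = f a by rewrite /F mulr0 addr0.
rewrite F0 in H2.
apply: (@null_seq_bound _ _ _ (fun k => cmean (fun z => F z * (z / (z - b%:C%C)) - F z) k r)).
  by apply: null_seq_eq (null_seqN (null_seqB H1 H2)) => k; rewrite cmeanB -/(F b%:C%C); ring.
move=> k; apply: cmean_bound => [|z zr]; first exact: ltW.
have zb : z - b%:C%C != 0 by rewrite pole_neq0// cmod_real gtr0_norm// zr.
rewrite (_ : _ - _ = F z * (b%:C%C / (z - b%:C%C))); last by field; rewrite zb.
rewrite !cmodM cmod_real (gtr0_norm b0) cmodV mulrA.
by rewrite ler_pM ?mulr_ge0 ?invr_ge0 ?ler_wpM2r ?pole_bound ?FK ?zr// ltW.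
Qed.

(** Now two terms of the kernel are removed: [z / (z - b) - 1 - b / z = b ^ 2 / (z (z - b))]. *)
Lemma cauchy_taylor (l h : C) : cder f a l -> cmod h < r ->
  cmod (f (a + h) - f a - l * h) <= K * cmod h ^+ 2 / (r * (r - cmod h)).
Proof.
move=> fl hr; have [->|h0] := eqVneq h 0.
  by rewrite addr0 subrr mulr0 subrr cmod0 expr0n /= mulr0 mul0r.
have [u cu hu] := unit_arg h; rewrite hu; set b := cmod h in hr *.
have b0 : 0 < b by rewrite cmod_gt0.
rewrite cmodM cu mul1r cmod_real gtr0_norm//.
pose F z := f (a + u * z).
have Fd z : cmod z <= r -> cdiff F z.
  by move=> zr; apply: cdiff_affine; apply: fd; rewrite cmodM cu mul1r.
have FK z : cmod z <= r -> cmod (F z) <= K by move=> zr; apply: fK; rewrite cmodM cu mul1r.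
have Fc : ccont F 0 by apply: cdiff_cont; apply: Fd; rewrite cmod0 ltW.
have F0 : F 0 = f a by rewrite /F mulr0 addr0.
have Fl : cder F 0 (l * u) by apply: cder_affine; rewrite mulr0 addr0.
have H1 := cauchy_real b0 hr Fd FK.
have H2 := mean_value r0 Fc (fun z zr => Fd z (proj2 (andP zr))).
(* The mean value property of [q], together with the null means of [1 / z], identifies the
   derivative with the mean of [F z / z]. *)
pose q z := if z == 0 then l * u else (F z - F 0) / z.
have qc : ccont q 0.
  move=> e e0; have [d d0 Hd] := Fl e e0; exists d => // z /Hd; rewrite add0r /q eqxx.
  case: eqP => [_|/eqP z0]; first by move=> _; rewrite subrr cmod0 ltW.
  move=> Hz; rewrite (_ : _ - _ = (F z - F 0 - l * u * z) / z); last by field.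
  by rewrite cmodM cmodV ler_pdivrMr ?cmod_gt0.
have qd z : 0 < cmod z <= r -> cdiff q z.
  move=> /andP[z0 zr]; apply: (@cdiff_eq _ (fun z => (F z - F 0) / z)).
    exists (cmod z) => // y yz; rewrite /q ifN//.
    by apply: contraTneq yz => /eqP; rewrite addr_eq0 => /eqP ->; rewrite cmodN ltxx.
  apply: cdiffM; first by apply: cdiffB; [exact: Fd|exact: cdiff_cst].
  by eexists; apply: cderV; rewrite -cmod_gt0.
have H3 := mean_value r0 qc qd.
have H4 := inv_mean0 r0.
have q0 : q 0 = l * u by rewrite /q eqxx.
rewrite q0 in H3; rewrite F0 in H2.
apply: (@null_seq_bound _ _ _
  (fun k => cmean (fun z => F z * (z / (z - b%:C%C)) - F z - b%:C%C * (F z / z)) k r)).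
  apply: null_seq_eq (null_seqN (null_seqB (null_seqB H1 H2) 
    (null_seqZ b%:C%C (null_seqD H3 (null_seqZ (f a) H4))))) => k.
  rewrite -/(F b%:C%C) !cmeanB cmeanZ.
  have -> : cmean q k r = cmean (fun z => F z / z) k r - f a * cmean GRing.inv k r.
    rewrite -cmeanZ -cmeanB; apply: eq_cmean => [|z zr]; first exact: ltW.
    by rewrite /q F0 ifN ?mulrBl// -cmod_gt0 zr.
  by rewrite /F; ring.
move=> k; apply: cmean_bound => [|z zr]; first exact: ltW.
have zb : z - b%:C%C != 0 by rewrite pole_neq0// cmod_real gtr0_norm// zr.
have z0 : z != 0 by rewrite -cmod_gt0 zr.
rewrite (_ : _ - _ = F z * ((b%:C%C) ^+ 2 / (z * (z - b%:C%C)))); last by field; rewrite zb z0.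
rewrite cmodM cmodM cmodX cmod_real (gtr0_norm b0) cmodV cmodM zr mulrA.
rewrite ler_pM ?mulr_ge0 ?exprn_ge0 ?invr_ge0 ?mulr_ge0 ?(ltW r0) ?(ltW b0)//.
  by rewrite ler_wpM2r ?exprn_ge0 ?(ltW b0)// FK// zr.
rewrite !invfM ler_wpM2l ?invr_ge0 ?(ltW r0)//.
exact: pole_bound.
Qed.

End Estimates.

End Cauchy.

(** * Vector-valued maps in coordinates, and convex combinations *)

Section Vectors.
Variables (R : realType) (n : nat).
Local Notation C := (R[i]).
Local Notation Cn := 'rV[C]_n.
Implicit Types (x y v w : Cn) (Om : set Cn).

Lemma rC_gt0 (e : C) : 0 < e -> exists2 d : R, 0 < d & e = d%:C%C.
Proof.
case: e => a b; rewrite ltcE /= => /andP[/eqP -> a0]; by exists a.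
Qed.

Lemma mx_entry_norm v i : `|v 0 i| <= `|v|.
Proof.
rewrite [leRHS]mx_normE -[leLHS]nngE num_le.
exact: (@le_bigmax _ _ _ _ (fun ij : 'I_1 * 'I_n => `|v ij.1 ij.2|%:nng) (0, i)).
Qed.

Lemma rV_norm_le v (e : C) : 0 <= e -> (forall i, `|v 0 i| <= e) -> `|v| <= e.
Proof.
move=> e0 H; have [->//|/mx_norm_neq0[[i j] /= E]] := eqVneq `|v| 0.
by rewrite [leLHS]E ord1.
Qed.

Lemma open_coord Om x : open Om -> Om x -> exists2 d : R, 0 < d &
  forall y, (forall i, cmod (y 0 i - x 0 i) < d) -> Om y.
Proof.
move=> oO Ox; have /nbhs_ballP[e /= e0 He] := open_nbhs_nbhs (conj oO Ox).
have [d d0 ed] := rC_gt0 e0; exists d => // y Hy; apply: He; split=> // i j.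
by rewrite ord1 -ball_normE /= distrC cmodE ed ltcR.
Qed.

Lemma bounded_coord Om : bounded_set Om -> exists2 K : R, 0 < K &
  forall y, Om y -> forall i, cmod (y 0 i) <= K.
Proof.
move=> [M [/complex_realP[k ->] HM]]; exists (`|k| + 1); first by rewrite ltr_wpDl ?ltr01.
move=> y Oy i; have := HM (`|k| + 1)%:C%C; rewrite ltcR.
have -> : k < `|k| + 1 by rewrite (le_lt_trans (ler_norm k))// ltrDl ltr01.
move=> /(_ isT y Oy) /= h.
by have := le_trans (mx_entry_norm y i) h; rewrite cmodE lecR.
Qed.

Lemma cvg_coord (a : C -> Cn) x : a eps @[eps --> (0 : C)^'] --> x ->
  forall e : R, 0 < e -> exists2 d : R, 0 < d & forall eps, 0 < cmod eps < d ->
    forall i, cmod (a eps 0 i - x 0 i) < e.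
Proof.
move=> H e e0; have e0' : 0 < e%:C%C :> C by rewrite ltcR.
move/cvgrPdist_lt : H => /(_ _ e0') [d /= d0 Hd].
have [r r0 rd] := rC_gt0 d0; exists r => // eps /andP[e1 e2] i.
have := Hd eps; rewrite /ball_ /= sub0r normrN cmodE rd ltcR => /(_ e2).
rewrite -cmod_gt0 e1 => /(_ isT) h.
rewrite -ltcR -cmodE (le_lt_trans _ h)// distrC.
by have := mx_entry_norm (x - a eps) i; rewrite !mxE.
Qed.

Definition vcdiff (phi : C -> Cn) (z : C) := forall i, cdiff (fun t : C => phi t 0 i) z.

Definition vcder (phi : C -> Cn) (z : C) (l : Cn) :=
  forall i, cder (fun t : C => phi t 0 i) z (l 0 i).

Lemma vcdiff_vcder phi z : vcdiff phi z -> exists l, vcder phi z l.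
Proof.
move=> /choice[l Hl]; exists (\row_i l i) => i; rewrite mxE; exact: Hl.
Qed.

Lemma vcder_vcdiff phi z l : vcder phi z l -> vcdiff phi z.
Proof. by move=> H i; exists (l 0 i). Qed.

Lemma derivable_vcder (phi : C -> Cn) (z : C) : derivable phi z 1 -> exists l, vcder phi z l.
Proof.
move=> /derivableP/is_derive_first_order H; exists ('D_1 phi z) => i e e0.
have e0' : 0 < e%:C%C :> C by rewrite ltcR.
have [d d0 Hd] := H _ e0'; have [r r0 rd] := rC_gt0 d0.
exists r => // h hr; have := Hd h; rewrite cmodE rd ltcR => /(_ hr).
move=> /(le_trans (mx_entry_norm _ i)); rewrite !mxE cmodE -rmorphM lecR /=.
by rewrite (addrC h) [h * _]mulrC; apply.
Qed.

Lemma vcder_derivable (phi : C -> Cn) (z : C) l : vcder phi z l -> derivable phi z 1.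
Proof.
move=> H; apply: (@first_order_derivable _ _ _ _ l) => e e0.
have [r r0 er] := rC_gt0 e0.
have /choice[d Hd] i : exists d : R, 0 < d /\ forall h, cmod h < d ->
    cmod (phi (z + h) 0 i - phi z 0 i - l 0 i * h) <= r * cmod h.
  by have [d d0 Hd] := H i r r0; exists d.
exists (\big[Num.min/1]_i d i)%:C%C.
  by rewrite ltcR; apply: lt_bigmin => // i _; case: (Hd i).
move=> h; rewrite cmodE ltcR => hd.
apply: rV_norm_le; first by rewrite er -rmorphM lecR /= mulr_ge0// ltW.
move=> i; rewrite !mxE cmodE er -rmorphM lecR /= (addrC h) (mulrC h).
by apply: (proj2 (Hd i)); apply: (lt_le_trans hd); apply: bigmin_le.
Qed.

Definition hol_in Om (phi : C -> Cn) := forall z, cmod z < 1 -> Om (phi z) /\ vcdiff phi z.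

Lemma hol_diskE Om phi : hol_disk Om phi <-> hol_in Om phi.
Proof.
split=> H z /H[Oz dz]; split=> //.
  by have [l /vcder_vcdiff] := derivable_vcder dz.
by have [l /vcder_derivable] := vcdiff_vcder dz.
Qed.

Lemma vcder_uniq phi z l m : vcder phi z l -> vcder phi z m -> l = m.
Proof. by move=> H1 H2; apply/rowP => i; apply: cder_uniq (H1 i) (H2 i). Qed.

(** Weights are not normalised, so the induction can split off the first point; the case of a
    vanishing remaining weight is treated apart. *)
Lemma convex_comb Om (m : nat) (w : 'I_m -> R) (x : 'I_m -> Cn) : convex_domain Om ->
  (forall j, 0 <= w j) -> 0 < \sum_j w j -> (forall j, Om (x j)) ->
  Om ((\sum_j w j)^-1%:C%C *: \sum_j ((w j)%:C%C *: x j)).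
Proof.
move=> cO; elim: m w x => [|m IH] w x w0; first by rewrite big_ord0 ltxx.
rewrite !big_ord_recl => S0 xO.
set S := \sum_(i < m) _ in S0 *; set X := \sum_(i < m) (_ *: _).
have w00 := w0 ord0.
have Sge : 0 <= S by apply: sumr_ge0.
have [SZ|Sn0] := eqVneq S 0.
  have -> : X = 0.
    apply: big1 => i _; have := @psumr_eq0P _ _ xpredT (fun i => w (lift ord0 i)) (fun i _ => w0 _) SZ.
    by move=> /(_ i isT) ->; rewrite scale0r.
  move: S0; rewrite SZ !addr0 => S0.
  by rewrite scalerA -rmorphM /= mulVf ?gt_eqF// scale1r.
have Sp : 0 < S by rewrite lt_def Sn0.
have H := IH (fun i => w (lift ord0 i)) (fun i => x (lift ord0 i)) (fun i => w0 _) Sp (fun i => xO _).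
have := cO _ _ (xO ord0) H (S / (w ord0 + S)).
rewrite -/S -/X scalerDr !scalerA -!rmorphM /= => HH.
rewrite (_ : _ + _ = (1 - S / (w ord0 + S))%:C%C *: x ord0 + (S / (w ord0 + S) * S^-1)%:C%C *: X).
  apply: HH; rewrite divr_ge0 ?(ltW S0)//= ler_pdivrMr// mul1r lerDr//.
congr (_%:C%C *: _ + _%:C%C *: _); field; rewrite ?gt_eqF//.
Qed.

End Vectors.

(** * The Poisson kernel and Harnack's inequality in convex domains *)

Section Harnack.
Variable R : realType.
Local Notation C := (R[i]).
Implicit Types (z : C).

Definition poisson (b r : R) z : R := (r ^+ 2 - b ^+ 2) / cmod (z - b%:C%C) ^+ 2.

Lemma sqr_cmodC z : (cmod z ^+ 2)%:C%C = z * z^*.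
Proof. by rewrite rmorphXn /= -cmodE sqr_normc. Qed.

(** The Poisson kernel is the Cauchy kernel plus a function holomorphic on the closed disk and zero
    at 0, whose product with a holomorphic [F] has null means. *)
Lemma poissonE (b r : R) z : 0 < b -> b < r -> cmod z = r ->
  (poisson b r z)%:C%C = z / (z - b%:C%C) + b%:C%C * z / ((r ^+ 2)%:C%C - b%:C%C * z).
Proof.
move=> b0 br zr; rewrite /poisson rmorphM fmorphV rmorphB /= -zr !sqr_cmodC.
have z0 : z != 0 by rewrite -cmod_gt0 zr (lt_trans b0).
have zb : z - b%:C%C != 0 by rewrite pole_neq0// cmod_real gtr0_norm// zr.
have zb' : z^* - b%:C%C != 0 by rewrite pole_neq0// cmod_conj cmod_real gtr0_norm// zr.
have cr : (b%:C%C)^* = b%:C%C := conjc_real b.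
rewrite rmorphXn /= rmorphB /= cr.
field; rewrite ?z0 ?zb' ?zb ?andbT /=.
have -> : z * z^* - b%:C%C * z = z * (z^* - b%:C%C) by ring.
by rewrite mulf_neq0.
Qed.

Lemma poisson_ge (b r : R) z : 0 < b -> b < r -> cmod z = r ->
  (r - b) / (r + b) <= poisson b r z.
Proof.
move=> b0 br zr; have r0 : 0 < r by apply: lt_trans br.
have zb : z - b%:C%C != 0 by rewrite pole_neq0// cmod_real gtr0_norm// zr.
rewrite /poisson ler_pdivlMr ?exprn_gt0 ?cmod_gt0// mulrAC ler_pdivrMr ?addr_gt0//.
have h : cmod (z - b%:C%C) <= r + b.
  by rewrite (le_trans (cmodB _ _))// zr cmod_real gtr0_norm.
have -> : (r ^+ 2 - b ^+ 2) * (r + b) = (r - b) * (r + b) ^+ 2 by ring.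
rewrite ler_wpM2l ?subr_ge0 ?(ltW br)// ler_pXn2r ?nnegrE// addr_ge0 ?ltW//.
Qed.

Lemma poisson_mean (F : C -> C) (b r K : R) : 0 < b -> b < r ->
  (forall z, cmod z <= r -> cdiff F z) -> (forall z, cmod z <= r -> cmod (F z) <= K) ->
  null_seq (fun k => cmean (fun z => F z * (poisson b r z)%:C%C) k r - F b%:C%C).
Proof.
move=> b0 br Fd FK; have r0 : 0 < r by apply: lt_trans br.
pose H z := F z * (b%:C%C * z / ((r ^+ 2)%:C%C - b%:C%C * z)).
have Hd z : cmod z <= r -> cdiff H z.
  move=> zr; apply: cdiffM; first exact: Fd.
  apply: cdiffM; first by apply: cdiffM; [exact: cdiff_cst|exact: cdiff_id].
  apply: cdiffV; last by apply: cdiffB; [exact: cdiff_cst|apply: cdiffM; [exact: cdiff_cst|exact: cdiff_id]].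
  rewrite -oppr_eq0 opprB; rewrite -oppr_eq0 opprB pole_neq0//.
  rewrite cmodM !cmod_real !gtr0_norm ?exprn_gt0// expr2.
  by rewrite (le_lt_trans (y := b * r)) ?ler_wpM2l ?ltr_pM2r// ltW.
have H1 := cauchy_real b0 br Fd FK.
have H2 : null_seq (fun k => cmean H k r - H 0).
  apply: mean_value => // [|z /andP[_ zr]]; last exact: Hd.
  by apply: cdiff_cont; apply: Hd; rewrite cmod0 ltW.
apply: null_seq_eq (null_seqD H1 H2) => k.
rewrite {2}/H mulr0 mul0r mulr0 subr0 addrAC -cmeanD; congr (_ - _).
by apply: eq_cmean => [|z zr]; [exact: ltW|rewrite poissonE// mulrDr].
Qed.

Lemma ev_fin n (P : 'I_n -> nat -> Prop) : (forall i, ev (P i)) -> ev (fun k => forall i, P i k).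
Proof.
move=> /choice[k0 H]; exists (\max_i k0 i)%N => k hk i; apply: H.
by apply: leq_trans hk; apply: leq_bigmax.
Qed.

(* The Poisson kernel is at least [c := (1 - |b|) / 4], so the discrete
   Poisson means exhibit points near [phi b] as convex combinations of values
   of [phi] and, with weight about [c], a point near [phi 0]. *)
Lemma harnack n (Om : set 'rV[C]_n) (phi : C -> 'rV[C]_n) (d K : R) : convex_domain Om ->
  hol_in Om phi -> (forall y, Om y -> forall i, cmod (y 0 i) <= K) -> 0 < d ->
  (forall y : 'rV[C]_n, (forall i, cmod (y 0 i - phi 0 0 i) < d) -> Om y) ->
  forall b, cmod b < 1 -> forall y : 'rV[C]_n,
    (forall i, cmod (y 0 i - phi b 0 i) < (1 - cmod b) / 8 * d) -> Om y.
Proof.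
move=> cO hphi HK d0 Hd b b1 y Hy.
have [bz|bn0] := eqVneq b 0.
  apply: Hd => i; rewrite bz cmod0 in Hy; apply: (lt_le_trans (Hy i)); lra.
have [u cu bu] := unit_arg b; set be := cmod b in b1 Hy bu.
have be0 : 0 < be by rewrite cmod_gt0.
(* With this radius the lower bound [(r - b) / (r + b)] of the kernel is [(1 - b) / (1 + 3 b)],
   hence at least [c = (1 - b) / 4]. *)
pose r := (1 + be) / 2; have ber : be < r by rewrite /r; lra.
have r0 : 0 < r by apply: lt_trans ber.
have r1 : r < 1 by rewrite /r; lra.
pose c := (1 - be) / 4; have c0 : 0 < c by rewrite /c; lra.
have c01 : cmod (0 : C) < 1 by rewrite cmod0 ltr01.
have K0 (i : 'I_n) : 0 <= K by exact: le_trans (cmod_ge0 _) (HK _ (hphi 0 c01).1 i).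
case: n => [|n] in Om phi cO hphi HK Hd y Hy K0 *.
  by apply: Hd => -[].
have {}K0 := K0 ord0.
have cP z : cmod z = r -> c <= poisson be r z.
  move=> zr; apply: le_trans (poisson_ge be0 ber zr); rewrite ler_pdivlMr ?addr_gt0//.
  rewrite /c /r; nra.
have uz z : cmod z <= r -> cmod (u * z) < 1.
  by move=> zr; rewrite cmodM cu mul1r (le_lt_trans zr).
pose F i z := phi (u * z) 0 i.
have Fd i z : cmod z <= r -> cdiff (F i) z.
  move=> /uz/hphi[_ /(_ i) dz].
  have := @cdiff_affine R (fun t => phi t 0 i) 0 u z; rewrite add0r => /(_ dz).
  by apply: cdiff_eq; exists 1 => // h _; rewrite add0r.
have FK i z : cmod z <= r -> cmod (F i z) <= K by move=> /uz/hphi[/HK + _]; apply.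
have M1 i := poisson_mean be0 ber (Fd i) (FK i).
have M2 i := mean_value r0 (cdiff_cont (Fd i 0 ltac:(by rewrite cmod0 ltW)))
  (fun z zr => Fd i z (proj2 (andP zr))).
have M3 := @poisson_mean (fun=> 1) be r 1 be0 ber (fun z _ => cdiff_cst 1 z)
  (fun z _ => ltac:(by rewrite cmod1)).
(* The discretisation errors add up to at most [(2 + K) e], and the weight of [x] may drop to
   [c - e]; [e] keeps both effects within the half of [c d] that the hypothesis on [y] leaves
   free. *)
pose e : R := c * d / (4 * (K + d + 3)).
have Kd : 0 < K + d + 3 by rewrite addr_gt0 ?ltr0n// ltr_wpDl.
have e0 : 0 < e by apply: divr_gt0; apply: mulr_gt0.
have ed : e * (4 * (K + d + 3)) = c * d by rewrite /e divfK// mulf_neq0// gt_eqF.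
have [k [[k1 k2] k3]] := ev_ex (ev_and (ev_and (ev_fin (fun i => M1 i e e0)) (ev_fin (fun i => M2 i e e0))) (M3 e e0)).
pose pt (j : 'I_(2 ^ k)) := r%:C%C * cexp (tau R * (j%:R / 2 ^+ k)).
have ptr j : cmod (pt j) = r by rewrite cmod_circle_pt ?ltW.
pose w j := (2 ^+ k)^-1 * (poisson be r (pt j) - c).
have w0 j : 0 <= w j.
  by rewrite mulr_ge0 ?invr_ge0 ?exprn_ge0// subr_ge0 cP.
pose S := \sum_j w j.
have ik : ((2 ^+ k)^-1)%:C%C = (2 ^+ k)^-1 :> C.
  by rewrite fmorphV rmorphXn /= rmorph_nat.
have SE : S%:C%C = cmean (fun z => 1 * (poisson be r z)%:C%C) k r - c%:C%C.
  rewrite -[X in _ - X](cmean_cst c%:C%C k r) -cmeanB /cmean /S rmorph_sum mulr_sumr.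
  by apply: eq_bigr => j _; rewrite /w rmorphM rmorphB /= ik mul1r.
have Se : `|S + c - 1| <= e.
  by rewrite -cmod_real rmorphB rmorphD /= SE subrK.
have e4 : 4 * e < c by nra.
have S1 : 0 < 1 - S by move: Se; rewrite ler_norml => /andP[]; lra.
(* The point that makes [y] exactly the convex combination of the values of [phi] with weights [w j]
   and of [x] with weight [1 - S]. Since [1 - S] is about [c], [x] is close to [phi 0]. *)
pose x := (1 - S)^-1%:C%C *: (y - \sum_j ((w j)%:C%C *: phi (u * pt j))).
have xO : Om x.
  apply: Hd => i.
  have sE : (\sum_j ((w j)%:C%C *: phi (u * pt j))) 0 i =
     cmean (fun z => F i z * (poisson be r z)%:C%C) k r - c%:C%C * cmean (F i) k r.
    rewrite summxE -cmeanZ -cmeanB /cmean mulr_sumr; apply: eq_bigr => j _.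
    by rewrite !mxE /w rmorphM rmorphB /= ik /F; ring.
  have S1' : (1 - S)%:C%C != 0 :> C by rewrite -cmod_gt0 cmod_real normr_gt0 gt_eqF.
  rewrite !mxE sE.
  set m1 := cmean _ _ _; set m2 := cmean _ _ _.
  have k1i := k1 i; have k2i := k2 i; rewrite -/m1 in k1i; rewrite -/m2 in k2i.
  have F0 : F i 0 = phi 0 0 i by rewrite /F mulr0.
  have Fb : F i be%:C%C = phi b 0 i by rewrite /F -bu.
  rewrite F0 in k2i; rewrite Fb in k1i.
  have ph0 : cmod (phi 0 0 i) <= K by rewrite -F0 FK// cmod0 ltW.
  rewrite (_ : _ - _ = (1 - S)^-1%:C%C * ((y 0 i - phi b 0 i) - (m1 - phi b 0 i) +
     c%:C%C * (m2 - phi 0 0 i) + (S + c - 1)%:C%C * phi 0 0 i)); last first.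
    rewrite fmorphV /= !(rmorphB, rmorphD) /= rmorph1; field.
    by rewrite -(rmorph1 (real_complex R)) -rmorphB.
  rewrite cmodM cmod_real gtr0_norm ?invr_gt0// mulrC ltr_pdivrMr//.
  have A1 := cmodD ((y 0 i - phi b 0 i) - (m1 - phi b 0 i) + c%:C%C * (m2 - phi 0 0 i))
    ((S + c - 1)%:C%C * phi 0 0 i).
  have A2 := cmodD ((y 0 i - phi b 0 i) - (m1 - phi b 0 i)) (c%:C%C * (m2 - phi 0 0 i)).
  have A3 := cmodB (y 0 i - phi b 0 i) (m1 - phi b 0 i).
  have A4 : cmod (c%:C%C * (m2 - phi 0 0 i)) <= e.
    rewrite cmodM cmod_real gtr0_norm// -[e]mul1r ler_pM// ?ltW//; rewrite /c; lra.
  have A5 : cmod ((S + c - 1)%:C%C * phi 0 0 i) <= e * K.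
    by rewrite cmodM cmod_real ler_pM.
  have A6 := Hy i.
  have A7 : (1 - be) / 8 * d = c * d / 2 by rewrite /c; field.
  have A8 : c - e <= 1 - S by move: Se; rewrite ler_norml => /andP[]; lra.
  have A9 : d * (c - e) <= d * (1 - S) by rewrite ler_wpM2l// ltW.
  nra.
pose W (j : 'I_(2 ^ k).+1) := if unlift ord0 j is Some j' then w j' else 1 - S.
pose X (j : 'I_(2 ^ k).+1) := if unlift ord0 j is Some j' then phi (u * pt j') else x.
have WS : \sum_j W j = 1.
  rewrite big_ord_recl {1}/W unlift_none (eq_bigr w) ?subrK// => j _.
  by rewrite /W liftK.
have := @convex_comb _ _ Om _ W X cO; rewrite WS invr1 scale1r.
rewrite (_ : \sum_j _ = y).
  apply=> // j; rewrite /W /X; case: unliftP => [j' _|_]//.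
  - exact: ltW.
  - by apply: (hphi _ _).1; rewrite uz// ptr.
rewrite big_ord_recl {1}/W {1}/X unlift_none (eq_bigr (fun j => (w j)%:C%C *: phi (u * pt j))); last first.
  by move=> j _; rewrite /W /X liftK.
rewrite /x scalerA -rmorphM /= divff ?gt_eqF// scale1r subrK//.
Qed.

End Harnack.

(** * Interpolation at pairs of nodes that may merge *)

Section Interpolation.
Variable R : realType.
Local Notation C := (R[i]).

Lemma cmod_prod (I : Type) (s : seq I) (P : pred I) (F : I -> C) :
  cmod (\prod_(i <- s | P i) F i) = \prod_(i <- s | P i) cmod (F i).
Proof.
elim/big_rec2 : _ => [|i y1 y2 _ IH]; first by rewrite cmod1.
by rewrite cmodM IH.
Qed.

Lemma prod_le_exp (I : Type) (s : seq I) (P : pred I) (F : I -> R) (M : R) (N : nat) :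
  1 <= M -> (size s <= N)%N -> (forall i, 0 <= F i) -> (forall i, P i -> F i <= M) ->
  \prod_(i <- s | P i) F i <= M ^+ N.
Proof.
move=> M1 sN F0 FM; apply: (@le_trans _ _ (M ^+ size s)); last by rewrite ler_weXn2l.
elim: s {sN} => [|a s IH]; first by rewrite big_nil.
rewrite big_cons /= exprS; case: ifP => Pa.
  by rewrite ler_pM ?FM// prodr_ge0.
by rewrite (le_trans IH)// ler_peMl// exprn_ge0// (le_trans ler01).
Qed.

Lemma prod_ge_exp (I : eqType) (s : seq I) (P : pred I) (F : I -> R) (m : R) (N : nat) :
  0 < m -> m <= 1 -> (size s <= N)%N -> (forall i, i \in s -> P i -> m <= F i) ->
  m ^+ N <= \prod_(i <- s | P i) F i.
Proof.
move=> m0 m1 sN Fm; apply: (@le_trans _ _ (m ^+ size s)).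
  by rewrite ler_wiXn2l ?(ltW m0).
elim: s {sN} Fm => [|a s IH] Fm; first by rewrite big_nil.
have {}IH := IH (fun i si => Fm i (@mem_behead _ (a :: s) i si)).
rewrite big_cons /= exprS; case: ifP => Pa.
  by rewrite ler_pM ?(ltW m0) ?exprn_ge0 ?(ltW m0)// Fm// mem_head.
by apply: le_trans IH; rewrite ler_piMl// exprn_ge0// ltW.
Qed.

Lemma cdiff_prod_seq (T : eqType) (cl : seq T) (P : pred T) (be t : T -> C) z :
  cdiff (fun z => \prod_(j <- cl | P j) ((z - be j) * (z - (be j + t j)))) z.
Proof.
apply: (@cdiff_prod _ _ _ _ (fun j z => (z - be j) * (z - (be j + t j)))) => j.
exact: cdiffM (cdiff_subc _ _) (cdiff_subc _ _).
Qed.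

(* The point is that the bound does not degenerate when the gap [t i] between
   the nodes [be i] and [be i + t i] tends to zero. *)
Lemma interpolation (s : R) (N : nat) : 0 < s -> exists K d : R, [/\ 0 < K, 0 < d &
  forall (T : eqType) (cl : seq T) (be t A E : T -> C) (B : R),
    0 <= B -> uniq cl -> (size cl <= N)%N ->
    (forall i, cmod (be i) <= 1) -> (forall i, cmod (t i) <= d) ->
    (forall i j, i \in cl -> j \in cl -> i != j -> s <= cmod (be i - be j)) ->
    (forall i, cmod (A i) <= B) -> (forall i, cmod (E i) <= B) ->
    exists P : C -> C, [/\ forall z, cdiff P z,
      forall i, i \in cl -> P (be i) = A i /\ P (be i + t i) = A i + t i * E i &
      forall z, cmod z <= 1 -> cmod (P z) <= K * B]].
Proof.
move=> s0; pose s' := Num.min s 1.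
have s'0 : 0 < s' by rewrite lt_min s0 ltr01.
have s's : s' <= s by rewrite ge_min lexx.
have s'1 : s' <= 1 by rewrite ge_min lexx orbT.
(* Bounds for the products [W i] below: factors near the nodes of pair [i] are at least [s' / 2],
   and on [|z| <= 2] they are at most 4, two for each other pair. *)
pose m : R := ((s' / 2) ^+ 2) ^+ N; pose M : R := 16 ^+ N.
have m0 : 0 < m by rewrite !exprn_gt0// divr_gt0.
have M1 : 1 <= M by rewrite exprn_ege1// ler1n.
have M0 : 0 < M by apply: lt_le_trans M1.
pose K := M * (m^-1 + 2 * ((1 + 2 * M / m) / m)).
have mi0 : 0 < m^-1 by rewrite invr_gt0.
have K1 : 0 < K by rewrite /K mulr_gt0// addr_gt0// !mulr_gt0// addr_gt0// !mulr_gt0.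
exists (N%:R * K + 1), (s' / 4); split; [|by rewrite divr_gt0|].
  by rewrite ltr_wpDl// mulr_ge0// ltW.
move=> T cl be t A E B B0 ucl sz be1 td sep AB EB.
pose W i z := \prod_(j <- cl | j != i) ((z - be j) * (z - (be j + t j))).
have Wd i z : cdiff (W i) z by exact: cdiff_prod_seq.
have W0 i j : j \in cl -> j != i -> W i (be j) = 0 /\ W i (be j + t j) = 0.
  by move=> jc ji; split; rewrite /W (big_rem j)//= ji subrr ?mul0r ?mulr0 ?mul0r.
have t4 i : cmod (t i) <= s' / 4 by exact: td.
have WM i z : cmod z <= 2 -> cmod (W i z) <= M.
  move=> z2; rewrite /W cmod_prod; apply: prod_le_exp => //; first by rewrite ler1n.
  move=> j _; rewrite cmodM.
  have h1 : cmod (z - be j) <= 4.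
    by rewrite (le_trans (cmodB _ _))//; have := be1 j; lra.
  have h2 : cmod (z - (be j + t j)) <= 4.
    rewrite (le_trans (cmodB _ _))//; have := be1 j; have := t4 j; have := cmodD (be j) (t j); lra.
  by rewrite (_ : 16 = 4 * 4) ?ler_pM//; ring.
have Wm i u : i \in cl -> cmod u <= s' / 4 -> m <= cmod (W i (be i + u)).
  move=> ic u4; rewrite /W cmod_prod; apply: prod_ge_exp => //.
  - by rewrite exprn_gt0// divr_gt0.
  - by rewrite exprn_ile1 ?divr_ge0 ?(ltW s'0)//; lra.
  move=> j jc ji; rewrite cmodM expr2.
  have ij : s' <= cmod (be i - be j) by rewrite (le_trans s's)// sep// eq_sym.
  apply: ler_pM; rewrite ?divr_ge0 ?(ltW s'0)//.
    have := cmod_sub_ge (be i - be j) (- u); rewrite cmodN opprK.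
    rewrite (_ : be i - be j + u = be i + u - be j); [lra|ring].
  have := cmod_sub_ge (be i - be j) (t j - u); have := cmodB (t j) u; have := t4 j.
  rewrite (_ : be i - be j - (t j - u) = be i + u - (be j + t j)); [lra|ring].
have WL i : i \in cl -> cmod ((W i (be i + t i) - W i (be i)) / t i) <= 2 * M.
  move=> ic; have [->|tn0] := eqVneq (t i) 0; first by rewrite invr0 mulr0 cmod0 mulr_ge0 ?(ltW M0).
  rewrite cmodM cmodV ler_pdivrMr ?cmod_gt0//.
  have H := @cauchy_lipschitz R (W i) (be i) 1 M ltr01 (fun z _ => Wd i _).
  have H1 z : cmod z <= 1 -> cmod (W i (be i + z)) <= M.
    by move=> z1; apply: WM; rewrite (le_trans (cmodD _ _))//; have := be1 i; lra.
  have t1 : cmod (t i) <= 1 / 2 by rewrite (le_trans (t4 i))//; lra.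
  apply: (le_trans (H H1 (t i) _)); first by apply: le_lt_trans t1 _; lra.
  have tp : 0 < 1 - cmod (t i) by lra.
  rewrite ler_pdivrMr// -!mulrA mulrCA ler_wpM2l ?(ltW M0)//.
  have := cmod_ge0 (t i); nra.
(* Newton form of the two conditions at pair [i]: [y i] is the divided difference of data over
   [W i]. Expanding it puts the gap only under the increment of [W i], which [WL] controls by a
   Cauchy estimate. For [t i = 0] the convention that division by 0 gives 0 is harmless. *)
pose x i := A i / W i (be i).
pose y i := (E i - x i * ((W i (be i + t i) - W i (be i)) / t i)) / W i (be i + t i).
have Wn0 i u : i \in cl -> cmod u <= s' / 4 -> W i (be i + u) != 0.
  by move=> ic u4; rewrite -cmod_gt0 (lt_le_trans m0)// Wm.
have Wn i : i \in cl -> W i (be i) != 0.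
  by move=> ic; rewrite -[be i]addr0 Wn0// cmod0 divr_ge0// ltW.
have Wnt i : i \in cl -> W i (be i + t i) != 0 by move=> ic; exact: Wn0.
have xb i : i \in cl -> cmod (x i) <= B / m.
  move=> ic; rewrite cmodM cmodV ler_pM ?invr_ge0// lef_pV2 ?posrE ?cmod_gt0 ?Wn//.
  by rewrite -[be i]addr0 Wm// cmod0 divr_ge0// ltW.
have yb i : i \in cl -> cmod (y i) <= B * ((1 + 2 * M / m) / m).
  move=> ic; rewrite cmodM cmodV mulrA ler_pM ?invr_ge0//; last first.
    by rewrite lef_pV2 ?posrE ?cmod_gt0 ?Wnt// Wm.
  rewrite (le_trans (cmodB _ _))// mulrDr mulr1 lerD ?EB// cmodM.
  rewrite (_ : B * (2 * M / m) = B / m * (2 * M)); last by ring.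
  by rewrite ler_pM ?xb ?WL.
pose P z := \sum_(i <- cl) W i z * (x i + y i * (z - be i)).
exists P; split.
- move=> z; apply: (@cdiff_sum _ _ _ _ (fun i z => W i z * (x i + y i * (z - be i)))) => i.
  apply: cdiffM => //; apply: cdiffD; first exact: cdiff_cst.
  apply: cdiffM; first exact: cdiff_cst.
  exact: cdiff_subc.
- move=> i ic.
  have PE u : (u = be i \/ u = be i + t i) -> P u = W i u * (x i + y i * (u - be i)).
    move=> Hu; rewrite /P (bigD1_seq i)//= big_seq_cond big1 ?addr0// => j /andP[jc ji].
    have [w1 w2] := @W0 j i ic ltac:(by rewrite eq_sym).
    by case: Hu => ->; rewrite ?w1 ?w2 mul0r.
  rewrite !PE; [|by right|by left]; split.
    by rewrite subrr mulr0 addr0 /x mulrC divfK// Wn.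
  rewrite addrAC subrr add0r /y.
  have [->|tn0] := eqVneq (t i) 0.
    by rewrite mulr0 mul0r !addr0 /x mulrC divfK// Wn.
  rewrite /x; field; rewrite tn0 Wn// Wnt//.
- move=> z z1; apply: (@le_trans _ _ (\sum_(i <- cl) K * B)); last first.
    rewrite big_const_seq count_predT iter_addr_0 -[_ *+ _]mulr_natl mulrA ler_wpM2r//.
    by rewrite (@le_trans _ _ (N%:R * K))// ?lerDl// ler_wpM2r ?ler_nat// ltW.
  apply: (le_trans (cmod_sum _ _ _)); rewrite big_seq [leRHS]big_seq.
  apply: ler_sum => i ic; rewrite cmodM /K -mulrA.
  apply: ler_pM => //; first by apply: WM; rewrite (le_trans z1)// ler1n.
  apply: (le_trans (cmodD _ _)); rewrite mulrDl; apply: lerD.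
    by rewrite mulrC xb.
  have zb : cmod (z - be i) <= 2 by rewrite (le_trans (cmodB _ _))//; have := be1 i; lra.
  rewrite cmodM (_ : _ * B = B * ((1 + 2 * M / m) / m) * 2); last by ring.
  by rewrite ler_pM ?yb.
Qed.

End Interpolation.

(** * Peak functions with values near a segment *)

Section Peak.
Variable R : realType.
Local Notation C := (R[i]).
Implicit Types (u z : C).

Lemma exists_expr_le (x e : R) : 0 <= x -> x < 1 -> 0 < e -> exists p, x ^+ p <= e.
Proof.
move=> x0 x1 e0; have := @cvg_expr R x; rewrite ger0_norm// => /(_ x1).
move=> /cvgrPdist_le /(_ _ e0) [p _ Hp]; exists p.
by have := Hp p (leqnn p); rewrite /= sub0r normrN ger0_norm// exprn_ge0.
Qed.

(** The closed disk with diameter [[0, 1]], image of the closed unit disk under [(1 + z) / 2]. Away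
    from 1 the modulus is bounded below 1 on it, and 1 is attained only at 1. *)
Definition lens u := cmod u ^+ 2 + cmod (1 - u) ^+ 2 <= 1.

Lemma lens_le1 u : lens u -> cmod u <= 1.
Proof.
rewrite /lens => h; rewrite -(@ler_pXn2r _ 2) ?nnegrE// expr1n.
have := sqr_ge0 (cmod (1 - u)); lra.
Qed.

Lemma lens_disk z : cmod z <= 1 -> lens ((1 + z) / 2).
Proof.
move=> z1; rewrite /lens (_ : 1 - (1 + z) / 2 = (1 - z) / 2); last by field.
rewrite !cmodM !cmodV cmod_nat !exprMn !cmod_sqr.
have : cmod z ^+ 2 <= 1 by rewrite exprn_ile1.
case: z {z1} => a b; rewrite cmod_sqr /= => h; nra.
Qed.

Lemma cmod_expr_sub1 u q : cmod u <= 1 -> cmod (u ^+ q - 1) <= q%:R * cmod (1 - u).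
Proof.
move=> u1; elim: q => [|q IH]; first by rewrite expr0 subrr cmod0 mul0r.
rewrite (_ : _ - 1 = u * (u ^+ q - 1) - (1 - u)); last by rewrite exprS; ring.
rewrite (le_trans (cmodB _ _))// -natr1 mulrDl mul1r lerD2r cmodM.
by rewrite (le_trans _ IH)// ler_piMl.
Qed.

(* Powers of [u] with rapidly increasing exponents: at each point of the lens
   all but at most one of them are close to 0 or to 1, and the first ones are
   the ones that are close to 1, so their sum is within distance about 1 of [0, m]. *)
Lemma peak_sum (m : nat) (e d : R) : 0 < e -> 0 < d -> exists H : C -> C,
  [/\ forall u, cdiff H u, H 1 = m%:R,
    forall u, lens u -> d <= cmod (1 - u) -> cmod (H u) <= m%:R * e &
    forall u, lens u -> exists2 t : R, 0 <= t <= m%:R & cmod (H u - t%:C%C) <= 1 + m%:R * e].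
Proof.
move=> e0; elim: m d => [|m IH] d d0.
  exists (fun=> 0); split=> // [u|u _ _|u _]; first exact: cdiff_cst.
    by rewrite cmod0 mul0r.
  by exists 0; rewrite ?lexx// subrr cmod0 mul0r addr0.
have [p Hp] : exists p, forall u, lens u -> d <= cmod (1 - u) -> cmod (u ^+ p) <= e.
  (* For [d >= 1] the lens condition leaves only [u = 0]. *)
  have [d1|d1] := ltP d 1; last first.
    exists 1%N => u hu du; rewrite expr1.
    have : cmod u ^+ 2 <= 0.
      have : 1 <= cmod (1 - u) ^+ 2 by rewrite exprn_ege1// (le_trans d1).
      by move: hu; rewrite /lens; lra.
    rewrite exprn_even_le0//= => /eqP ->; exact: ltW.
  have [p Hp] := @exists_expr_le (1 - d ^+ 2) e ltac:(rewrite subr_ge0 exprn_ile1//; lra)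
    ltac:(by rewrite gtrBl exprn_gt0) e0.
  exists (2 * p)%N => u hu du; rewrite cmodX exprM; apply: le_trans Hp.
  apply: lerXn2r; rewrite ?nnegrE ?exprn_ge0//.
    rewrite subr_ge0 exprn_ile1//; lra.
  have : d ^+ 2 <= cmod (1 - u) ^+ 2 by rewrite lerXn2r ?nnegrE// ltW.
  by move: hu; rewrite /lens; lra.
(* Within [d'] of 1 the power [u ^+ p] is still within [e] of 1, so the functions from the induction
   act only where this power has already settled. *)
pose d' := Num.min d (e / (p%:R + 1)).
have p1 : (0 : R) < p%:R + 1 by rewrite ltr_wpDl// ?ltr01.
have d'0 : 0 < d' by rewrite lt_min d0 divr_gt0.
have d'd : d' <= d by rewrite ge_min lexx.
have d'e : d' <= e / (p%:R + 1) by rewrite ge_min lexx orbT.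
have [H [Hd H1 Ha Hb]] := IH d' d'0.
exists (fun u => u ^+ p + H u); split.
- by move=> u; apply: cdiffD => //; apply: (@cdiffX _ id); exact: cdiff_id.
- by rewrite expr1n H1 nat1r.
- move=> u hu du; rewrite (le_trans (cmodD _ _))// -natr1 mulrDl mul1r addrC lerD ?Hp//.
  by rewrite Ha// (le_trans d'd).
move=> u hu; have [du|du] := leP d' (cmod (1 - u)).
  exists 0; first by rewrite lexx ler0n.
  rewrite subr0 (le_trans (cmodD _ _))// lerD//.
    by rewrite cmodX exprn_ile1// lens_le1.
  by rewrite (le_trans (Ha _ hu du))// ler_wpM2r ?(ltW e0)// ler_nat.
have [t /andP[t0 tm] Ht] := Hb u hu.
exists (t + 1); first by rewrite addr_ge0// -natr1 lerD2r.
rewrite rmorphD /= rmorph1 (_ : _ - _ = (u ^+ p - 1) + (H u - t%:C%C)); last by ring.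
rewrite (le_trans (cmodD _ _))// -natr1 mulrDl mul1r addrA addrC lerD//.
apply: (le_trans (cmod_expr_sub1 p (lens_le1 hu))).
apply: (@le_trans _ _ ((p%:R + 1) * d')).
  by rewrite ler_pM// ?ler0n ?lerDl// ltW.
by move: d'e; rewrite ler_pdivlMr// mulrC.
Qed.

(** Averaging the [m] powers of [peak_sum] divides its fixed defect 1 by [m], which makes it at most
    [th / 2]. *)
Lemma peak (e : C) (th s : R) : cmod e = 1 -> 0 < th -> 0 < s -> exists G : C -> C,
  [/\ forall z, cdiff G z, G e = 1,
    forall z, cmod z <= 1 -> exists2 t : R, 0 <= t <= 1 & cmod (G z - t%:C%C) <= th &
    forall z, cmod z <= 1 -> s <= cmod (z - e) -> cmod (G z) <= th].
Proof.
move=> e1 th0 s0; pose m := (Num.truncn (2 / th)).+1.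
have th2 : 0 < th / 2 by rewrite divr_gt0.
have m0 : (0 : R) < m%:R by rewrite ltr0n.
have mth : m%:R^-1 <= th / 2.
  rewrite -[leRHS]invrK lef_pV2 ?posrE ?invr_gt0// invf_div.
  by rewrite ltW// truncnS_gt.
have s2 : 0 < s / 2 by rewrite divr_gt0.
have [H [Hd H1 Ha Hb]] := peak_sum m th2 s2.
have ee : e^* * e = 1 by rewrite mulrC -sqr_cmodC e1 expr1n.
pose U z := (1 + e^* * z) / 2.
have UL z : cmod z <= 1 -> lens (U z).
  by move=> z1; apply: lens_disk; rewrite cmodM cmod_conj e1 mul1r.
have cm : cmod (m%:R : C)^-1 = m%:R^-1 by rewrite cmodV cmod_nat.
exists (fun z => m%:R^-1 * H (U z)); split.
- move=> z; apply: cdiffM; first exact: cdiff_cst.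
  apply: (@cdiff_comp _ H U) => //; apply: cdiffM; last exact: cdiff_cst.
  apply: cdiffD; first exact: cdiff_cst.
  by apply: cdiffM; [exact: cdiff_cst|exact: cdiff_id].
- rewrite /U ee (_ : (1 + 1) / 2 = 1); last by field.
  by rewrite H1 mulVf// pnatr_eq0.
- move=> z /UL/Hb[t /andP[t0 tm] Ht]; exists (t / m%:R).
    by rewrite divr_ge0//= ler_pdivrMr// mul1r.
  rewrite (_ : _ - _ = m%:R^-1 * (H (U z) - t%:C%C)); last first.
    by rewrite rmorphM fmorphV /= rmorph_nat; ring.
  rewrite cmodM cm mulrC ler_pdivrMr//; apply: (le_trans Ht).
  have := mth; rewrite -(ler_pM2r m0) mulVf ?gt_eqF// => ?; lra.
move=> z z1 zs; rewrite cmodM cm mulrC ler_pdivrMr//.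
apply: (le_trans (Ha _ (UL _ z1) _)); last by rewrite mulrC ler_wpM2r ?(ltW m0)//; lra.
rewrite (_ : 1 - U z = - (e^* * (z - e)) / 2); last by rewrite /U mulrBr ee; field.
by rewrite cmodM cmodN cmodM cmod_conj e1 mul1r cmodV cmod_nat ler_wpM2r// invr_ge0.
Qed.

Lemma unit_pts : exists e : nat -> C, (forall i, cmod (e i) = 1) /\ injective e.
Proof.
pose x (i : nat) : C := Complex 1 i%:R.
have x0 i : x i != 0 by rewrite eq_complex /= oner_eq0.
exists (fun i => x i / (x i)^*); split.
  by move=> i; rewrite cmodM cmodV cmod_conj divff// cmod_eq0.
move=> i j /eqP; rewrite eqr_div ?conjc_eq0 ?x0// => /eqP.
move=> /(congr1 (@complex.Im R)) /= h; apply/eqP; rewrite -(eqr_nat R); apply/eqP.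
by move: h; lra.
Qed.

End Peak.

(** * Multiplicities with respect to the two kinds of indicators *)

Section Multiplicity.
Variables (R : realType) (n : nat).
Local Notation C := (R[i]).
Local Notation Cn := 'rV[C]_n.
Implicit Types (x y v l : Cn).

Lemma cmod_entry_enorm x i : cmod (x 0 i) <= enorm x.
Proof.
rewrite -[leLHS]ger0_norm// -sqrtr_sqr ler_sqrt ?sumr_ge0// => [|j _]; last exact: sqr_ge0.
by rewrite (bigD1 i)//= lerDl sumr_ge0// => j _; exact: sqr_ge0.
Qed.

Lemma enorm_le_sum x : enorm x <= \sum_i cmod (x 0 i).
Proof.
have S0 : 0 <= \sum_i cmod (x 0 i) by apply: sumr_ge0.
rewrite -[leRHS]ger0_norm// -sqrtr_sqr ler_sqrt ?sqr_ge0//.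
rewrite expr2 mulr_suml; apply: ler_sum => i _; rewrite expr2 ler_wpM2l//.
by rewrite (bigD1 i)//= lerDl sumr_ge0.
Qed.

Lemma hdotD x y v : hdot (x + y) v = hdot x v + hdot y v.
Proof. by rewrite -big_split; apply: eq_bigr => i _; rewrite mxE mulrDl. Qed.

Lemma hdotZ (c : C) x v : hdot (c *: x) v = c * hdot x v.
Proof. by rewrite mulr_sumr; apply: eq_bigr => i _; rewrite mxE mulrA. Qed.

Lemma hdot_self v : enorm v = 1 -> hdot v v = 1.
Proof.
move=> v1; have : enorm v ^+ 2 = 1 by rewrite v1 expr1n.
rewrite sqr_sqrtr ?sumr_ge0// => [|i _]; last exact: sqr_ge0.
move=> /(congr1 (fun r => r%:C%C : C)); rewrite rmorph1 rmorph_sum => <-.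
by apply: eq_bigr => i _; rewrite -sqr_cmodC.
Qed.

Lemma projperpD v x y : projperp v (x + y) = projperp v x + projperp v y.
Proof. by rewrite /projperp hdotD scalerDl opprD addrACA. Qed.

Lemma projperpZ v (c : C) x : projperp v (c *: x) = c *: projperp v x.
Proof. by rewrite /projperp hdotZ -scalerA -scalerBr. Qed.

Lemma projperp_self v : enorm v = 1 -> projperp v v = 0.
Proof. by move=> v1; rewrite /projperp hdot_self// scale1r subrr. Qed.

Lemma enorm1_cmod v i : enorm v = 1 -> cmod (v 0 i) <= 1.
Proof. by move=> <-; exact: cmod_entry_enorm. Qed.

Let D : R := n%:R * (n%:R + 1) + 1.

Lemma D_gt0 : 0 < D.
Proof. by rewrite ltr_wpDl ?ltr01// mulr_ge0// ?addr_ge0. Qed.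

Lemma linear_bounds v x (c : R) : enorm v = 1 -> 0 <= c -> (forall i, cmod (x 0 i) <= c) ->
  [/\ enorm x <= D * c, enorm (projperp v x) <= D * c,
      cmod (hdot x v) <= D * c & forall i, cmod (projperp v x 0 i) <= D * c].
Proof.
move=> v1 c0 xc; have n0 : (0 : R) <= n%:R by [].
have sumc (F : 'I_n -> R) b : (forall i, F i <= b) -> \sum_i F i <= n%:R * b.
  move=> H; apply: (@le_trans _ _ (\sum_(i < n) b)); first exact: ler_sum.
  by rewrite sumr_const card_ord -[b *+ _]mulr_natl.
have h1 : cmod (hdot x v) <= n%:R * c.
  apply: (le_trans (cmod_sum _ _ _)); apply: sumc => i.
  by rewrite cmodM cmod_conj -[c]mulr1 ler_pM ?enorm1_cmod.
have h2 i : cmod (projperp v x 0 i) <= (n%:R + 1) * c.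
  rewrite !mxE (le_trans (cmodB _ _))// mulrDl mul1r addrC lerD// cmodM.
  by rewrite -[leRHS]mulr1 ler_pM ?enorm1_cmod.
have nD : n%:R <= D by rewrite /D; nra.
have nD1 : n%:R + 1 <= D.
  rewrite /D; have [->|n1] := posnP n; first by rewrite mul0r.
  have : (1 : R) <= n%:R by rewrite ler1n.
  by nra.
split.
- by rewrite (le_trans (enorm_le_sum _))// (le_trans (sumc _ _ xc))// ler_wpM2r.
- rewrite (le_trans (enorm_le_sum _))// (le_trans (sumc _ _ h2))// mulrA ler_wpM2r//.
  by rewrite lerDl.
- by rewrite (le_trans h1)// ler_wpM2r.
- by move=> i; rewrite (le_trans (h2 i))// ler_wpM2r.
Qed.

Lemma elog_le (x y : R) : 0 <= x -> x <= y -> 0 < y -> (elog x <= (ln y)%:E)%E.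
Proof.
move=> x0 xy y0; rewrite /elog; case: eqVneq => [_|xn0]; first exact: leNye.
by rewrite lee_fin ler_ln ?posrE// lt_def xn0.
Qed.

Lemma elog_ge (x y : R) : 0 < y -> y <= x -> ((ln y)%:E <= elog x)%E.
Proof.
move=> y0 yx; have x0 : 0 < x by apply: lt_le_trans yx.
by rewrite /elog gt_eqF// lee_fin ler_ln ?posrE.
Qed.

(** Near 0 the logarithm is negative, so division reverses the inequality, and [L / ln |zeta|] tends
    to 0. The radius [r] makes [|L|] at most [e |ln |zeta||]. *)
Lemma liminf0_ge (F : C -> \bar R) (L d k : R) : 0 < d -> 
  (forall zeta, 0 < cmod zeta < d -> (F zeta <= (L + k * ln (cmod zeta))%:E)%E) ->
  (k%:E <= liminf0 (fun zeta => F zeta * ((ln (cmod zeta))^-1)%:E))%E.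
Proof.
move=> d0 H; apply/lee_addgt0Pr => e e0; rewrite -leeBlDr//.
pose r := Num.min d (expR (- ((`|L| + 1) / e))).
have r0 : 0 < r by rewrite lt_min d0 expR_gt0.
apply: (@le_trans _ _ (ereal_inf [set F zeta * ((ln (cmod zeta))^-1)%:E | zeta in [set zeta | (0 < cmod zeta < r)%R]])%E); last first.
  by apply: ereal_sup_ubound; exists r.
apply: le_ereal_inf_tmp => _ [z /= /andP[z0 zr] <-].
move: zr; rewrite lt_min => /andP[zd zL].
have /H : 0 < cmod z < d by rewrite z0.
have L0 : 0 < (`|L| + 1) / e by rewrite divr_gt0// ltr_wpDl.
have lnz : ln (cmod z) < - ((`|L| + 1) / e).
  by rewrite -(expRK (- _)) ltr_ln ?posrE// expR_gt0.
set t := ln (cmod z) in lnz *.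
have t0 : t < 0 by lra.
have ti0 : t^-1 < 0 by rewrite invr_lt0.
case: (F z) => [f| |]; rewrite ?leeNy_eq//.
  rewrite lee_fin => Ff; rewrite -EFinM -EFinB lee_fin.
  rewrite ler_ndivlMr// .
  have := ler_norm L; have : (k - e) * t = k * t - e * t by ring.
  move: lnz; rewrite -ltrN2 opprK ltr_pdivrMr// => lnz ? ?; lra.
move=> _; rewrite mulNyr /= ltr0_sg// EFinN mulN1e leey //.
Qed.

(** Each infimum over a punctured disk is tested at one small positive real point. *)
Lemma liminf0_le (F : C -> \bar R) (L d k : R) : 0 < d ->
  (forall zeta, 0 < cmod zeta < d -> ((L + k * ln (cmod zeta))%:E <= F zeta)%E) ->
  (liminf0 (fun zeta => F zeta * ((ln (cmod zeta))^-1)%:E) <= k%:E)%E.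
Proof.
move=> d0 H; apply: ge_ereal_sup => _ [r /= r0 <-].
apply/lee_addgt0Pr => e e0.
pose s := Num.min (Num.min d r / 2) (expR (- ((`|L| + 1) / e))).
have s0 : 0 < s by rewrite lt_min expR_gt0 divr_gt0// lt_min d0.
have sdr : s < Num.min d r.
  by rewrite gt_min ltr_pdivrMr// ltr_pMr ?ltr1n// lt_min d0 r0.
move: (sdr); rewrite lt_min => /andP[sd sr].
have cs : cmod s%:C%C = s by rewrite cmod_real gtr0_norm.
apply: (@le_trans _ _ (F s%:C%C * ((ln s)^-1)%:E)%E).
  by apply: ereal_inf_lbound; exists s%:C%C; rewrite /= cs// s0.
have := H s%:C%C; rewrite cs s0 sd => /(_ isT).
have L0 : 0 < (`|L| + 1) / e by rewrite divr_gt0// ltr_wpDl.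
have lns : ln s <= - ((`|L| + 1) / e).
  by rewrite -(expRK (- _)) ler_ln ?posrE ?expR_gt0// ge_min lexx orbT.
set t := ln s in lns *.
have t0 : t < 0 by lra.
have ti0 : t^-1 < 0 by rewrite invr_lt0.
case: (F _) => [f| |]; rewrite ?leeNy_eq//.
  rewrite lee_fin => Ff; rewrite -EFinM -EFinD lee_fin ler_ndivrMr//.
  have := ler_norm (- L); rewrite normrN; have : (k + e) * t = k * t + e * t by ring.
  move: lns; rewrite -lerN2 opprK ler_pdivrMr// => lns ? ?; lra.
move=> _; rewrite mulyr /= ltr0_sg// EFinN mulN1e leNye//.
Qed.

Lemma vcder_lip phi (al : C) l : vcder phi al l -> exists L d : R, [/\ 0 < L, 0 < d &
  forall h, cmod h < d -> forall i, cmod ((phi (al + h) - phi al) 0 i) <= L * cmod h].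
Proof.
move=> H; have /choice[d Hd] i : exists d : R, 0 < d /\ forall h, cmod h < d ->
    cmod (phi (al + h) 0 i - phi al 0 i) <= (cmod (l 0 i) + 1) * cmod h.
  by have [d d0 Hd] := cder_lip (H i); exists d.
exists (\sum_i cmod (l 0 i) + 1), (\big[Num.min/1]_i d i); split.
- by rewrite ltr_wpDl ?ltr01// sumr_ge0.
- by apply: lt_bigmin => // i _; case: (Hd i).
move=> h hd i; rewrite !mxE.
have /(proj2 (Hd i)) : cmod h < d i by apply: (lt_le_trans hd); apply: bigmin_le.
move=> /le_trans; apply; rewrite ler_wpM2r// lerD2r (bigD1 i)//= lerDl.
by rewrite sumr_ge0.
Qed.

Lemma vcder_small phi (al : C) l (e : R) : vcder phi al l -> 0 < e -> exists2 d : R, 0 < d &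
  forall h, cmod h < d -> forall i, cmod ((phi (al + h) - phi al - h *: l) 0 i) <= e * cmod h.
Proof.
move=> H e0; have /choice[d Hd] i : exists d : R, 0 < d /\ forall h, cmod h < d ->
    cmod (phi (al + h) 0 i - phi al 0 i - l 0 i * h) <= e * cmod h.
  by have [d d0 Hd] := H i e e0; exists d.
exists (\big[Num.min/1]_i d i).
  by apply: lt_bigmin => // i _; case: (Hd i).
move=> h hd i; rewrite !mxE [h * _]mulrC; apply: (proj2 (Hd i)).
by apply: (lt_le_trans hd); apply: bigmin_le.
Qed.

(** A Lipschitz bound already gives order at least 1, and the mass caps it at 1, so a vanishing
    derivative makes no difference. *)
Lemma mult_pt phi (al : C) l a : vcder phi al l -> phi al = a ->
  mult 1 (@Psi_pt R n) phi a al = 1%:E.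
Proof.
move=> dphi pa; rewrite /mult pa eqxx; apply: min_l.
have [L [d [L0 d0 H]]] := vcder_lip dphi.
apply: (@liminf0_ge _ (ln (n%:R * L + 1)) d) => // z /andP[z0 zd].
have nL : 0 <= n%:R * L by rewrite mulr_ge0 ?(ltW L0).
have nL1 : 0 < n%:R * L + 1 by rewrite ltr_wpDl ?ltr01.
rewrite mul1r -lnM ?posrE//; apply: elog_le; [exact: sqrtr_ge0| |by rewrite mulr_gt0].
apply: (le_trans (enorm_le_sum _)).
apply: (@le_trans _ _ (\sum_(i < n) L * cmod z)).
  by apply: ler_sum => i _; have := H z zd i; rewrite pa.
rewrite sumr_const card_ord -[_ *+ _]mulr_natl mulrA ler_wpM2r// lerDl//.
Qed.

Lemma Psi_dir_le v x (L k t : R) : 0 < L -> 0 < t ->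
  enorm (projperp v x) <= L * expR (k * ln t) ->
  cmod (hdot x v) ^+ 2 <= L * expR (k * ln t) ->
  (Psi_dir v x <= (ln L + k * ln t)%:E)%E.
Proof.
move=> L0 t0 h1 h2; have Lp : 0 < L * expR (k * ln t) by rewrite mulr_gt0 ?expR_gt0.
have LE : ln L + k * ln t = ln (L * expR (k * ln t)) by rewrite lnM ?posrE ?expR_gt0// expRK.
rewrite /Psi_dir ge_max LE; apply/andP; split; first by apply: elog_le => //; exact: sqrtr_ge0.
rewrite /elog; case: eqVneq => [_|hn0]; first by rewrite mulrNy gtr0_sg// mul1e leNye.
have hp : 0 < cmod (hdot x v) by rewrite lt_def hn0/=.
rewrite -EFinM lee_fin -[2]/(2%:R) mulr_natl -lnXn// ler_ln ?posrE ?exprn_gt0//.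
Qed.

(** Both the projection and the square of the [v] component are bounded by a multiple of
    [|zeta|]. *)
Lemma mult_dir_ge1 v phi (al : C) l a : enorm v = 1 -> vcder phi al l -> phi al = a ->
  (1%:E <= mult 2 (Psi_dir v) phi a al)%E.
Proof.
move=> v1 dphi pa; rewrite /mult pa eqxx le_min; apply/andP; split; first by rewrite lee_fin ler1n.
have [L [d [L0 d0 H]]] := vcder_lip dphi; have D0 := D_gt0.
pose M := D * L + (D * L) ^+ 2.
have M0 : 0 < M by rewrite addr_gt0 ?exprn_gt0 ?mulr_gt0.
apply: (@liminf0_ge _ (ln M) (Num.min d 1)); first by rewrite lt_min d0 ltr01.
move=> z /andP[z0]; rewrite lt_min => /andP[zd z1].
have [||_ h1 h2 _] := @linear_bounds v (phi (al + z) - a) (L * cmod z) v1.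
- by rewrite mulr_ge0 ?(ltW L0).
- by move=> i; rewrite -pa; apply: H.
apply: Psi_dir_le => //; rewrite mul1r lnK//.
  apply: (le_trans h1); rewrite mulrA ler_wpM2r// lerDl ltW// exprn_gt0// mulr_gt0//.
apply: (@le_trans _ _ ((D * (L * cmod z)) ^+ 2)).
  by rewrite lerXn2r ?nnegrE// mulr_ge0 ?(ltW D0)// mulr_ge0 ?(ltW L0).
rewrite mulrA exprMn (expr2 (cmod z)) mulrA ler_wpM2r//.
have q0 : 0 <= D * L by rewrite mulr_ge0 ?(ltW D0) ?(ltW L0).
rewrite /M; have := sqr_ge0 (D * L); have := ltW z1; have := cmod_ge0 z; nra.
Qed.

Lemma mult_dir_le2 v phi (al : C) a : (mult 2 (Psi_dir v) phi a al <= 2%:E)%E.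
Proof. by rewrite /mult; case: ifP => _; rewrite ?ge_min ?lexx// lee_fin. Qed.

(** A derivative transverse to [v] keeps the projected increment at least [m / 2 * |zeta|]. *)
Lemma mult_dir_le1 v phi (al : C) l a : enorm v = 1 -> vcder phi al l -> phi al = a ->
  projperp v l != 0 -> (mult 2 (Psi_dir v) phi a al <= 1%:E)%E.
Proof.
move=> v1 dphi pa pl; rewrite /mult pa eqxx ge_min; apply/orP; right.
have [i pli] : exists i, projperp v l 0 i != 0.
  apply: contrapT => /forallNP Hn; move/eqP: pl; apply; apply/rowP => i.
  by rewrite [RHS]mxE; apply/eqP; apply: contrapT => /negP; exact: Hn.
have D0 := D_gt0; set m := cmod (projperp v l 0 i).
have m0 : 0 < m by rewrite cmod_gt0.
have e0 : 0 < m / (2 * D) by rewrite divr_gt0 ?mulr_gt0.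
have [d d0 H] := vcder_small dphi e0.
apply: (@liminf0_le _ (ln (m / 2)) d) => // z /andP[z0 zd].
rewrite mul1r -lnM ?posrE ?divr_gt0//; apply: (@le_trans _ _ (elog (enorm (projperp v (phi (al + z) - a))))).
  apply: elog_ge; first by rewrite mulr_gt0// divr_gt0.
  apply: le_trans (cmod_entry_enorm _ i).
  rewrite (_ : phi (al + z) - a = (phi (al + z) - a - z *: l) + z *: l); last by rewrite subrK.
  have addE (A B : Cn) : (A + z *: B) 0 i = A 0 i + z * B 0 i by rewrite !mxE.
  rewrite projperpD projperpZ addE.
  have [||_ _ _ /(_ i) h] := @linear_bounds v (phi (al + z) - a - z *: l) (m / (2 * D) * cmod z) v1.
  - by rewrite mulr_ge0 ?(ltW e0).
  - by move=> j; rewrite -pa; apply: H.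
  have DE : D * (m / (2 * D) * cmod z) = m / 2 * cmod z by field; rewrite gt_eqF.
  rewrite DE in h.
  have := cmod_sub_ge (z * projperp v l 0 i) (- projperp v (phi (al + z) - a - z *: l) 0 i).
  rewrite opprK cmodN cmodM -/m [X in _ <= cmod X]addrC; lra.
by rewrite /Psi_dir le_max lexx.
Qed.

(** When the derivative is along [v], the projection sees only the remainder, which must be
    quadratic and not merely [o(|h|)] to reach order 2. *)
Lemma mult_dir_eq2 v phi (al : C) l a (K d : R) : enorm v = 1 -> vcder phi al l -> phi al = a ->
  projperp v l = 0 -> 0 < d -> (forall h, cmod h < d -> forall i,
     cmod ((phi (al + h) - phi al - h *: l) 0 i) <= K * cmod h ^+ 2) ->
  mult 2 (Psi_dir v) phi a al = 2%:E.
Proof.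
move=> v1 dphi pa pl d0 HK; rewrite /mult pa eqxx; apply: min_l.
have [L [d' [L0 d'0 H]]] := vcder_lip dphi; have D0 := D_gt0.
pose M := D * `|K| + (D * L) ^+ 2.
have M0 : 0 < M by rewrite ltr_wpDl ?mulr_ge0 ?(ltW D0) ?exprn_gt0 ?mulr_gt0.
apply: (@liminf0_ge _ (ln M) (Num.min d d')); first by rewrite lt_min d0 d'0.
move=> z /andP[z0]; rewrite lt_min => /andP[zd zd'].
have K0 : 0 <= `|K| * cmod z ^+ 2 by rewrite mulr_ge0 ?exprn_ge0.
have [|_ h1 _ _] := @linear_bounds v (phi (al + z) - phi al - z *: l) (`|K| * cmod z ^+ 2) v1 K0.
  by move=> i; apply: (le_trans (HK z zd i)); rewrite ler_wpM2r ?exprn_ge0 ?ler_norm.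
have [||_ _ h2 _] := @linear_bounds v (phi (al + z) - a) (L * cmod z) v1.
- by rewrite mulr_ge0 ?(ltW L0).
- by move=> i; rewrite -pa; apply: H.
have E : expR (2 * ln (cmod z)) = cmod z ^+ 2 by rewrite mulr_natl -lnXn// lnK// posrE exprn_gt0.
apply: Psi_dir_le => //; rewrite E.
  rewrite (_ : phi (al + z) - a = (phi (al + z) - phi al - z *: l) + z *: l); last by rewrite subrK pa.
  rewrite projperpD projperpZ pl scaler0 addr0 (le_trans h1)// mulrA ler_wpM2r ?exprn_ge0//.
  by rewrite lerDl ltW// exprn_gt0 ?mulr_gt0.
apply: (@le_trans _ _ ((D * (L * cmod z)) ^+ 2)).
  by rewrite lerXn2r ?nnegrE// mulr_ge0 ?(ltW D0)// mulr_ge0 ?(ltW L0).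
rewrite mulrA exprMn ler_wpM2r ?exprn_ge0// lerDr mulr_ge0// ltW//.
Qed.

End Multiplicity.

(** * Indexing of the points and of the limit system *)

Lemma pair_code_inj : injective (fun i : nat * bool => i.1 * 2 + i.2)%N.
Proof. by move=> [i []] [j []] /= e; congr (_, _); lia. Qed.

Section Index.
Variables (M N : nat).

(* [(j, true)] stands for [a_j] or [a'_j] and [(j, false)] for [a''_j]. *)
Definition idx : seq (nat * bool) :=
  [seq (j, true) | j <- iota 0 M] ++
  flatten [seq [:: (j, true); (j, false)] | j <- iota M (N - M)].

Lemma mem_idx i : (M <= N)%N -> (i \in idx) = (i.1 < N)%N && (i.2 || (M <= i.1)%N).
Proof.
move=> MN; case: i => j b; rewrite mem_cat /=.
have -> : ((j, b) \in [seq (j, true) | j <- iota 0 M]) = (j < M)%N && b.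
  apply/mapP/andP => [[j' + [-> ->]]|[jM ->]]; first by rewrite mem_iota.
  by exists j; rewrite ?mem_iota.
have -> : ((j, b) \in flatten [seq [:: (j, true); (j, false)] | j <- iota M (N - M)]) =
    (M <= j < N)%N.
  apply/flattenP/idP => [[s /mapP[j' + ->]]|jMN].
    by rewrite mem_iota subnKC// !inE => + /orP[/eqP[-> _]|/eqP[-> _]].
  exists [:: (j, true); (j, false)]; last by case: b; rewrite !inE eqxx ?orbT.
  by apply/mapP; exists j; rewrite ?mem_iota ?subnKC.
by case: b; lia.
Qed.

Lemma idx_uniq : uniq idx.
Proof.
have U2 m k : uniq (flatten [seq [:: (j, true); (j, false)] | j <- iota m k]).
  elim: k m => //= k IH m; rewrite IH andbT !inE /=.
  suff H c : (m, c) \notin flatten [seq [:: (j, true); (j, false)] | j <- iota m.+1 k].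
    by rewrite negb_or !H !andbT; apply/eqP => -[].
  apply/flattenP => -[s /mapP[j' + ->]]; rewrite mem_iota !inE => /andP[h _].
  by move=> /orP[] /eqP[e _]; move: h; rewrite -e ltnn.
rewrite cat_uniq U2 andbT map_inj_uniq ?iota_uniq /=; last by move=> ? ? [].
apply/hasPn => i /flattenP[s /mapP[j + ->]]; rewrite mem_iota => /andP[h _] H.
apply/mapP => -[j']; rewrite mem_iota /= add0n => h' E.
by move: H; rewrite E !inE => /orP[] /eqP[e]; move: h'; rewrite e ltnNge h.
Qed.

Lemma big_idx (V : nmodType) (F : nat * bool -> V) : (M <= N)%N ->
  (\sum_(i <- idx) F i)%R =
  (\sum_(j < N) (F (j : nat, true) + if (M <= j)%N then F (j : nat, false) else 0))%R.
Proof.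
move=> MN; rewrite big_cat big_map big_flatten /= big_map.
rewrite -(big_mkord xpredT (fun j => F (j, true) + if (M <= j)%N then F (j, false) else 0)%R).
rewrite [RHS](big_cat_nat (n := M))//=; congr (_ + _)%R.
  rewrite /index_iota subn0 big_seq [RHS]big_seq; apply: eq_bigr => j; rewrite mem_iota /= => jM.
  by rewrite leqNgt jM addr0.
rewrite /index_iota big_seq [RHS]big_seq; apply: eq_bigr => j; rewrite mem_iota => /andP[-> _].
by rewrite big_cons big_seq1.
Qed.

Variables (R : realType) (n : nat).
Local Notation C := (R[i]).
Local Notation Cn := 'rV[C]_n.

Definition pt (a a' a'' : nat -> C -> Cn) (eps : C) (i : nat * bool) : Cn :=
  if (i.1 < M)%N then a i.1 eps else if i.2 then a' i.1 eps else a'' i.1 eps.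

Lemma Seps_map a a' a'' eps : Seps M N a a' a'' eps = [seq pt a a' a'' eps i | i <- idx].
Proof.
rewrite /Seps /idx map_cat -map_comp; congr (_ ++ _).
  by apply/eq_in_map => j; rewrite mem_iota /= /pt /= => ->.
rewrite map_flatten -map_comp; congr flatten.
apply/eq_in_map => j; rewrite mem_iota => /andP[jM _].
by rewrite /pt /= ltnNge jM.
Qed.

Lemma size_limit_system (b v : nat -> Cn) : (M <= N)%N -> size (limit_system M N b v) = N.
Proof. by move=> MN; rewrite size_cat !size_map !size_iota subnKC. Qed.

Lemma nth_limit_system (b v : nat -> Cn) k : (k < N)%N ->
  nth (pole0 R n) (limit_system M N b v) k =
  if (k < M)%N then Pole (b k) (@Psi_pt R n) 1 else Pole (b k) (Psi_dir (v k)) 2.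
Proof.
move=> kN; rewrite nth_cat size_map size_iota; case: ltnP => kM.
  by rewrite (nth_map 0%N) ?size_iota// nth_iota.
have kNM : (k - M < N - M)%N by lia.
have Hk : nth 0%N (iota M (N - M)) (k - M) = k by rewrite nth_iota ?subnKC.
rewrite (nth_map 0%N) ?size_iota; [by rewrite Hk|exact: kNM].
Qed.

End Index.

(** * Configurations compared with admissible pairs *)

Section Configuration.
Variables (R : realType) (n : nat) (Om : set 'rV[R[i]]_n) (M N : nat).
Local Notation C := (R[i]).
Local Notation Cn := 'rV[C]_n.
Variables (b v : nat -> Cn) (z : Cn) (K : R).
Implicit Types (phi : C -> Cn) (al : C).
Hypothesis MN : (M <= N)%N.
Hypothesis OmK : forall y, Om y -> forall i, cmod (y 0 i) <= K.
Hypothesis zb : forall j, (j < N)%N -> z != b j.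
Hypothesis v1 : forall j, (M <= j < N)%N -> enorm (v j) = 1.

(* A node [x i] outside the unit disk means that the corresponding point is not
   hit; coinciding nodes of a pair encode a single node of multiplicity 2. *)
Definition config (phi : C -> Cn) (x : nat * bool -> C) :=
  [/\ hol_in Om phi, phi 0 = z,
    forall i, i \in idx M N -> cmod (x i) < 1 -> phi (x i) = b i.1 &
    forall j, (M <= j < N)%N -> x (j, true) = x (j, false) -> cmod (x (j, true)) < 1 ->
      exists2 l, vcder phi (x (j, true)) l & projperp (v j) l = 0].

Definition lcost (w : C) : R := if cmod w < 1 then ln (cmod w) else 0.

Definition cost (x : nat * bool -> C) : R := \sum_(i <- idx M N) lcost (x i).

(** Supplies the quadratic remainder demanded by [mult_dir_eq2]. *)
Lemma hol_second_order phi al l : hol_in Om phi -> cmod al < 1 -> vcder phi al l ->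
  exists K' d : R, 0 < d /\ forall h, cmod h < d -> forall i,
     cmod ((phi (al + h) - phi al - h *: l) 0 i) <= K' * cmod h ^+ 2.
Proof.
move=> hphi al1 dl; pose r := (1 - cmod al) / 2.
have r0 : 0 < r by rewrite /r; lra.
have inD h : cmod h <= r -> cmod (al + h) < 1.
  by move=> hr; rewrite (le_lt_trans (cmodD _ _))//; rewrite /r in hr; lra.
exists (`|K| / (r * (r / 2))), (r / 2); split; first by rewrite divr_gt0.
move=> h hr i; rewrite !mxE [h * _]mulrC.
have hr' : cmod h < r by lra.
have := @cauchy_taylor R (fun t => phi t 0 i) al r `|K| r0
  (fun w wr => (hphi _ (inD w wr)).2 i)
  (fun w wr => le_trans (OmK (hphi _ (inD w wr)).1 i) (ler_norm K)) (l 0 i) h (dl i) hr'.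
move=> /le_trans; apply; rewrite [leRHS]mulrAC ler_wpM2l ?mulr_ge0 ?exprn_ge0//.
by rewrite lef_pV2 ?posrE ?mulr_gt0 ?subr_gt0 ?divr_gt0// ler_pM2l//; lra.
Qed.

Lemma hol_vcder phi al : hol_in Om phi -> cmod al < 1 -> exists l, vcder phi al l.
Proof. by move=> hphi /hphi[_ /vcdiff_vcder]. Qed.

Lemma ln_cmod_lt0 (al : C) : al != 0 -> cmod al < 1 -> ln (cmod al) < 0.
Proof. by move=> a0 a1; rewrite ln_lt0// a1 cmod_gt0 a0. Qed.

Lemma between12 (m : \bar R) : (1%:E <= m)%E -> (m <= 2%:E)%E ->
  exists2 r : R, 1 <= r <= 2 & m = r%:E.
Proof. by case: m => [r| |]// h1 h2; exists r; rewrite // -!lee_fin h1. Qed.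

Lemma elog_cmod (al : C) : al != 0 -> elog (cmod al) = (ln (cmod al))%:E.
Proof. by move=> a0; rewrite /elog cmod_eq0 (negbTE a0). Qed.

Let kind k := if (k < M)%N then Pole (b k) (@Psi_pt R n) 1 else Pole (b k) (Psi_dir (v k)) 2.
Let mu phi k al := mult (pole_mass (kind k)) (pole_ind (kind k)) phi (pole_pt (kind k)) al.

Definition good_seq phi k (A : seq C) :=
  [/\ uniq A, forall al, al \in A -> cmod al < 1 /\ phi al = b k &
    (\sum_(al <- A) mu phi k al <= (pole_mass (kind k))%:E)%E].

Definition seq_cost phi k (A : seq C) := (\sum_(al <- A) mu phi k al * elog (cmod al))%E.

Lemma kind_pt k : pole_pt (kind k) = b k.
Proof. by rewrite /kind; case: ifP. Qed.

Lemma admissibleE phi As : admissible Om (limit_system M N b v) z phi As <->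
  [/\ hol_in Om phi, phi 0 = z, size As = N & forall k, (k < N)%N -> good_seq phi k (nth [::] As k)].
Proof.
have E k (kN : (k < N)%N) := @nth_limit_system M N R n b v k kN.
rewrite /admissible size_limit_system//; split=> -[h1 h2 h3 h4]; split=> //.
- exact/hol_diskE.
- move=> k kN; have := h4 k kN; rewrite E// -/(kind k) => -[g1 g2 g3]; split=> // al /g2.
  by rewrite kind_pt.
- exact/hol_diskE.
move=> k kN; have [g1 g2 g3] := h4 k kN; rewrite E// -/(kind k); split=> // al /g2.
by rewrite kind_pt.
Qed.

Lemma gen_sumE phi As : (\sum_(k < size (limit_system M N b v)) \sum_(alpha <- nth [::] As k)
   mult (pole_mass (nth (pole0 R n) (limit_system M N b v) k))
     (pole_ind (nth (pole0 R n) (limit_system M N b v) k)) phi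
     (pole_pt (nth (pole0 R n) (limit_system M N b v) k)) alpha * elog (cmod alpha))%E =
  (\sum_(k < N) seq_cost phi k (nth [::] As k))%E.
Proof.
rewrite -(big_mkord xpredT (fun k => \sum_(alpha <- nth [::] As k)
   mult (pole_mass (nth (pole0 R n) (limit_system M N b v) k))
     (pole_ind (nth (pole0 R n) (limit_system M N b v) k)) phi
     (pole_pt (nth (pole0 R n) (limit_system M N b v) k)) alpha * elog (cmod alpha))%E).
rewrite size_limit_system// big_mkord; apply: eq_bigr => k _.
by rewrite (@nth_limit_system M N R n b v k (ltn_ord k)).
Qed.

Lemma node_neq0 phi k al : (k < N)%N -> phi 0 = z -> phi al = b k -> al != 0.
Proof. by move=> kN p0 pa; apply: contra (zb kN) => /eqP a0; rewrite -p0 -a0 pa. Qed.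

Lemma mu_pt phi k al : hol_in Om phi -> (k < M)%N -> cmod al < 1 -> phi al = b k -> mu phi k al = 1%:E.
Proof.
move=> hphi kM al1 pa; have [l dl] := hol_vcder hphi al1.
by rewrite /mu /kind kM /=; apply: mult_pt dl pa.
Qed.

Lemma mu_dir phi k al : hol_in Om phi -> (M <= k < N)%N -> cmod al < 1 -> phi al = b k ->
  exists2 r : R, 1 <= r <= 2 & mu phi k al = r%:E.
Proof.
move=> hphi kMN al1 pa; have [l dl] := hol_vcder hphi al1.
apply: between12; rewrite /mu /kind ltnNge (proj1 (andP kMN)) /=.
  by apply: mult_dir_ge1 dl pa; exact: v1.
exact: mult_dir_le2.
Qed.

(** Since every multiplicity is at least 1, the mass cap leaves at most one node at a point pole and
    at most two at a directional pole. Absent nodes are encoded by 1, which lies outside the open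
    disk and costs 0. *)
Lemma admissible_config phi As : admissible Om (limit_system M N b v) z phi As ->
  exists2 x, config phi x & ((cost x)%:E <= \sum_(k < N) seq_cost phi k (nth [::] As k))%E.
Proof.
move=> /admissibleE[hphi p0 sA gA].
pose A k := nth [::] As k.
have lc1 : lcost 1 = 0 by rewrite /lcost cmod1 ltxx.
have Hk k : exists y : C * C, (k < N)%N -> [/\
   cmod y.1 < 1 -> phi y.1 = b k, (M <= k)%N -> cmod y.2 < 1 -> phi y.2 = b k,
   (M <= k)%N -> y.1 = y.2 -> cmod y.1 < 1 -> exists2 l, vcder phi y.1 l & projperp (v k) l = 0 &
   ((lcost y.1 + if (M <= k)%N then lcost y.2 else 0)%:E <= seq_cost phi k (A k))%E].
  have [kN|] := ltnP k N; last by exists (0, 0).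
  have [uA pA mA] := gA k kN; rewrite -/(A k) in uA pA mA.
  have cN1 : cmod (1 : C) < 1 = false by rewrite cmod1 ltxx.
  have [kM|kM] := ltnP k M.
    case EA : (A k) uA pA mA => [|al [|al' A']] uA pA mA.
    - by exists (1, 1) => _; rewrite /= cN1; split=> //; rewrite /seq_cost big_nil lc1 addr0.
    - have [al1 pal] := pA al (mem_head _ _).
      exists (al, 1) => _; split=> //=; rewrite ?cN1//.
      rewrite /seq_cost big_seq1 mu_pt// mul1e elog_cmod ?(node_neq0 kN p0 pal)//.
      by rewrite addr0 /lcost al1.
    exfalso; move: mA; rewrite !big_cons.
    have [al1 pal] := pA al (mem_head _ _).
    have [al1' pal'] := pA al' ltac:(by rewrite !inE eqxx orbT).
    rewrite !mu_pt// {1}/kind kM /= addeA -EFinD.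
    have : (0 <= \sum_(j <- A') mu phi k j)%E.
      rewrite big_seq; apply: sume_ge0 => j jA.
      by have [j1 pj] := pA j ltac:(by rewrite !inE jA !orbT); rewrite mu_pt.
    case: (\sum_(j <- A') _)%E => [s| |]//; rewrite -?EFinD !lee_fin; lra.
  have kMN : (M <= k < N)%N by rewrite kM kN.
  have mk : pole_mass (kind k) = 2 by rewrite /kind ltnNge kM.
  case EA : (A k) uA pA mA => [|al [|al' [|al'' A']]] uA pA mA.
  - by exists (1, 1) => _; rewrite /= cN1; split=> //; rewrite /seq_cost big_nil lc1 addr0.
  - have [al1 pal] := pA al (mem_head _ _).
    have a0 := node_neq0 kN p0 pal.
    have lnl0 := ln_cmod_lt0 a0 al1.
    have [l dl] := hol_vcder hphi al1.
    have [r /andP[r1 r2] mr] := mu_dir hphi kMN al1 pal.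
    (* A tangential node is doubled: [2 ln |al|] is at most [r ln |al|] because [r <= 2]. A
       transverse one has [r = 1] and stays single. *)
    have [pl|pl] := eqVneq (projperp (v k) l) 0.
      exists (al, al) => _; split=> //=; first by exists l.
      rewrite /seq_cost big_seq1 mr elog_cmod// -EFinM lee_fin /lcost al1.
      nra.
    exists (al, 1) => _; split=> //=; rewrite ?cN1//.
      by move=> _ a1; move: al1; rewrite a1 cN1.
    have m1 : r <= 1.
      rewrite -lee_fin -mr /mu /kind ltnNge kM /=.
      by apply: mult_dir_le1 dl pal pl; exact: v1.
    rewrite /seq_cost big_seq1 mr elog_cmod// -EFinM lee_fin lc1 /lcost al1 addr0.
    by have -> : r = 1; [lra|rewrite mul1r].
  - have [al1 pal] := pA al (mem_head _ _).
    have [al1' pal'] := pA al' ltac:(by rewrite !inE eqxx orbT).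
    have a0 := node_neq0 kN p0 pal; have a0' := node_neq0 kN p0 pal'.
    have [r /andP[r1 r2] mr] := mu_dir hphi kMN al1 pal.
    have [r' /andP[r1' r2'] mr'] := mu_dir hphi kMN al1' pal'.
    exists (al, al') => _; split=> //=.
      by move=> _ aa; move: uA; rewrite /= aa inE eqxx.
    (* [r + r' <= 2] with both at least 1 forces [r = r' = 1]. *)
    move: mA; rewrite !big_cons big_nil mr mr' adde0 -EFinD mk lee_fin => mA.
    rewrite /seq_cost !big_cons big_nil mr mr' adde0 !elog_cmod// -!EFinM -EFinD lee_fin.
    rewrite /lcost al1 al1'; have -> : r = 1 by lra.
    by have -> : r' = 1; [lra|rewrite !mul1r].
  exfalso; move: mA; rewrite !big_cons mk.
  have [al1 pal] := pA al (mem_head _ _).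
  have [al1' pal'] := pA al' ltac:(by rewrite !inE eqxx orbT).
  have [al1'' pal''] := pA al'' ltac:(by rewrite !inE eqxx !orbT).
  have [r /andP[r1 r2] ->] := mu_dir hphi kMN al1 pal.
  have [r' /andP[r1' r2'] ->] := mu_dir hphi kMN al1' pal'.
  have [r'' /andP[r1'' r2''] ->] := mu_dir hphi kMN al1'' pal''.
  have : (0 <= \sum_(j <- A') mu phi k j)%E.
    rewrite big_seq; apply: sume_ge0 => j jA.
    have [j1 pj] := pA j ltac:(by rewrite !inE jA !orbT).
    by have [s /andP[s1 _] ->] := mu_dir hphi kMN j1 pj; rewrite lee_fin (le_trans ler01).
  case: (\sum_(j <- A') _)%E => [s| |]//; rewrite -?EFinD !lee_fin; lra.
have [y Hy] := choice Hk.
exists (fun i => if i.2 then (y i.1).1 else (y i.1).2).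
  split=> // [[j c]|j /andP[jM jN] /=].
    by rewrite mem_idx// => /andP[/= /Hy[h1 h2 _ _]]; case: c => //= /h2.
  by have [_ _ + _] := Hy j jN; apply.
rewrite /cost big_idx//= -sumEFin; apply: lee_sum => j _.
by have [_ _ _] := Hy j (ltn_ord j).
Qed.

(* The first alternative, an identically zero projection, means [n = 1]. *)
Definition strong_config phi x := config phi x /\ forall j, (M <= j < N)%N ->
  cmod (x (j, true)) < 1 -> cmod (x (j, false)) < 1 -> x (j, true) != x (j, false) ->
  (forall u, projperp (v j) u = 0) \/
  (forall c, exists2 l, vcder phi (x (j, c)) l & projperp (v j) l != 0).

Lemma mu_eq2 phi k al l : hol_in Om phi -> (M <= k < N)%N -> cmod al < 1 -> phi al = b k ->
  vcder phi al l -> projperp (v k) l = 0 -> mu phi k al = 2%:E.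
Proof.
move=> hphi kMN al1 pal dl pl; have [K' [d [d0 H]]] := hol_second_order hphi al1 dl.
rewrite /mu /kind ltnNge (proj1 (andP kMN)) /=.
by apply: (mult_dir_eq2 _ dl pal pl d0 H); exact: v1.
Qed.

(** Two distinct nodes at a directional pole respect the cap only if both are transverse to [v_j],
    which [strong_config] ensures; a merged pair becomes one node of multiplicity 2. *)
Lemma strong_config_admissible phi x : strong_config phi x -> exists As,
  admissible Om (limit_system M N b v) z phi As /\
  (\sum_(k < N) seq_cost phi k (nth [::] As k) <= (cost x)%:E)%E.
Proof.
move=> [[hphi p0 px dx] sx].
have Hk k : exists A, (k < N)%N -> good_seq phi k A /\
   (seq_cost phi k A <= (lcost (x (k, true)) + if (M <= k)%N then lcost (x (k, false)) else 0)%:E)%E.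
  have [kN|] := ltnP k N; last by exists [::].
  have xt : (k, true) \in idx M N by rewrite mem_idx//= kN.
  have pt := px _ xt; rewrite /= in pt.
  have S1 al : (k < N)%N -> cmod al < 1 -> phi al = b k -> 
     good_seq phi k [:: al] /\ (seq_cost phi k [:: al] <= (ln (cmod al))%:E)%E.
    move=> _ al1 pal; have a0 := node_neq0 kN p0 pal.
    have lnl0 := ln_cmod_lt0 a0 al1.
    have [r [r1 mr rm]] : exists r, [/\ 1 <= r, mu phi k al = r%:E & r <= pole_mass (kind k)].
      have [kM|kM] := ltnP k M; first by exists 1; rewrite mu_pt// /kind kM.
      have kMN : (M <= k < N)%N by rewrite kM kN.
      have [r /andP[r1 r2] mr] := mu_dir hphi kMN al1 pal.
      by exists r; split=> //; rewrite /kind ltnNge kM.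
    split; last by rewrite /seq_cost big_seq1 mr elog_cmod// -EFinM lee_fin; nra.
    split=> // [al'|]; last by rewrite big_seq1 mr lee_fin.
    by rewrite inE => /eqP ->.
  have S0 : good_seq phi k [::] /\ seq_cost phi k [::] = 0%E.
    by split; [split=> //; rewrite big_nil lee_fin /kind; case: ifP|rewrite /seq_cost big_nil].
  have [kM|kM] := ltnP k M.
    rewrite addr0 /lcost; case: ifP => [al1|_].
      by exists [:: x (k, true)] => _; apply: S1 => //; exact: pt.
    by exists [::] => _; have [? ->] := S0.
  have kMN : (M <= k < N)%N by rewrite kM kN.
  have xf : (k, false) \in idx M N by rewrite mem_idx//= kN kM.
  have pf := px _ xf; rewrite /= in pf.
  rewrite /lcost; case: ifP => [al1|nal1]; last first.
    rewrite add0r; case: ifP => [al1|_].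
      by exists [:: x (k, false)] => _; apply: S1 => //; exact: pf.
    by exists [::] => _; have [? ->] := S0.
  case: ifP => [al1'|nal1]; last first.
    by rewrite addr0; exists [:: x (k, true)] => _; apply: S1 => //; exact: pt.
  have {}pt := pt al1; have {}pf := pf al1'.
  have at0 := node_neq0 kN p0 pt; have af0 := node_neq0 kN p0 pf.
  have mk : pole_mass (kind k) = 2 by rewrite /kind ltnNge kM.
  have S2 al l c : cmod al < 1 -> phi al = b k -> vcder phi al l -> projperp (v k) l = 0 ->
      2 * ln (cmod al) <= c ->
      good_seq phi k [:: al] /\ (seq_cost phi k [:: al] <= c%:E)%E.
    move=> al1'' pal dl pl lc; have m2 := mu_eq2 hphi kMN al1'' pal dl pl.
    split; last by rewrite /seq_cost big_seq1 m2 elog_cmod ?(node_neq0 kN p0 pal)// -EFinM lee_fin.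
    split=> // [al'|]; last by rewrite big_seq1 m2 mk.
    by rewrite inE => /eqP ->.
  have [xe|xne] := eqVneq (x (k, true)) (x (k, false)).
    have [l dl pl] := dx k kMN xe al1.
    exists [:: x (k, true)] => _; apply: S2 dl pl _ => //.
    by rewrite -xe; lra.
  (* If the projection is zero, every node has multiplicity 2 and only one fits: twice the smaller
     logarithm is at most the sum of the two. *)
  have [pz|pn] := sx k kMN al1 al1' xne.
    have [lt dlt] := hol_vcder hphi al1; have [lf dlf] := hol_vcder hphi al1'.
    have [h|h] := leP (ln (cmod (x (k, true)))) (ln (cmod (x (k, false)))).
      by exists [:: x (k, true)] => _; apply: (S2 _ lt) => //; lra.
    by exists [:: x (k, false)] => _; apply: (S2 _ lf) => //; lra.
  have m1 c : mu phi k (x (k, c)) = 1%:E.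
    have cal1 : cmod (x (k, c)) < 1 by case: c.
    have pal : phi (x (k, c)) = b k by case: c {cal1}.
    have [l dl pl] := pn c; have [r /andP[r1 r2] mr] := mu_dir hphi kMN cal1 pal.
    suff : r <= 1 by move=> r1'; rewrite mr; congr _%:E; lra.
    rewrite -lee_fin -mr /mu /kind ltnNge kM /=.
    by apply: mult_dir_le1 dl pal pl; exact: v1.
  exists [:: x (k, true); x (k, false)] => _; split.
    split=> /=; first by rewrite inE xne.
      by move=> al; rewrite !inE => /orP[] /eqP ->.
    by rewrite !big_cons big_nil !m1 adde0 mk -EFinD.
  by rewrite /seq_cost !big_cons big_nil !m1 adde0 !mul1e !elog_cmod// -EFinD.
have [A HA] := choice Hk.
exists (mkseq A N); split.
  apply/admissibleE; split=> //; first by rewrite size_mkseq.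
  by move=> k kN; rewrite nth_mkseq//; case: (HA k kN).
rewrite /cost big_idx// -sumEFin; apply: lee_sum => j _.
by rewrite nth_mkseq//; case: (HA j (ltn_ord j)).
Qed.

End Configuration.

(** * Dilation, and perturbation to transverse nodes *)

Section Perturbation.
Variables (R : realType) (n : nat) (Om : set 'rV[R[i]]_n) (M N : nat).
Local Notation C := (R[i]).
Local Notation Cn := 'rV[C]_n.
Variables (b v : nat -> Cn) (z : Cn) (K d : R).
Implicit Types (phi : C -> Cn).
Hypothesis MN : (M <= N)%N.
Hypothesis OmK : forall y, Om y -> forall i, cmod (y 0 i) <= K.
Hypothesis zb : forall j, (j < N)%N -> z != b j.
Hypothesis v1 : forall j, (M <= j < N)%N -> enorm (v j) = 1.
Hypothesis cO : convex_domain Om.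
Hypothesis d0 : 0 < d.
Hypothesis zd : forall y : Cn, (forall i, cmod (y 0 i - z 0 i) < d) -> Om y.
Hypothesis binj : forall i j, (i < N)%N -> (j < N)%N -> b i = b j -> i = j.

Lemma vcder_dilate phi (r : R) w l : vcder phi (r%:C%C * w) l ->
  vcder (fun t => phi (r%:C%C * t)) w (r%:C%C *: l).
Proof.
move=> H i; rewrite mxE mulrC.
have g : cder (fun t => r%:C%C * t) w r%:C%C.
  by have := cder_scale r%:C%C (cder_id w); rewrite mulr1.
exact: (@cder_comp _ (fun t => phi t 0 i) (fun t => r%:C%C * t) w _ _ g (H i)).
Qed.

Lemma disk_dilate (r : R) (w : C) : 0 < r < 1 -> cmod w <= 1 -> cmod (r%:C%C * w) <= r.
Proof.
by move=> /andP[r0 r1] w1; rewrite cmodM cmod_real gtr0_norm// ler_piMr// ltW.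
Qed.

(** Dilation keeps the argument in [|w| <= r], so Harnack's bound becomes uniform over the closed
    disk. This is the room for all later corrections. *)
Lemma dilate_room phi (r : R) : hol_in Om phi -> phi 0 = z -> 0 < r < 1 ->
  forall w, cmod w <= 1 -> forall y : Cn,
    (forall i, cmod (y 0 i - phi (r%:C%C * w) 0 i) < (1 - r) / 8 * d) -> Om y.
Proof.
move=> hphi p0 r01 w w1 y Hy; have rw := disk_dilate r01 w1.
have [r0 r1] := andP r01.
apply: (harnack cO hphi OmK d0 _ (b := r%:C%C * w)); rewrite ?p0//.
  exact: le_lt_trans rw r1.
move=> i; apply: (lt_le_trans (Hy i)); rewrite ler_wpM2r ?(ltW d0)//; lra.
Qed.

Lemma scale_nodes (x : nat * bool -> C) (e : R) : 0 < e ->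
  (forall i, i \in idx M N -> cmod (x i) < 1 -> x i != 0) ->
  exists2 r : R, 0 < r < 1 & (forall i, i \in idx M N -> cmod (x i) < 1 -> cmod (x i) < r) /\
    cost M N (fun i => x i / r%:C%C) <= cost M N x + e.
Proof.
move=> e0 xn0; pose s : R := (size (idx M N))%:R + 1.
have s0 : 0 < s by rewrite ltr_wpDl ?ltr01.
pose m : R := \big[Num.max/0]_(i <- idx M N | cmod (x i) < 1) cmod (x i).
have m1 : m < 1 by apply: bigmax_lt.
have m0 : 0 <= m by apply: bigmax_ge_id.
(* The first term keeps all active nodes of modulus less than [r]; the second bounds the loss
   [- ln r] of each node by [e / s]. *)
pose r : R := Num.max ((m + 1) / 2) (expR (- (e / s))).
have r0 : 0 < r by rewrite lt_max expR_gt0 orbT.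
have r1 : r < 1.
  rewrite gt_max expR_lt1 oppr_lt0 divr_gt0// andbT; lra.
have mr : m < r by rewrite lt_max; apply/orP; left; lra.
have re : - ln r <= e / s.
  by rewrite lerNl -ler_expR lnK ?posrE// le_max lexx orbT.
exists r; first by rewrite r0.
have xr i : i \in idx M N -> cmod (x i) < 1 -> cmod (x i) < r.
  move=> ii xi1; apply: le_lt_trans mr.
  exact: (le_bigmax_seq 0 i (fun i => cmod (x i) < 1) (fun i => cmod (x i))).
split=> //.
apply: (@le_trans _ _ (\sum_(i <- idx M N) (lcost (x i) + e / s))).
  rewrite /cost big_seq [leRHS]big_seq; apply: ler_sum => i ii.
  rewrite /lcost cmodM cmodV cmod_real (gtr0_norm r0) ltr_pdivrMr// mul1r.
  have lnr : 0 <= - ln r by rewrite oppr_ge0 ln_le0// ltW.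
  case: ifP => xi; case: ifP => xi1.
  - have xi0 : 0 < cmod (x i) by rewrite cmod_gt0 xn0.
    by rewrite lnM ?posrE ?invr_gt0// lnV ?posrE// lerD2l.
  - have : cmod (x i) < 1 by apply: lt_trans xi r1.
    by rewrite xi1.
  - by rewrite (xr _ ii xi1) in xi.
  by rewrite add0r divr_ge0 ?ltW.
rewrite big_split /= lerD2l big_const_seq count_predT iter_addr_0 -[_ *+ _]mulr_natr.
by rewrite mulrAC ler_pdivrMr// ler_pM2l// /s lerDl.
Qed.

Lemma config_nodes_neq0 phi x : config Om M N b v z phi x ->
  forall i, i \in idx M N -> cmod (x i) < 1 -> x i != 0.
Proof.
move=> [hphi p0 px dx] i ii xi; move: (ii); rewrite mem_idx// => /andP[iN _].
by apply: (node_neq0 zb iN p0); apply: px.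
Qed.

Lemma cder_root (h : C -> C) (be : C) : cdiff h be ->
  cder (fun t => (t - be) * h t) be (h be).
Proof.
move=> [l hl]; have := cderM (cderD (cder_id be) (cder_cst (- be) be)) hl.
by rewrite subrr mul0r add0r addr0 mulr1.
Qed.

(** To the dilated map one adds [q be t *: w be] for each node [be]. The scalar [q be] vanishes at 0
    and at all nodes, and its derivative is nonzero at [be] and zero at the other nodes, so values
    are kept and derivatives are adjusted independently. *)
Lemma perturb phi x (e : R) : config Om M N b v z phi x -> 0 < e ->
  exists psi y, strong_config Om M N b v z psi y /\ cost M N y <= cost M N x + e.
Proof.
move=> cf e0; have xn0 := config_nodes_neq0 cf.
have [hphi p0 px dx] := cf.
have [r r01 [xr cr]] := scale_nodes e0 xn0.
have [r0 r1] := andP r01.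
have rn0 : r%:C%C != 0 :> C by rewrite -cmod_gt0 cmod_real normr_gt0 gt_eqF.
have room := dilate_room hphi p0 r01.
set rho := (1 - r) / 8 * d in room.
have rho0 : 0 < rho by rewrite mulr_gt0// divr_gt0// subr_gt0.
pose y i := x i / r%:C%C; pose phir t := phi (r%:C%C * t).
have ry i : r%:C%C * y i = x i by rewrite /y mulrC divfK.
have ya i : i \in idx M N -> (cmod (y i) < 1) = (cmod (x i) < 1).
  move=> ii; rewrite /y cmodM cmodV cmod_real (gtr0_norm r0) ltr_pdivrMr// mul1r.
  by apply/idP/idP => [h|/(xr i ii)//]; apply: lt_trans h r1.
pose good j := exists u, projperp (v j) u != 0.
pose D (i : nat * bool) := [/\ (M <= i.1)%N, x (i.1, true) <> x (i.1, false) & good i.1].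
have /choice[w Hw] be : exists u, forall i, i \in idx M N -> cmod (x i) < 1 -> be = y i ->
   (~ D i -> u = 0) /\
   (D i -> forall l (c : C), vcder phi (x i) l -> c != 0 -> projperp (v i.1) (r%:C%C *: l + c *: u) != 0).
  have [[i [ii xi bi]]|nex] := pselect (exists i, [/\ i \in idx M N, cmod (x i) < 1 & be = y i]); last first.
    by exists 0 => i ii xi bi; exfalso; apply: nex; exists i.
  have uniq1 i' : i' \in idx M N -> cmod (x i') < 1 -> be = y i' -> i'.1 = i.1 /\ x i' = x i.
    move=> ii' xi' bi'; have xx : x i' = x i by rewrite -!ry -bi' -bi.
    split=> //; move: (ii) (ii'); rewrite !mem_idx// => /andP[iN _] /andP[iN' _].
    by apply: binj => //; rewrite -!px// xx.
  have [Di|nDi] := pselect (D i); last first.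
    exists 0 => i' ii' xi' bi'; have [e1 e2] := uniq1 i' ii' xi' bi'.
    split=> [_|Di']; first exact: erefl.
    by exfalso; apply: nDi; move: Di'; rewrite /D e1.
  have [l dl] := hol_vcder hphi xi; have [_ _ [u0 pu0]] := Di.
  have [pl|pl] := eqVneq (projperp (v i.1) l) 0.
    exists u0 => i' ii' xi' bi'; have [e1 e2] := uniq1 i' ii' xi' bi'; rewrite e1 e2.
    split=> [nD|_ l' c dl' c0]; first by case: nD; rewrite /D e1.
    rewrite -(vcder_uniq dl dl') projperpD !projperpZ pl scaler0 add0r.
    by rewrite scaler_eq0 negb_or c0.
  exists 0 => i' ii' xi' bi'; have [e1 e2] := uniq1 i' ii' xi' bi'; rewrite e1 e2.
  split=> [_|_ l' c dl' c0]; first exact: erefl.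
  rewrite -(vcder_uniq dl dl') scaler0 addr0 projperpZ.
  by rewrite scaler_eq0 negb_or rn0.
pose ns := undup [seq y i | i <- idx M N & cmod (x i) < 1].
have yns i : i \in idx M N -> cmod (x i) < 1 -> y i \in ns.
  by move=> ii xi; rewrite mem_undup; apply: map_f; rewrite mem_filter xi.
(* The squares kill the derivative at the other nodes, and the factor [t] preserves the value at
   0. *)
pose g be (t : C) : C := t * \prod_(ga <- ns | ga != be) ((t - ga) * (t - ga)).
have gd be t : cdiff (g be) t.
  apply: cdiffM; first exact: cdiff_id.
  apply: (@cdiff_prod _ _ _ _ (fun ga t => (t - ga) * (t - ga))) => ga.
  exact: cdiffM (cdiff_subc _ _) (cdiff_subc _ _).
pose q be (t : C) := (t - be) * g be t.
have qd be t : cdiff (q be) t.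
  by apply: cdiffM => //; exact: cdiff_subc.
have gfac (be ga : C) : be \in ns -> ga \in ns -> ga != be -> exists2 k : C -> C, cdiff k ga &
    forall t, q be t = (t - ga) * ((t - ga) * k t).
  move=> bn gn gb; exists (fun t => (t - be) * (t * \prod_(ga' <- rem ga ns | ga' != be) ((t - ga') * (t - ga')))).
    apply: cdiffM; first exact: cdiff_subc.
    apply: cdiffM; first exact: cdiff_id.
    apply: (@cdiff_prod _ _ _ _ (fun ga t => (t - ga) * (t - ga))) => ga'.
    exact: cdiffM (cdiff_subc _ _) (cdiff_subc _ _).
  by move=> s; rewrite /q /g (big_rem ga)//= gb; ring.
have q0 be : q be 0 = 0 by rewrite /q /g mul0r mulr0.
have qns be ga : be \in ns -> ga \in ns -> q be ga = 0.
  move=> bn gn; have [->|gb] := eqVneq ga be; first by rewrite /q subrr mul0r.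
  by have [k _ ->] := gfac be ga bn gn gb; rewrite subrr mul0r.
have gn0 be : be \in ns -> be != 0 -> g be be != 0.
  move=> bn b0; rewrite /g mulf_neq0// prodf_seq_neq0; apply/allP => ga gn /=.
  by apply/implyP => gb; rewrite mulf_neq0// subr_eq0 eq_sym.
have qder be ga : be \in ns -> ga \in ns -> cder (q be) ga (if ga == be then g be be else 0).
  move=> bn gn; case: eqP => [->|/eqP gb]; first exact: cder_root.
  have [k kd qE] := gfac be ga bn gn gb.
  have kd' : cdiff (fun t => (t - ga) * k t) ga.
    by apply: cdiffM => //; exact: cdiff_subc.
  have := cder_root kd'; rewrite subrr mul0r; apply: cder_eq.
  by exists 1 => // h _; rewrite qE.
pose B := \sum_(be <- ns) 2 * 4 ^+ size ns * (\sum_i cmod (w be 0 i)).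
have B0 : 0 <= B.
  by apply: sumr_ge0 => be _; rewrite mulr_ge0// ?sumr_ge0// mulr_ge0// exprn_ge0.
have n1 (ga : C) : ga \in ns -> cmod ga <= 1.
  have : all (fun ga => cmod ga <= 1) ns.
    rewrite (eq_all_r (mem_undup _)) all_map; apply/allP => i.
    by rewrite mem_filter => /andP[xi ii] /=; rewrite ltW// ya.
  by move=> /allP; apply.
have qB be t : be \in ns -> cmod t <= 1 -> cmod (q be t) <= 2 * 4 ^+ size ns.
  move=> bn t1; rewrite /q /g cmodM ler_pM//.
    by rewrite (le_trans (cmodB _ _))//; have := n1 be bn; lra.
  rewrite cmodM -[leRHS]mul1r ler_pM// cmod_prod.
  rewrite big_seq_cond; apply: (@le_trans _ _ (\prod_(i <- ns | (i \in ns) && (i != be)) (4 : R))).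
    apply: ler_prod => ga /andP[gn _]; rewrite cmod_ge0 cmodM.
    have h : cmod (t - ga) <= 2 by rewrite (le_trans (cmodB _ _))//; have := n1 ga gn; lra.
    by rewrite (_ : 4 = 2 * 2) ?ler_pM//; ring.
  by apply: (@prod_le_exp _ _ _ _ (fun=> 4)) => //; rewrite ler1n.
(* [B] bounds the whole correction, so after scaling it is smaller than the room [rho]. *)
pose de := rho / (B + 1).
have B1 : 0 < B + 1 by rewrite ltr_wpDl ?ltr01.
have de0 : 0 < de by rewrite divr_gt0.
pose psi t := phir t + de%:C%C *: \sum_(be <- ns) (q be t *: w be).
have psiE t i : psi t 0 i = phir t 0 i + de%:C%C * \sum_(be <- ns) (q be t * w be 0 i).
  by rewrite !mxE summxE; congr (_ + _ * _); apply: eq_bigr => be _; rewrite mxE.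
have hpsi : hol_in Om psi.
  move=> t t1; split.
    apply: (room t (ltW t1)) => i; rewrite psiE addrAC subrr add0r cmodM cmod_real gtr0_norm//.
    apply: (@le_lt_trans _ _ (de * B)); last first.
      by rewrite /de mulrAC ltr_pdivrMr// ltr_pM2l// ltrDl ltr01.
    rewrite ler_wpM2l ?(ltW de0)// (le_trans (cmod_sum _ _ _))// /B big_seq [leRHS]big_seq.
    apply: ler_sum => be bn; rewrite cmodM ler_pM//; first by rewrite qB// ltW.
    by rewrite (bigD1 i)//= lerDl sumr_ge0.
  move=> i; rewrite (_ : (fun t => _) = (fun t => phir t 0 i + de%:C%C * \sum_(be <- ns) (q be t * w be 0 i))); last first.
    by apply/funext => s; exact: psiE.
  apply: cdiffD.
    have [l] := @hol_vcder _ _ _ phi (r%:C%C * t) hphi (le_lt_trans (disk_dilate r01 (ltW t1)) r1).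
    by move=> /vcder_dilate/vcder_vcdiff; apply.
  apply: cdiffM; first exact: cdiff_cst.
  apply: (@cdiff_sum _ _ _ _ (fun be t => q be t * w be 0 i)) => be.
  by apply: cdiffM => //; exact: cdiff_cst.
have psi_node i : i \in idx M N -> cmod (x i) < 1 -> psi (y i) = phi (x i).
  move=> ii xi; rewrite /psi /phir ry big_seq big1 ?scaler0 ?addr0// => be bn.
  by rewrite qns ?yns// scale0r.
have psi_der i l : i \in idx M N -> cmod (x i) < 1 -> vcder phi (x i) l ->
    vcder psi (y i) (r%:C%C *: l + (de%:C%C * g (y i) (y i)) *: w (y i)).
  move=> ii xi dl k; have yn := yns i ii xi.
  have h1 : vcder phir (y i) (r%:C%C *: l) by apply: vcder_dilate; rewrite ry.
  pose G ga := if y i == ga then g ga ga else 0.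
  have h2 : cder (fun t => \sum_(be <- ns) (q be t * w be 0 k)) (y i)
      (\sum_(be <- ns) G be * w be 0 k).
    have : {subset ns <= ns} by [].
    elim: {1 3 4}ns => [_|ga s IH sub].
      rewrite big_nil; apply: cder_eq (cder_cst 0 (y i)).
      by exists 1 => // h _; rewrite big_nil.
    have {}IH := IH (fun u us => sub u (@mem_behead _ (ga :: s) u us)).
    have gan : ga \in ns by apply: sub; rewrite mem_head.
    have qw := cderM (qder ga (y i) gan yn) (cder_cst (w ga 0 k) (y i)).
    rewrite mulr0 add0r mulrC in qw.
    rewrite big_cons; apply: cder_eq (cderD qw IH).
    by exists 1 => // h _; rewrite big_cons.
  have := cderD (h1 k) (cder_scale de%:C%C h2).
  rewrite (_ : \sum_(be <- ns) G be * w be 0 k = g (y i) (y i) * w (y i) 0 k); last first.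
    rewrite (bigD1_seq (y i)) ?undup_uniq//= big1 ?addr0 ?/G ?eqxx// => be bne.
    by rewrite /G eq_sym (negbTE bne) mul0r.
  rewrite mulrA -[X in cder _ _ (_ + X)]/(_ * _).
  have -> : (r%:C%C *: l + (de%:C%C * g (y i) (y i)) *: w (y i)) 0 k =
     (r%:C%C *: l) 0 k + de%:C%C * g (y i) (y i) * w (y i) 0 k by rewrite !mxE.
  by apply: cder_eq; exists 1 => // h _; rewrite psiE.
have cn0 i : i \in idx M N -> cmod (x i) < 1 -> de%:C%C * g (y i) (y i) != 0.
  move=> ii xi; rewrite mulf_neq0 ?gn0 ?yns//.
    by rewrite -cmod_gt0 cmod_real normr_gt0 gt_eqF.
  by rewrite /y mulf_neq0 ?invr_eq0// xn0.
exists psi, y; split=> //; split; first split=> //.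
- rewrite /psi /phir mulr0 p0 big1 ?scaler0 ?addr0// => be _.
  by rewrite q0 scale0r.
- by move=> i ii; rewrite ya// => xi; rewrite psi_node// px.
- move=> j jMN yy; have [jM jN] := andP jMN.
  have jt : (j, true) \in idx M N by rewrite mem_idx//= jN.
  rewrite ya// => xj; have xx : x (j, true) = x (j, false) by rewrite -!ry yy.
  have [l dl pl] := dx j jMN xx xj.
  have [+ _] := Hw _ _ jt xj erefl; move=> wz.
  have {}wz : w (y (j, true)) = 0 by apply: wz => -[].
  exists (r%:C%C *: l); last by rewrite projperpZ pl scaler0.
  by have := psi_der _ _ jt xj dl; rewrite wz scaler0 addr0.
move=> j jMN; have [jM jN] := andP jMN.
have jc c : (j, c) \in idx M N by rewrite mem_idx//= jN jM orbT.
rewrite !ya// => xt xf yne.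
have [gj|ngj] := pselect (good j); last first.
  left=> u; apply/eqP; apply: contrapT => /negP pu; apply: ngj; by exists u.
right=> c; have xc : cmod (x (j, c)) < 1 by case: c.
have [l dl] := hol_vcder hphi xc.
exists (r%:C%C *: l + (de%:C%C * g (y (j, c)) (y (j, c))) *: w (y (j, c))).
  exact: psi_der.
have [_ +] := Hw _ _ (jc c) xc erefl; apply=> //; last exact: cn0.
split=> //=; apply/eqP; apply: contra yne => /eqP xx; by rewrite /y xx.
Qed.

End Perturbation.

Section Attach.
Variable R : realType.
Local Notation C := (R[i]).

Lemma separation (T : eqType) (cl : seq T) (f : T -> C) :
  {in cl &, injective f} -> exists2 s : R, 0 < s &
  forall i j, i \in cl -> j \in cl -> i != j -> s <= cmod (f i - f j).
Proof.
move=> finj.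
(* Positivity is asked of every index, also outside [cl], where [f] may fail to be injective; there
   the value is set to 1. *)
pose s : R := \big[Num.min/1]_(i <- cl) \big[Num.min/1]_(j <- cl | i != j)
   (if j \in cl then if i \in cl then cmod (f i - f j) else 1 else 1).
exists s.
  apply: lt_bigmin => // i _; apply: lt_bigmin => // j ij.
  case: ifP => // jc; case: ifP => // ic; rewrite cmod_gt0 subr_eq0.
  by apply: contra ij => /eqP/finj ->.
move=> i j ic jc ij; apply: (bigmin_inf_seq _ i) => //.
by apply: (bigmin_inf_seq _ j) => //; rewrite jc ic.
Qed.

Lemma common_radius (T : eqType) (cl : seq T) (P : T -> R -> Prop) :
  (forall i (d d' : R), 0 < d' -> d' <= d -> P i d -> P i d') ->
  (forall i, i \in cl -> exists2 d : R, 0 < d & P i d) ->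
  exists2 d : R, 0 < d & forall i, i \in cl -> P i d.
Proof.
move=> Pd; elim: cl => [|a s IH] H; first by exists 1.
have [d d0 Hd] := IH (fun i si => H i (@mem_behead _ (a :: s) i si)).
have [d' d'0 Hd'] := H a (mem_head _ _).
exists (Num.min d d'); first by rewrite lt_min d0.
have m0 : 0 < Num.min d d' by rewrite lt_min d0.
move=> i; rewrite inE => /orP[/eqP ->|/Hd Pi].
  by apply: Pd Hd'; rewrite // ge_min lexx orbT.
by apply: Pd Pi; rewrite // ge_min lexx.
Qed.

Variables (n : nat) (Om : set 'rV[C]_n).
Local Notation Cn := 'rV[C]_n.
Hypothesis cO : convex_domain Om.

Definition inside (x : Cn) (d : R) := forall y : Cn, (forall k, cmod (y 0 k - x 0 k) < d) -> Om y.

Lemma inside_segment (x y : Cn) d (t : R) : 0 <= t <= 1 -> inside x d -> inside y d ->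
  inside ((1 - t)%:C%C *: x + t%:C%C *: y) d.
Proof.
move=> t01 Hx Hy w Hw.
pose h := w - ((1 - t)%:C%C *: x + t%:C%C *: y).
have -> : w = (1 - t)%:C%C *: (x + h) + t%:C%C *: (y + h).
  by apply/rowP => k; rewrite /h !mxE rmorphB rmorph1 /=; ring.
have Hh k : cmod (h 0 k) < d by have := Hw k; rewrite !mxE.
by apply: cO => //; [apply: Hx|apply: Hy] => k; rewrite mxE addrAC subrr add0r.
Qed.

Lemma inside_near (x y : Cn) d e : inside x d -> (forall k, cmod (y 0 k - x 0 k) <= e) -> inside y (d - e).
Proof.
move=> Hx Hy w Hw; apply: Hx => k.
rewrite -(subrKA (y 0 k)) (le_lt_trans (cmodD _ _))//.
by have := Hw k; have := Hy k; lra.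
Qed.

Lemma inside_le (x : Cn) d e : e <= d -> inside x d -> inside x e.
Proof. by move=> ed Hx y Hy; apply: Hx => k; apply: lt_le_trans (Hy k) ed. Qed.

(* [f] is dragged along segments towards the points [p i] near the boundary
   points [e i], by peak functions with values close to [0, 1]. *)
Lemma attach_points (I : eqType) (s : seq I) (e : I -> C) (p : I -> Cn) (f : C -> Cn)
    (rho K s0 eta : R) :
  (forall w, cmod w <= 1 -> vcdiff f w) -> (forall w, cmod w <= 1 -> inside (f w) rho) ->
  (forall w, cmod w <= 1 -> forall k, cmod (f w 0 k) <= K) ->
  (forall i, i \in s -> inside (p i) rho /\ forall k, cmod (p i 0 k) <= K) ->
  uniq s -> (forall i, cmod (e i) = 1) -> 0 < s0 -> 0 < rho -> 0 < eta ->
  (forall i j, i \in s -> j \in s -> i != j -> s0 <= cmod (e i - e j)) ->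
  exists (chi : C -> Cn), [/\ forall w, cmod w <= 1 -> vcdiff chi w,
    forall w, cmod w <= 1 -> inside (chi w) (rho / 2),
    forall w, cmod w <= 1 -> (forall i, i \in s -> s0 / 4 <= cmod (w - e i)) ->
      forall k, cmod (chi w 0 k - f w 0 k) <= eta &
    exists2 t0 : R, 0 < t0 & forall t : R, 0 < t -> t <= t0 -> forall i, i \in s ->
      forall k, cmod (chi ((1 - t)%:C%C * e i) 0 k - p i 0 k) <= eta].
Proof.
move=> fd fin fK pin us e1 s00 rho0 eta0 sep.
pose K' := `|K| + 1; have K'0 : 0 < K' by rewrite ltr_wpDl ?ltr01.
have KK' : K <= K' by rewrite (le_trans (ler_norm K))// lerDl.
pose m : R := (size s)%:R; have m0 : 0 <= m by [].
pose eta' := Num.min (rho / 2) eta.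
have eta'0 : 0 < eta' by rewrite lt_min eta0 divr_gt0.
(* Each [p i - f] is at most [2 K']. One nearby peak, off the segment by [th], and at most [m]
   distant ones produce an error of at most [(m + 1) th 2 K']. *)
pose th := eta' / ((m + 2) * (2 * K')).
have q0 : 0 < (m + 2) * (2 * K') by rewrite mulr_gt0 ?mulr_gt0// ltr_wpDl.
have th0 : 0 < th by rewrite divr_gt0.
have thE : (m + 2) * (th * (2 * K')) = eta' by rewrite mulrCA divfK ?gt_eqF.
have tK : 0 < th * (2 * K') := mulr_gt0 th0 (mulr_gt0 (ltr0n R 2) K'0).
have thE' : th * (2 * K') + m * (th * (2 * K')) <= eta'.
  by rewrite -thE (_ : (m + 2) * _ = th * (2 * K') + m * (th * (2 * K')) + th * (2 * K')); [rewrite lerDl ltW|ring].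
have s40 : 0 < s0 / 4 by rewrite divr_gt0.
have /choice[G HG] i := peak (e1 i) th0 s40.
pose chi w := f w + \sum_(i <- s) (G i w *: (p i - f w)).
have chiE w k : chi w 0 k = f w 0 k + \sum_(i <- s) (G i w * (p i 0 k - f w 0 k)).
  by rewrite mxE summxE; congr (_ + _); apply: eq_bigr => i _; rewrite !mxE.
have pf i w k : i \in s -> cmod w <= 1 -> cmod (p i 0 k - f w 0 k) <= 2 * K'.
  move=> si w1; apply: (le_trans (cmodB _ _)).
  by have := (pin i si).2 k; have := fK w w1 k; lra.
have small (P : pred I) w k : cmod w <= 1 ->
    (forall i, i \in s -> P i -> s0 / 4 <= cmod (w - e i)) ->
    cmod (\sum_(i <- s | P i) (G i w * (p i 0 k - f w 0 k))) <= m * (th * (2 * K')).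
  move=> w1 Hw; apply: (le_trans (cmod_sum _ _ _)).
  apply: (@le_trans _ _ (\sum_(i <- s) (th * (2 * K')))); last first.
    by rewrite big_const_seq count_predT iter_addr_0 -[_ *+ _]mulr_natl.
  rewrite big_mkcond big_seq [leRHS]big_seq; apply: ler_sum => i si.
  case: ifP => Pi; last exact: ltW.
  rewrite cmodM ler_pM// ?pf//.
  by have [_ _ _ Gs] := HG i; apply: Gs => //; apply: Hw.
exists chi; split.
- move=> w w1 k; rewrite (_ : (fun t => _) = (fun t => f t 0 k + \sum_(i <- s) (G i t * (p i 0 k - f t 0 k)))); last first.
    by apply/funext => t; exact: chiE.
  apply: cdiffD; first exact: fd.
  apply: (@cdiff_sum _ _ _ _ (fun i t => G i t * (p i 0 k - f t 0 k))) => i.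
  apply: cdiffM; first by case: (HG i).
  by apply: cdiffB; [exact: cdiff_cst|exact: fd].
- move=> w w1.
  have eta'h : eta' <= rho / 2 by rewrite ge_min lexx.
  have mt : m * (th * (2 * K')) <= eta' by rewrite -thE ler_wpM2r ?(ltW tK)// lerDl.
  (* The points [e i] are [s0] apart, so [w] is close to at most one of them. There [chi w] is
     nearly on the segment from [f w] to [p i0], which keeps its room by convexity. *)
  have [[i0 [si0 near0]]|far] := pselect (exists i, i \in s /\ cmod (w - e i) < s0 / 4); last first.
    apply: (@inside_le _ (rho - eta')); first lra.
    apply: inside_near (fin w w1) _ => k; rewrite chiE addrAC subrr add0r.
    apply: le_trans mt; apply: small => // i si _; rewrite leNgt; apply/negP => h.
    by apply: far; exists i.
  have [_ _ /(_ w w1)[t t01 Gt] _] := HG i0.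
  apply: (@inside_le _ (rho - eta')); first lra.
  apply: (inside_near (inside_segment t01 (fin w w1) (pin i0 si0).1)) => k.
  have segE : ((1 - t)%:C%C *: f w + t%:C%C *: p i0) 0 k =
     (1 - t)%:C%C * f w 0 k + t%:C%C * p i0 0 k by rewrite !mxE.
  rewrite chiE segE (bigD1_seq i0)//= rmorphB rmorph1.
  rewrite (_ : _ - _ = (G i0 w - t%:C%C) * (p i0 0 k - f w 0 k) +
      \sum_(i <- s | i != i0) (G i w * (p i 0 k - f w 0 k))); last by rewrite /=; ring.
  apply: (le_trans (cmodD _ _)); apply: le_trans thE'.
  apply: lerD; first by rewrite cmodM ler_pM// pf.
  apply: small => // i si ii0.
  have := sep i0 i si0 si ltac:(by rewrite eq_sym).
  have := cmodB (w - e i) (w - e i0); rewrite (_ : _ - _ - _ = e i0 - e i); last by ring.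
  by move: near0; lra.
- move=> w w1 Hw k; rewrite chiE addrAC subrr add0r.
  apply: (@le_trans _ _ eta'); last by rewrite ge_min lexx orbT.
  rewrite -thE; apply: (@le_trans _ _ (m * (th * (2 * K')))).
    by apply: small => // i si _; apply: Hw.
  by rewrite ler_wpM2r ?(ltW tK)// lerDl.
(* Since [G i] is continuous with value 1 at [e i], the point [p i] is still nearly reached slightly
   inside the disk. *)
have [t0 t00 Ht0] : exists2 t0 : R, 0 < t0 & forall i, i \in s ->
    forall t : R, 0 < t -> t <= t0 -> cmod (G i ((1 - t)%:C%C * e i) - 1) <= th.
  apply: common_radius => [i d d' d'0 dd' H t tp td|i si]; first by apply: H => //; apply: le_trans dd'.
  have [Gd Ge _ _] := HG i; have [d d0 Hd] := cdiff_cont (Gd (e i)) th0.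
  exists (d / 2); first by rewrite divr_gt0.
  move=> t tp td; rewrite rmorphB rmorph1 /= mulrBl mul1r -Ge; apply: Hd.
  by rewrite cmodN cmodM e1 mulr1 cmod_real gtr0_norm//; lra.
exists (Num.min (Num.min t0 (s0 / 4)) 1); first by rewrite !lt_min t00 s40 ltr01.
move=> t tp; rewrite !le_min => /andP[/andP[tt0 ts0] t1] i si k.
set w := (1 - t)%:C%C * e i.
have w1 : cmod w <= 1.
  by rewrite /w cmodM e1 mulr1 cmod_real ger0_norm ?subr_ge0//; lra.
have we : cmod (w - e i) <= s0 / 4.
  rewrite (_ : w - e i = - t%:C%C * e i); last by rewrite /w rmorphB rmorph1 /=; ring.
  by rewrite cmodM cmodN e1 mulr1 cmod_real gtr0_norm.
have Gt := Ht0 i si t tp tt0; rewrite -/w in Gt.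
rewrite chiE (bigD1_seq i)//= (_ : _ - _ = (G i w - 1) * (p i 0 k - f w 0 k) +
   \sum_(j <- s | j != i) (G j w * (p j 0 k - f w 0 k))); last by ring.
apply: (@le_trans _ _ eta'); last by rewrite ge_min lexx orbT.
apply: (le_trans (cmodD _ _)); apply: le_trans thE'.
apply: lerD; first by rewrite cmodM ler_pM// pf.
apply: small => // j sj ji.
have := sep i j si sj ltac:(by rewrite eq_sym).
have := cmodB (w - e j) (w - e i); rewrite (_ : _ - _ - _ = e i - e j); last by ring.
by move: we; lra.
Qed.

(** Convergence in projective space becomes an asymptotic relation [w = mu v + o(mu)] with [mu]
    tending to 0, where [mu] is the inverse of the rescaling factor. *)
Lemma direction_rate (w : C -> Cn) (v : Cn) : enorm v = 1 -> proj_cvg0 w v ->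
  (forall e : R, 0 < e -> exists2 d : R, 0 < d & forall eps, 0 < cmod eps < d ->
     forall k, cmod (w eps 0 k) < e) ->
  exists mu : C -> C, (forall eps, mu eps != 0) /\ forall e : R, 0 < e ->
    exists2 d : R, 0 < d & forall eps, 0 < cmod eps < d ->
      cmod (mu eps) <= e /\ forall k, cmod (w eps 0 k - mu eps * v 0 k) <= e * cmod (mu eps).
Proof.
move=> v1 [lam [lam0 /cvg_coord H]] Hw.
exists (fun eps => (lam eps)^-1); split=> [eps|e e0]; first by rewrite invr_eq0.
have n0 : 0 < n%:R :> R.
  rewrite ltr0n lt0n; apply/eqP => nz; move: v1.
  have : enorm v <= 0.
    apply: (le_trans (enorm_le_sum _)); rewrite big1// => i.
    by exfalso; move: i; rewrite nz => -[].
  by move=> + v1; rewrite v1 ler10.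
pose h := Num.min e (2 * n%:R)^-1.
have h0 : 0 < h by rewrite lt_min e0 invr_gt0 mulr_gt0.
have he : h <= e by rewrite ge_min lexx.
have hn : h <= (2 * n%:R)^-1 by rewrite ge_min lexx orbT.
have [d d0 Hd] := H h h0.
have e2 : 0 < e / (2 * n%:R) by rewrite divr_gt0 ?mulr_gt0.
have [d' d'0 Hd'] := Hw _ e2.
exists (Num.min d d'); first by rewrite lt_min d0.
move=> eps /andP[ep]; rewrite lt_min => /andP[ed ed'].
have {}Hd k : cmod (lam eps * w eps 0 k - v 0 k) < h.
  by have := Hd eps ltac:(by rewrite ep) k; rewrite mxE.
have {}Hd' := Hd' eps ltac:(by rewrite ep).
have l0 : 0 < cmod (lam eps) by rewrite cmod_gt0.
split; last first.
  move=> k; rewrite (_ : _ - _ = (lam eps)^-1 * (lam eps * w eps 0 k - v 0 k)); last first.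
    by rewrite mulrBr mulrA mulVf// mul1r.
  by rewrite cmodM mulrC ler_wpM2r// (le_trans (ltW (Hd k))).
(* As [v] has norm 1 and [n h <= 1 / 2], the rescaled small vector has size at least one half, which
   forces [lam] to be large. *)
have k1 : 1 <= cmod (lam eps) * (n%:R * (e / (2 * n%:R))) + n%:R * h.
  rewrite -{1}v1 (le_trans (enorm_le_sum _))//.
  apply: (@le_trans _ _ (\sum_(k < n) (cmod (lam eps) * (e / (2 * n%:R)) + h))).
    apply: ler_sum => k _; have := cmodB (lam eps * w eps 0 k) (lam eps * w eps 0 k - v 0 k).
    rewrite opprB addrC subrK => /le_trans; apply; apply: lerD; last exact: ltW.
    by rewrite cmodM ler_wpM2l// ltW.
  by rewrite sumr_const card_ord -[_ *+ _]mulr_natl mulrDr mulrCA.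
rewrite cmodV -[leRHS]invrK lef_pV2 ?posrE ?invr_gt0//.
have nh : n%:R * h <= 1 / 2.
  by apply: (le_trans (ler_wpM2l (ltW n0) hn)); rewrite invfM mulrCA divff ?gt_eqF// mulr1 mul1r.
have ne : n%:R * (e / (2 * n%:R)) = e / 2 by field; rewrite gt_eqF.
rewrite ne in k1; rewrite -div1r ler_pdivrMr//; lra.
Qed.

End Attach.

(** * Upper bound for Coman's function *)

Section UpperBound.
Variables (R : realType) (n : nat) (Om : set 'rV[R[i]]_n) (M N : nat).
Local Notation C := (R[i]).
Local Notation Cn := 'rV[C]_n.
Variables (b v : nat -> Cn) (z : Cn) (K d : R) (p : C -> nat * bool -> Cn).
Implicit Types (phi : C -> Cn).
Hypothesis MN : (M <= N)%N.
Hypothesis OmK : forall y, Om y -> forall i, cmod (y 0 i) <= K.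
Hypothesis v1 : forall j, (M <= j < N)%N -> enorm (v j) = 1.
Hypothesis cO : convex_domain Om.
Hypothesis d0 : 0 < d.
Hypothesis zd : inside Om z d.
Hypothesis bd : forall j, (j < N)%N -> exists2 rho : R, 0 < rho & inside Om (b j) rho.
Hypothesis binj : forall i j, (i < N)%N -> (j < N)%N -> b i = b j -> i = j.
Hypothesis Hp : forall i, i \in idx M N -> forall e : R, 0 < e -> exists2 d : R, 0 < d &
  forall eps, 0 < cmod eps < d -> forall k, cmod (p eps i 0 k - b i.1 0 k) < e.
Hypothesis Hdir : forall j, (M <= j < N)%N -> exists mu : C -> C, (forall eps, mu eps != 0) /\
  forall e : R, 0 < e -> exists2 d : R, 0 < d & forall eps, 0 < cmod eps < d ->
    cmod (mu eps) <= e /\ forall k,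
    cmod ((p eps (j, false) - p eps (j, true)) 0 k - mu eps * v j 0 k) <= e * cmod (mu eps).

Definition paired (x : nat * bool -> C) j :=
  (cmod (x (j, true)) < 1) && (x (j, true) == x (j, false)).

(** For a merged pair the index [(j, false)] is [second]: it gets no base node of its own, but a
    shift of the node of its partner, the [double] index [(j, true)]. *)
Definition second x (i : nat * bool) := ~~ i.2 && paired x i.1.

Definition double x (i : nat * bool) := [&& i.2, (M <= i.1)%N & paired x i.1].

(** The gap between merging nodes will be [mu / c], so [c] must be nonzero. If the derivative
    vanishes, a small nonzero [c] is used and absorbed in the error [e]. *)
Lemma derivative_direction phi (x : C) vj (l : Cn) (e : R) : vcder phi x l -> projperp vj l = 0 ->
  enorm vj = 1 -> 0 < e -> exists c : C, c != 0 /\ exists2 dt : R, 0 < dt & forall t, cmod t < dt ->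
    forall k, cmod ((phi (x + t) - phi x) 0 k - t * c * vj 0 k) <= e * cmod t.
Proof.
move=> dl pl vj1 e0; have e2 : 0 < e / 2 by rewrite divr_gt0.
have le : l = hdot l vj *: vj by apply/eqP; rewrite -subr_eq0 -[l - _]/(projperp vj l) pl.
set c := hdot l vj in le.
have [c' [c'0 cc']] : exists c' : C, c' != 0 /\ cmod (c - c') <= e / 2.
  have [->|cn0] := eqVneq c 0; last by exists c; rewrite subrr cmod0 ltW.
  exists (e / 2)%:C%C; rewrite sub0r cmodN cmod_real gtr0_norm// lexx; split=> //.
  by rewrite -cmod_gt0 cmod_real gtr0_norm.
exists c'; split=> //; have [dt dt0 Hdt] := vcder_small dl e2.
exists dt => // t tdt k; have := Hdt t tdt k; rewrite le => h.
have -> : (phi (x + t) - phi x) 0 k - t * c' * vj 0 k =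
   (phi (x + t) - phi x - t *: (c *: vj)) 0 k + t * (c - c') * vj 0 k by rewrite !mxE; ring.
rewrite (le_trans (cmodD _ _))// (splitr e) mulrDl lerD// !cmodM mulrAC mulrC.
rewrite ler_pM ?mulr_ge0// -[leRHS]mulr1 ler_pM ?enorm1_cmod//.
Qed.

Lemma elog_shift (y t : C) (ka : R) : 0 < ka -> y != 0 -> cmod t <= ka * cmod y ->
  (elog (cmod (y + t)%R) <= (ln (cmod y) + ka)%:E)%E.
Proof.
move=> ka0 y0 ty; have yp : 0 < cmod y by rewrite cmod_gt0.
have k1 : 0 < 1 + ka by rewrite addr_gt0.
apply: (@le_trans _ _ (ln (cmod y * (1 + ka)))%:E).
  apply: elog_le => //; last by rewrite mulr_gt0.
  by rewrite (le_trans (cmodD _ _))// mulrDr mulr1 lerD2l mulrC.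
rewrite lee_fin lnM ?posrE// lerD2l; have := @le_ln1Dx R ka; apply.
by rewrite (lt_trans _ ka0)// ltrN10.
Qed.

Lemma coman_le_config phi x (e : R) : config Om M N b v z phi x ->
  (forall i, i \in idx M N -> cmod (x i) < 1 -> x i != 0) -> 0 < e ->
  exists2 d1 : R, 0 < d1 & forall eps, 0 < cmod eps < d1 ->
    (coman_lempert Om [seq p eps i | i <- idx M N] z <= (cost M N x + e)%:E)%E.
Proof.
move=> cf xn0 e0; have [hphi p0 px dx] := cf.
have e2 : 0 < e / 2 by rewrite divr_gt0.
have [r r01 [xr cr]] := scale_nodes e2 xn0.
have [r0 r1] := andP r01.
have rn0 : r%:C%C != 0 :> C by rewrite -cmod_gt0 cmod_real normr_gt0 gt_eqF.
pose y i := x i / r%:C%C; pose phir t := phi (r%:C%C * t).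
have ry i : r%:C%C * y i = x i by rewrite /y mulrC divfK.
have ya i : i \in idx M N -> cmod (x i) < 1 -> cmod (y i) < 1.
  by move=> ii xi; rewrite /y cmodM cmodV cmod_real (gtr0_norm r0) ltr_pdivrMr// mul1r xr.
have yn0 i : i \in idx M N -> cmod (x i) < 1 -> y i != 0.
  by move=> ii xi; rewrite mulf_neq0 ?invr_eq0// xn0.
have idxN i : i \in idx M N -> (i.1 < N)%N by rewrite mem_idx// => /andP[].
have [rho [rho0 phirin bin]] : exists rho : R, [/\ 0 < rho,
    forall w, cmod w <= 1 -> inside Om (phir w) rho &
    forall j, (j < N)%N -> inside Om (b j) rho].
  have [rb rb0 Hrb] : exists2 rb : R, 0 < rb & forall j, j \in iota 0 N -> inside Om (b j) rb.
    apply: common_radius => [j s s' _ ss'|j]; first exact: inside_le.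
    by rewrite mem_iota => /bd.
  have room0 : 0 < (1 - r) / 8 * d by rewrite mulr_gt0// divr_gt0// subr_gt0.
  exists (Num.min rb ((1 - r) / 8 * d)); split; first by rewrite lt_min rb0.
    move=> w w1; apply: (@inside_le _ _ _ _ ((1 - r) / 8 * d)); first by rewrite ge_min lexx orbT.
    exact: (dilate_room OmK cO d0 zd hphi p0 r01 w1).
  move=> j jN; apply: (@inside_le _ _ _ _ rb); first by rewrite ge_min lexx.
  by apply: Hrb; rewrite mem_iota.
have phird w : cmod w <= 1 -> vcdiff phir w.
  move=> w1; have := disk_dilate r01 w1 => rw.
  have [l] := hol_vcder hphi (le_lt_trans rw r1).
  by move=> /vcder_dilate/vcder_vcdiff.
have phirK w : cmod w <= 1 -> forall k, cmod (phir w 0 k) <= K.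
  move=> w1; have rw := disk_dilate r01 w1.
  by apply: OmK; apply: (hphi _ (le_lt_trans rw r1)).1.
have [ee [ee1 eeI]] := unit_pts R.
pose e_ (i : nat * bool) := ee (i.1 * 2 + i.2)%N.
have e_I : injective e_.
  by move=> i j /eeI/pair_code_inj.
pose inact := [seq i <- idx M N | ~~ (cmod (x i) < 1)].
(* [None] stands for the origin, where the value [z] is restored. *)
pose cl : seq (option (nat * bool)) := None :: map Some [seq i <- idx M N | ~~ second x i].
have clS i : (Some i \in cl) = (i \in idx M N) && ~~ second x i.
  by rewrite inE /= mem_map ?mem_filter 1?andbC// => ? ? [].
have cl_uniq : uniq cl.
  rewrite cons_uniq; apply/andP; split; first by apply/mapP => -[].
  rewrite map_inj_uniq; last by move=> ? ? [].
  by apply: filter_uniq; exact: idx_uniq.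
pose base (o : option (nat * bool)) : C :=
  if o is Some i then if cmod (x i) < 1 then y i else e_ i else 0.
have [s0 s00 sep] : exists2 s : R, 0 < s & forall o o', o \in cl -> o' \in cl -> o != o' ->
    s <= cmod (base o - base o').
  apply: separation => o o' oc oc' boo'.
  have cE i : cmod (e_ i) = 1 by exact: ee1.
  case: o o' oc oc' boo' => [i|] [i'|] //; rewrite ?clS /base.
  - move=> /andP[ii ns] /andP[ii' ns']; case: ifP => xi; case: ifP => xi'.
    + move=> yy; have xx : x i = x i' by rewrite -!ry yy.
      have i1 : i.1 = i'.1.
        by apply: binj; rewrite ?idxN// -!px// xx.
      case: i i' i1 xx xi xi' ns ns' {ii ii' yy} => j c [j' c'] /= <- {j'}.
      case: c; case: c' => // xx xi xi'; rewrite /second /paired /= ?xx ?eqxx ?xi ?xi' //.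
    + by move=> yy; have := ya i ii xi; rewrite yy cE ltxx.
    + by move=> yy; have := ya i' ii' xi'; rewrite -yy cE ltxx.
    + by move=> /e_I ->.
  - move=> /andP[ii _] _; case: ifP => xi /eqP; first by rewrite (negbTE (yn0 i ii xi)).
    by rewrite -cmod_eq0 cE oner_eq0.
  move=> _ /andP[ii _]; case: ifP => xi /eqP; rewrite eq_sym; first by rewrite (negbTE (yn0 i' ii xi)).
  by rewrite -cmod_eq0 cE oner_eq0.
have s20 : 0 < s0 / 2 by rewrite divr_gt0.
have [Ki [di [Ki0 di0 Hint]]] := @interpolation R (s0 / 2) (size cl) s20.
(* Data bounded by [B0] give a correction of size at most [rho / 4], inside the room [rho / 2] left
   by [attach_points]. *)
have [B0 [B00 KB]] : exists B0 : R, 0 < B0 /\ Ki * B0 = rho / 4.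
  exists (rho / (4 * Ki)); split; first by rewrite divr_gt0 ?mulr_gt0.
  by field; rewrite gt_eqF.
have [ra [ra0 rs ray]] : exists ra : R, [/\ 0 < ra, ra <= s0 / 4 &
    forall i, i \in idx M N -> cmod (x i) < 1 -> cmod (y i) + ra <= 1].
  have [ra ra0 Hra] : exists2 ra : R, 0 < ra & forall i, i \in idx M N ->
      (cmod (x i) < 1 -> cmod (y i) + ra <= 1).
    apply: common_radius => [i s s' _ ss' H /H|i ii]; first lra.
    case: (boolP (cmod (x i) < 1)) => xi; last by exists 1.
    by exists (1 - cmod (y i)); [rewrite subr_gt0 ya|move=> _; lra].
  exists (Num.min ra (s0 / 4)); split; first by rewrite lt_min ra0 divr_gt0.
    by rewrite ge_min lexx orbT.
  move=> i ii xi; apply: le_trans (Hra i ii xi); rewrite lerD2l.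
  by rewrite ge_min lexx.
(* The first bound controls values of [chi - phir]. The second controls its difference quotients: by
   the Cauchy estimate on radius [ra] they are at most [2 eta / ra <= B0 / 8]. *)
pose eta := Num.min (B0 / 8) (B0 * ra / 16).
have eta0 : 0 < eta.
  by rewrite lt_min; apply/andP; split; apply: divr_gt0 => //; apply: mulr_gt0.
have etaB : eta <= B0 / 8 by rewrite ge_min lexx.
have etar : eta <= B0 * ra / 16 by rewrite ge_min lexx orbT.
have inactS i : i \in inact -> [/\ i \in idx M N, cmod (x i) < 1 = false & Some i \in cl].
  rewrite mem_filter => /andP[/negbTE xi ii]; split=> //; rewrite clS ii /second /paired.
  apply/negP => /andP[i2 /andP[h1 /eqP h2]].
  by case: (i) i2 xi h1 h2 => j [] //= _ xi h1 h2; rewrite h2 xi in h1.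
have sep_e i i' : i \in inact -> i' \in inact -> i != i' -> s0 <= cmod (e_ i - e_ i').
  move=> /inactS[_ xi ci] /inactS[_ xi' ci'] ii'; have := sep _ _ ci ci'.
  by rewrite /base xi xi'; apply; apply: contra ii' => /eqP[->].
have [chi [chid chin chiphi [t0 t00 chinode]]] := @attach_points R n Om cO _ inact e_ (fun i => b i.1) phir rho K s0 eta
  phird phirin phirK
  (fun i ii => let ii' := (let: And3 h _ _ := inactS i ii in h) in
     conj (bin _ (idxN i ii')) (OmK (bin _ (idxN i ii') (b i.1) (fun k => ltac:(by rewrite subrr cmod0)))))
  (filter_uniq _ (idx_uniq M N)) (fun i => ee1 _) s00 rho0 eta0 sep_e.
pose tau := Num.min t0 (Num.min (s0 / 4) (1 / 2)).
have tau0 : 0 < tau by rewrite !lt_min t00 !divr_gt0.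
have taut : tau <= t0 by rewrite ge_min lexx.
have taus : tau <= s0 / 4 by rewrite !ge_min lexx !orbT.
have tau2 : tau <= 1 / 2 by rewrite !ge_min lexx !orbT.
pose be (o : option (nat * bool)) : C :=
  if o is Some i then if cmod (x i) < 1 then y i else (1 - tau)%:C%C * e_ i else 0.
have be_e i : cmod ((1 - tau)%:C%C * e_ i) = 1 - tau.
  by rewrite cmodM ee1 mulr1 cmod_real ger0_norm//; lra.
have be1 o : cmod (be o) <= 1 \/ o \notin cl.
  case: o => [i|] /=; last by left; rewrite cmod0 ler01.
  case: ifP => xi; last by left; rewrite be_e; lra.
  by rewrite clS; case: (boolP (i \in _)) => ii; [left; rewrite ltW// ya|right].
have be_base o : cmod (be o - base o) <= tau.
  case: o => [i|] /=; last by rewrite subrr cmod0 ltW.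
  case: ifP => _; first by rewrite subrr cmod0 ltW.
  rewrite (_ : _ - _ = - tau%:C%C * e_ i); last by rewrite rmorphB rmorph1 /=; ring.
  by rewrite cmodM cmodN ee1 mulr1 cmod_real gtr0_norm.
have sep_be o o' : o \in cl -> o' \in cl -> o != o' -> s0 / 2 <= cmod (be o - be o').
  move=> oc oc' oo'; have := sep o o' oc oc' oo'.
  have := be_base o; have := be_base o'.
  have := cmodB (be o - be o') ((be o - base o) - (be o' - base o')).
  have := cmodB (be o - base o) (be o' - base o').
  rewrite (_ : be o - be o' - _ = base o - base o'); [lra|ring].
pose ka := e / (2 * ((size (idx M N))%:R + 1)).
have sz0 : 0 < (size (idx M N))%:R + 1 :> R by rewrite ltr_wpDl// ltr01.
have ka0 : 0 < ka by rewrite divr_gt0 ?mulr_gt0.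
have doubleE i : i \in idx M N -> double x i -> [/\ (M <= i.1 < N)%N, i = (i.1, true),
    cmod (x i) < 1 & x (i.1, false) = x i].
  move=> ii; have iN := idxN i ii; case: i ii iN => j [] //= ii iN /and3P[_ /= jM /andP[/= h1 /eqP h2]].
  by rewrite jM iN.
have /choice[cc Hcc] i : exists c : C, c != 0 /\ (i \in idx M N -> double x i ->
    exists2 dt : R, 0 < dt & forall t, cmod t < dt ->
    forall k, cmod ((phir (y i + t) - phir (y i)) 0 k - t * c * v i.1 0 k) <= B0 / 4 * cmod t).
  case: (boolP ((i \in idx M N) && double x i)) => [/andP[ii di']|nd]; last first.
    by exists 1; rewrite oner_eq0; split=> // h1 h2; rewrite h1 h2 in nd.
  have [jMN iE xi xf] := doubleE i ii di'.
  have [l dl pl] := dx i.1 jMN ltac:(by rewrite -iE xf) ltac:(by rewrite -iE).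
  rewrite -iE in dl.
  have dl' : vcder phir (y i) (r%:C%C *: l) by apply: vcder_dilate; rewrite ry.
  have B4 : 0 < B0 / 4 by rewrite divr_gt0.
  have pl' : projperp (v i.1) (r%:C%C *: l) = 0 by rewrite projperpZ pl scaler0.
  have [c [c0 [dt dt0 Hdt]]] := derivative_direction dl' pl' (v1 jMN) B4.
  by exists c; split=> // _ _; exists dt.
have /choice[mu Hmu] j : exists mu : C -> C, (M <= j < N)%N -> (forall eps, mu eps != 0) /\
    forall e : R, 0 < e -> exists2 d : R, 0 < d & forall eps, 0 < cmod eps < d ->
    cmod (mu eps) <= e /\ forall k,
    cmod ((p eps (j, false) - p eps (j, true)) 0 k - mu eps * v j 0 k) <= e * cmod (mu eps).
  case: (boolP (M <= j < N)%N) => jMN; last by exists (fun=> 1).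
  by have [mu Hmu] := Hdir jMN; exists mu.
(* With [t = mu / c], the increment of [phir] along [t] and the secant of the pair have the same
   leading term [mu v], so they differ by a small multiple of [t]. *)
pose t_ eps (o : option (nat * bool)) : C :=
  if o is Some i then if (i \in idx M N) && double x i then mu i.1 eps / cc i else 0 else 0.
have Hsmall : exists2 d1 : R, 0 < d1 & forall i, i \in idx M N -> forall eps, 0 < cmod eps < d1 ->
   (forall k, cmod (p eps i 0 k - b i.1 0 k) <= B0 / 8) /\
   (double x i -> [/\ t_ eps (Some i) != 0, cmod (t_ eps (Some i)) <= Num.min di (ra / 2),
      cmod (t_ eps (Some i)) <= ka * cmod (y i),
      (forall k, cmod ((phir (y i + t_ eps (Some i)) - phir (y i)) 0 k
        - t_ eps (Some i) * cc i * v i.1 0 k) <= B0 / 4 * cmod (t_ eps (Some i))) &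
      forall k, cmod ((p eps (i.1, false) - p eps i) 0 k - t_ eps (Some i) * cc i * v i.1 0 k)
        <= B0 / 4 * cmod (t_ eps (Some i))]).
  apply: common_radius => [i s s' _ ss' H eps /andP[h1 h2]|i ii].
    by apply: H; rewrite h1 (lt_le_trans h2).
  have B8 : 0 < B0 / 8 by rewrite divr_gt0.
  have [d2 d20 Hd2] := Hp ii B8.
  case: (boolP (double x i)) => di'; last first.
    exists d2 => // eps heps; split=> // k; apply: ltW; exact: Hd2.
  have [jMN iE xi xf] := doubleE i ii di'.
  have [c0 /(_ ii di')[dt dt0 Hdt]] := Hcc i.
  have [mu0 Hmu'] := Hmu i.1 jMN.
  have cc0 : 0 < cmod (cc i) by rewrite cmod_gt0.
  have y0 : 0 < cmod (y i) by rewrite cmod_gt0 yn0.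
  pose T := Num.min (Num.min di (ra / 2)) (Num.min (ka * cmod (y i)) (dt / 2)).
  have T0 : 0 < T by rewrite !lt_min di0 !divr_gt0// mulr_gt0.
  have e10 : 0 < Num.min (T * cmod (cc i)) (B0 / 4 / cmod (cc i)).
    by rewrite lt_min mulr_gt0// !divr_gt0.
  have [d3 d30 Hd3] := Hmu' _ e10.
  exists (Num.min d2 d3); first by rewrite lt_min d20.
  move=> eps /andP[ep]; rewrite lt_min => /andP[ed2 ed3]; split.
    by move=> k; apply: ltW; apply: Hd2; rewrite ep.
  move=> _; have tE : t_ eps (Some i) = mu i.1 eps / cc i by rewrite /t_ ii di'.
  have [m1 m2] := Hd3 eps ltac:(by rewrite ep).
  have tc : t_ eps (Some i) * cc i = mu i.1 eps by rewrite tE divfK.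
  have tm : cmod (t_ eps (Some i)) * cmod (cc i) = cmod (mu i.1 eps) by rewrite -cmodM tc.
  move: m1; rewrite le_min => /andP[m1 m3].
  have tT : cmod (t_ eps (Some i)) <= T by rewrite -tm ler_pM2r// in m1.
  move: (tT); rewrite le_min => /andP[tT1]; rewrite le_min => /andP[tT2 tT3].
  split=> //.
  - by rewrite tE mulf_neq0 ?invr_eq0.
  - by apply: Hdt; apply: (le_lt_trans tT3); rewrite ltr_pdivrMr// ltr_pMr// ltr1n.
  move=> k; rewrite tc; have := m2 k; rewrite -iE => /le_trans; apply.
  rewrite -tm [cmod (t_ _ _) * _]mulrC mulrA; apply: ler_wpM2r => //.
  apply: (@le_trans _ _ (B0 / 4 / cmod (cc i) * cmod (cc i))).
    by apply: ler_wpM2r => //; rewrite ge_min lexx orbT.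
  by rewrite divfK// gt_eqF.
have [d1 d10 Hd1] := Hsmall.
exists d1; first exact: d10.
move=> eps heps.
have {Hsmall} Hd1i i ii := Hd1 i ii eps heps.
pose A (k : 'I_n) (o : option (nat * bool)) : C :=
  if o \in cl then (if o is Some i then p eps i 0 k else z 0 k) - chi (be o) 0 k else 0.
(* Slope still missing at a double node: the secant minus the increment of [chi], divided by the
   gap. *)
pose E (k : 'I_n) (o : option (nat * bool)) : C :=
  if o is Some i then if (i \in idx M N) && double x i then
    ((p eps (i.1, false) - p eps i) 0 k - (chi (y i + t_ eps o) 0 k - chi (y i) 0 k)) / t_ eps o
  else 0 else 0.
have far_y i w : i \in idx M N -> cmod (x i) < 1 -> ~~ second x i -> cmod w <= ra ->
    forall i', i' \in inact -> s0 / 4 <= cmod (y i + w - e_ i').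
  move=> ii xi ns wr i' /[dup] ia' /inactS[ii' xi' ci'].
  have := @sep (Some i) (Some i'); rewrite clS ii ns => /(_ isT ci').
  rewrite /base xi xi' => h.
  have : s0 <= cmod (y i - e_ i').
    apply: h; apply/eqP => -[E1]; by rewrite E1 xi' in xi.
  have := cmod_sub_ge (y i - e_ i') (- w); rewrite cmodN opprK.
  by rewrite (_ : y i - e_ i' + w = y i + w - e_ i'); [lra|ring].
have far0 i' : i' \in inact -> s0 / 4 <= cmod (0 - e_ i').
  move=> /inactS[ii' xi' ci']; have := @sep None (Some i') (mem_head _ _) ci' isT.
  by rewrite /base xi'; lra.
have AB k o : cmod (A k o) <= B0.
  rewrite /A; case: ifP => oc; last by rewrite cmod0 ltW.
  case: o oc => [i|] oc; last first.
    rewrite /be cmod_distC; have := chiphi 0 _ far0 k; rewrite cmod0 => /(_ ler01).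
    by rewrite /phir mulr0 p0 => h; lra.
  move: (oc); rewrite clS => /andP[ii ns].
  have [/(_ k) h _] := Hd1i i ii.
  suff h2 : cmod (chi (be (Some i)) 0 k - b i.1 0 k) <= eta.
    have := cmodB (p eps i 0 k - b i.1 0 k) (chi (be (Some i)) 0 k - b i.1 0 k).
    by rewrite (_ : _ - _ - _ = p eps i 0 k - chi (be (Some i)) 0 k); [lra|ring].
  rewrite /be; case: ifP => xi; last first.
    by apply: chinode => //; rewrite mem_filter ii xi.
  have -> : b i.1 0 k = phir (y i) 0 k by rewrite /phir ry px.
  apply: chiphi; first exact: ltW (ya i ii xi).
  by move=> i' ia'; have := far_y i 0 ii xi ns _ i' ia'; rewrite addr0 cmod0; apply; exact: ltW.
have double_ns i : double x i -> ~~ second x i by rewrite /double /second => /and3P[-> _ _].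
have EB k o : cmod (E k o) <= B0.
  rewrite /E; case: o => [i|]; last by rewrite cmod0 ltW.
  case: ifP => [/andP[ii di']|_]; last by rewrite cmod0 ltW.
  have [_ /(_ di')[tn0 ta _ tphi tp]] := Hd1i i ii.
  have [jMN iE xi xf] := doubleE i ii di'.
  move: ta; rewrite le_min => /andP[_ tra].
  set t := t_ eps (Some i) in tn0 tra tphi tp *.
  have tpos : 0 < cmod t by rewrite cmod_gt0.
  have wra (w : C) : cmod w <= ra -> cmod (y i + w) <= 1.
    by move=> wr; rewrite (le_trans (cmodD _ _))//; have := ray i ii xi; lra.
  have ns := double_ns i di'.
  have := @cauchy_lipschitz R (fun w => chi w 0 k - phir w 0 k) (y i) ra eta ra0
    (fun w wr => cdiffB (chid _ (wra w wr) k) (phird _ (wra w wr) k))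
    (fun w wr => chiphi _ (wra w wr) (far_y i w ii xi ns wr) k) t _.
  have tlt : cmod t < ra by lra.
  move=> /(_ tlt) h1.
  have h2 : eta * cmod t / (ra - cmod t) <= B0 / 8 * cmod t.
    rewrite ler_pdivrMr ?subr_gt0// mulrAC; apply: ler_wpM2r => //.
    apply: (le_trans etar); rewrite (_ : B0 * ra / 16 = B0 / 8 * (ra / 2)); last by field.
    by rewrite ler_wpM2l ?divr_ge0 ?(ltW B00)//; lra.
  have {}h1 := le_trans h1 h2.
  rewrite cmodM cmodV ler_pdivrMr//.
  have h3 := tphi k; have h4 := tp k.
  have subE (u w : Cn) : (u - w) 0 k = u 0 k - w 0 k by rewrite !mxE.
  rewrite subE in h3.
  set Q := (p eps (i.1, false) - p eps i) 0 k in h4 *.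
  have := cmodB (Q - t * cc i * v i.1 0 k) (phir (y i + t) 0 k - phir (y i) 0 k - t * cc i * v i.1 0 k).
  have := cmodB (Q - t * cc i * v i.1 0 k - (phir (y i + t) 0 k - phir (y i) 0 k - t * cc i * v i.1 0 k))
    (chi (y i + t) 0 k - phir (y i + t) 0 k - (chi (y i) 0 k - phir (y i) 0 k)).
  rewrite (_ : Q - _ - _ - _ = Q - (chi (y i + t) 0 k - chi (y i) 0 k)); last by ring.
  have : 0 <= B0 * cmod t by rewrite mulr_ge0 ?(ltW B00).
  by move: h1 h3 h4; clear; lra.
have td o : cmod (t_ eps o) <= di.
  rewrite /t_; case: o => [i|]; last by rewrite cmod0 ltW.
  case: ifP => [/andP[ii di']|_]; last by rewrite cmod0 ltW.
  have [_ /(_ di')[_ + _ _ _]] := Hd1i i ii.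
  by rewrite /t_ ii di' le_min => /andP[].
(* [interpolation] wants its nodes bounded at every index, not only on [cl]. *)
pose be' o := if o \in cl then be o else 0.
have be'1 o : cmod (be' o) <= 1.
  by rewrite /be'; case: ifP => oc; [case: (be1 o)=> //; rewrite oc|rewrite cmod0].
have sep_be' o o' : o \in cl -> o' \in cl -> o != o' -> s0 / 2 <= cmod (be' o - be' o').
  by move=> oc oc' oo'; rewrite /be' oc oc'; exact: sep_be.
have /choice[P HP] k := Hint _ cl be' (t_ eps) (A k) (E k) B0 (ltW B00) cl_uniq (leqnn _)
  be'1 td sep_be' (AB k) (EB k).
pose psi w := chi w + \row_k P k w.
have psiE w k : psi w 0 k = chi w 0 k + P k w by rewrite !mxE.
have psi_be o : o \in cl -> psi (be o) = if o is Some i then p eps i else z.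
  move=> oc; apply/rowP => k; rewrite psiE; have [_ /(_ o oc)[+ _] _] := HP k.
  by rewrite /be' oc /A oc => ->; case: o oc => [i|] oc; rewrite addrC subrK.
pose node i := if second x i then y i + t_ eps (Some (i.1, true)) else be (Some i).
have node_prop i : i \in idx M N -> [/\ cmod (node i) < 1, psi (node i) = p eps i &
    (elog (cmod (node i)) <= (lcost (y i) + ka)%:E)%E].
  move=> ii; rewrite /node; case: (boolP (second x i)) => si; last first.
    have ic : Some i \in cl by rewrite clS ii.
    rewrite psi_be// /be /lcost; case: ifP => xi.
      rewrite ya//; split=> //; rewrite elog_cmod ?yn0// lee_fin lerDl; exact: ltW.
    have -> : cmod (y i) < 1 = false.
      apply/negbTE; rewrite -leNgt /y cmodM cmodV cmod_real (gtr0_norm r0) ler_pdivlMr// mul1r.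
      by move/negbT: xi; rewrite -leNgt; lra.
    (* A node near the unit circle has negative logarithm, so for an upper bound it may be counted
       as 0. *)
    rewrite be_e; split=> //; first by lra.
    apply: (@le_trans _ _ (ln 1)%:E); first by apply: elog_le => //; lra.
    by rewrite ln1 lee_fin add0r ltW.
  case: i ii si => j c ii; rewrite /second /paired => /andP[/= nc /andP[xj /eqP xe]].
  have cE : c = false by case: (c) nc.
  rewrite {}cE {c nc} in ii *.
  have jMN : (M <= j < N)%N by move: ii; rewrite mem_idx//= => /andP[-> ->].
  have it : (j, true) \in idx M N by rewrite mem_idx//= (proj2 (andP jMN)).
  have dj : double x (j, true) by rewrite /double /paired /= (proj1 (andP jMN)) xj xe eqxx.
  have yy : y (j, false) = y (j, true) by rewrite /y xe.
  have [_ /(_ dj)[tn0 + tka _ _]] := Hd1i (j, true) it.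
  rewrite le_min => /andP[_ tra]; rewrite yy.
  have bey : be (Some (j, true)) = y (j, true) by rewrite /be xj.
  have jc : Some (j, true) \in cl by rewrite clS it double_ns.
  split.
  - by rewrite (le_lt_trans (cmodD _ _))//; have := ray _ it xj; lra.
  - apply/rowP => k; rewrite psiE; have [_ /(_ _ jc)[_ +] _] := HP k.
    have EE : E k (Some (j, true)) = ((p eps (j, false) - p eps (j, true)) 0 k -
        (chi (y (j, true) + t_ eps (Some (j, true))) 0 k - chi (y (j, true)) 0 k))
        / t_ eps (Some (j, true)) by rewrite {1}/E it dj.
    rewrite EE /be' jc bey => ->; rewrite /A jc bey.
    have subE (u w : Cn) : (u - w) 0 k = u 0 k - w 0 k by rewrite !mxE.
    by rewrite subE; field.
  rewrite /lcost ya// /=; apply: elog_shift => //; exact: yn0.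
have cost_le : cost M N y + (\sum_(i <- idx M N) ka) <= cost M N x + e.
  rewrite (splitr e) addrA lerD// big_const_seq count_predT iter_addr_0 -[_ *+ _]mulr_natr.
  rewrite /ka mulrAC ler_pdivrMr ?mulr_gt0//.
  rewrite (_ : e / 2 * (2 * _) = e * ((size (idx M N))%:R + 1)); last by field.
  by rewrite ler_wpM2l ?(ltW e0)// lerDl.
apply: (@le_trans _ _ (\sum_(w <- [seq node i | i <- idx M N]) elog (cmod w))%E).
  apply: ereal_inf_lbound; exists psi, [seq node i | i <- idx M N]; split=> //.
  - apply/hol_diskE => w w1; split.
      apply: (chin _ (ltW w1)) => k; rewrite psiE addrAC subrr add0r.
      have [_ _ /(_ w (ltW w1))] := HP k; rewrite KB; lra.
    move=> k; rewrite (_ : (fun t => _) = (fun t => chi t 0 k + P k t)); last first.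
      by apply/funext => t; exact: psiE.
    by apply: cdiffD; [exact: chid (ltW w1) k|case: (HP k)].
  - by have := psi_be None (mem_head _ _).
  - by rewrite !size_map.
  move=> k; rewrite size_map => ks.
  have kk := mem_nth (0%N, true) ks.
  rewrite (nth_map (0%N, true))// (nth_map (0%N, true))//.
  by have [h1 h2 _] := node_prop _ kk.
rewrite big_map; apply: (@le_trans _ _ (\sum_(i <- idx M N) (lcost (y i) + ka)%:E)%E).
  by rewrite big_seq [leRHS]big_seq; apply: lee_sum => i ii; case: (node_prop i ii).
by rewrite sumEFin lee_fin big_split.
Qed.

End UpperBound.

(** * Limits along an ultrafilter *)

Section UltraLimit.
Variables (R : realType) (T : Type) (G : set_system T).
Hypothesis GU : UltraFilter G.
Local Notation C := (R[i]).

Lemma ultra_meet (A B : set T) : G A -> G B -> exists t, A t /\ B t.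
Proof. by move=> GA GB; have [t] := filter_ex (filterI GA GB); exists t. Qed.

(** The limit is the supremum of the levels lying below [u] on a set of [G]; above it, the
    ultrafilter must contain the complementary set. *)
Lemma ultra_real_limit (u : T -> R) (K : R) : G [set t | `|u t| <= K] ->
  exists l : R, forall e : R, 0 < e -> G [set t | `|u t - l| <= e].
Proof.
move=> GK; pose S := [set r : R | G [set t | r <= u t]].
have hs : has_sup S.
  split; first by exists (- K); apply: filterS GK => t /=; rewrite ler_norml => /andP[].
  exists K => r Sr; have [t [/= h1 h2]] := ultra_meet GK Sr.
  by rewrite (le_trans h2)// (le_trans (ler_norm _)).
exists (sup S) => e e0.
have [r Sr hr] := sup_adherent e0 hs.
have h2 : G [set t | u t < sup S + e].
  have [h|h] := in_ultra_setVsetC [set t | sup S + e <= u t] GU.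
    have : sup S + e <= sup S by apply: ub_le_sup; [exact: hs.2|exact: h].
    by rewrite gerDl leNgt e0.
  by apply: filterS h => t /= /negP; rewrite -ltNge.
apply: filterS (filterI Sr h2) => t /= [h3 h4].
by rewrite ler_norml; apply/andP; split; lra.
Qed.

Definition ucvg (u : T -> C) (l : C) := forall e : R, 0 < e -> G [set t | cmod (u t - l) <= e].

Lemma ultra_limit (u : T -> C) (K : R) : G [set t | cmod (u t) <= K] -> exists l, ucvg u l.
Proof.
move=> GK.
have [a Ha] : exists a : R, forall e : R, 0 < e -> G [set t | `|complex.Re (u t) - a| <= e].
  by apply: (@ultra_real_limit _ K); apply: filterS GK => t /=; apply: le_trans (cmod_Re _).
have [b Hb] : exists b : R, forall e : R, 0 < e -> G [set t | `|complex.Im (u t) - b| <= e].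
  by apply: (@ultra_real_limit _ K); apply: filterS GK => t /=; apply: le_trans (cmod_Im _).
exists (Complex a b) => e e0; have e2 : 0 < e / 2 by rewrite divr_gt0.
apply: filterS (filterI (Ha _ e2) (Hb _ e2)) => t /= [h1 h2].
apply: (le_trans (cmod_le_ReIm _)); rewrite (splitr e).
by case: (u t) h1 h2 => x y /= h1 h2; rewrite lerD.
Qed.

Lemma ultra_forall (I : finType) (P : I -> set T) : (forall i, G (P i)) -> G [set t | forall i, P i t].
Proof. by move=> H; apply: filter_forall. Qed.

Lemma ultra_seq (I : eqType) (s : seq I) (P : I -> set T) :
  (forall i, i \in s -> G (P i)) -> G [set t | forall i, i \in s -> P i t].
Proof.
elim: s => [|a s IH] H; first by apply: filterS filterT.
have h1 := IH (fun i si => H i (@mem_behead _ (a :: s) i si)).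
apply: filterS (filterI (H a (mem_head _ _)) h1) => t /= [Pa Ps] i.
by rewrite inE => /orP[/eqP ->//|/Ps].
Qed.

Lemma ucvg_bound (u : T -> C) l (B : R) : ucvg u l -> G [set t | cmod (u t) <= B] -> cmod l <= B.
Proof.
move=> ul GB; apply/ler_addgt0Pr => e e0.
have [t [/= h1 h2]] := ultra_meet (ul e e0) GB.
by have := cmodB (u t) (u t - l); rewrite subKr; lra.
Qed.

Lemma ucvgD (u w : T -> C) l m : ucvg u l -> ucvg w m -> ucvg (fun t => u t + w t) (l + m).
Proof.
move=> ul wm e e0; have e2 : 0 < e / 2 by rewrite divr_gt0.
apply: filterS (filterI (ul _ e2) (wm _ e2)) => t /= [h1 h2].
by rewrite opprD addrACA (le_trans (cmodD _ _))// (splitr e) lerD.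
Qed.

Lemma ucvgZ (c : C) (u : T -> C) l : ucvg u l -> ucvg (fun t => c * u t) (c * l).
Proof.
move=> ul e e0; have c0 : 0 < cmod c + 1 by rewrite ltr_wpDl ?ltr01.
apply: filterS (ul _ (divr_gt0 e0 c0)) => t /= h.
rewrite -mulrBr cmodM (le_trans (ler_wpM2l (cmod_ge0 _) h))//.
by rewrite mulrA ler_pdivrMr// mulrC ler_pM2l// lerDl.
Qed.

Lemma ucvgB (u w : T -> C) l m : ucvg u l -> ucvg w m -> ucvg (fun t => u t - w t) (l - m).
Proof.
move=> ul wm; rewrite -[m]mul1r -mulNr; rewrite (_ : (fun t => _) = (fun t => u t + (-1) * w t)).
  by apply: ucvgD => //; exact: ucvgZ.
by apply/funext => t; rewrite mulN1r.
Qed.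

End UltraLimit.

(** * Estimates uniform over all maps into [Om] *)

Section HolomorphicEstimates.
Variables (R : realType) (n : nat) (Om : set 'rV[R[i]]_n) (K : R).
Local Notation C := (R[i]).
Local Notation Cn := 'rV[C]_n.
Hypothesis OmK : forall y, Om y -> forall i, cmod (y 0 i) <= K.

(** The constants depend only on [s] and [K]. This uniformity replaces a normal family argument: it
    carries expansions over to pointwise ultralimits. *)
Lemma uniform_estimates (s : R) : s < 1 -> exists q L : R, [/\ 0 < q, 0 < L, s + q < 1 &
  forall phi : C -> Cn, hol_in Om phi -> forall w, cmod w <= s -> forall l, vcder phi w l ->
    forall k, cmod (l 0 k) <= L /\ forall h, cmod h <= q ->
      cmod (phi (w + h) 0 k - phi w 0 k) <= L * cmod h /\
      cmod (phi (w + h) 0 k - phi w 0 k - l 0 k * h) <= L * cmod h ^+ 2].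
Proof.
move=> s1; pose r := (1 - s) / 2; have r0 : 0 < r by rewrite /r; lra.
pose K' := `|K| + 1; have K'0 : 0 < K' by rewrite ltr_wpDl ?ltr01.
pose L1 := 2 * K' / r; pose L2 := 2 * K' / r ^+ 2.
have L10 : 0 < L1 := divr_gt0 (mulr_gt0 (ltr0n R 2) K'0) r0.
have L20 : 0 < L2 := divr_gt0 (mulr_gt0 (ltr0n R 2) K'0) (exprn_gt0 2 r0).
exists (r / 2), (2 * L1 + L2 + L1); split; [by rewrite divr_gt0| |by rewrite /r; lra|].
  by rewrite addr_gt0// addr_gt0// mulr_gt0.
move=> phi hphi w ws l dl k.
have inD h : cmod h <= r -> cmod (w + h) < 1.
  by move=> hr; rewrite (le_lt_trans (cmodD _ _))//; rewrite /r in hr; lra.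
have fd h : cmod h <= r -> cdiff (fun t => phi t 0 k) (w + h) by move=> /inD/hphi[_]; apply.
have fK h : cmod h <= r -> cmod (phi (w + h) 0 k) <= K'.
  move=> /inD/hphi[/OmK/(_ k) + _] => /le_trans; apply.
  by rewrite (le_trans (ler_norm K))// lerDl.
have lip h : cmod h <= r / 2 -> cmod (phi (w + h) 0 k - phi w 0 k) <= L1 * cmod h.
  move=> hr; have hr' : cmod h < r by lra.
  have := @cauchy_lipschitz R (fun t => phi t 0 k) w r K' r0 fd fK h hr'.
  move=> /le_trans; apply; rewrite ler_pdivrMr ?subr_gt0// mulrAC; apply: ler_wpM2r => //.
  rewrite (_ : K' = L1 * (r / 2)); last by rewrite /L1; field; rewrite gt_eqF.
  by apply: ler_wpM2l; [exact: ltW|lra].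
have tay h : cmod h <= r / 2 -> cmod (phi (w + h) 0 k - phi w 0 k - l 0 k * h) <= L2 * cmod h ^+ 2.
  move=> hr; have hr' : cmod h < r by lra.
  have := @cauchy_taylor R (fun t => phi t 0 k) w r K' r0 fd fK _ h (dl k) hr'.
  move=> /le_trans; apply; rewrite ler_pdivrMr ?mulr_gt0 ?subr_gt0// mulrAC.
  apply: ler_wpM2r; first by rewrite exprn_ge0.
  rewrite (_ : K' = L2 * (r * (r / 2))); last by rewrite /L2; field; rewrite gt_eqF.
  by apply: ler_wpM2l; [exact: ltW|rewrite ler_pM2l//; lra].
split; last first.
  move=> h hr; split; [apply: (le_trans (lip h hr))|apply: (le_trans (tay h hr))].
    by apply: ler_wpM2r => //; move: L10 L20; clear; lra.
  by apply: ler_wpM2r; [rewrite exprn_ge0|move: L10 L20; clear; lra].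
(* Comparing the Lipschitz and the Taylor bound at one increment [t <= 1] bounds the derivative by
   [L1 + L2]. *)
pose t := Num.min (r / 2) 1; have t0 : 0 < t by rewrite lt_min divr_gt0 ?ltr01.
have tr : t <= r / 2 by rewrite ge_min lexx.
have t1 : t <= 1 by rewrite ge_min lexx orbT.
have ct : cmod t%:C%C = t by rewrite cmod_real gtr0_norm.
have h1 := lip t%:C%C; have h2 := tay t%:C%C; rewrite ct in h1 h2.
have {}h1 := h1 tr; have {}h2 := h2 tr.
have := cmodB (phi (w + t%:C%C) 0 k - phi w 0 k) (phi (w + t%:C%C) 0 k - phi w 0 k - l 0 k * t%:C%C).
rewrite subKr cmodM ct => h3.
rewrite -(ler_pM2r t0); apply: (le_trans h3).
have : L2 * t ^+ 2 <= L2 * t by rewrite ler_wpM2l ?(ltW L20)// expr2 ler_piMr// ltW.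
have : 0 <= L1 * t by rewrite mulr_ge0 ?(ltW L10) ?(ltW t0).
by move: h1 h2; lra.
Qed.

End HolomorphicEstimates.

(** * Nodes of competitors for the point systems *)

Section PointSystem.
Variables (R : realType) (n : nat) (Om : set 'rV[R[i]]_n) (M N : nat).
Local Notation C := (R[i]).
Local Notation Cn := 'rV[C]_n.
Implicit Types (phi : C -> Cn).

Lemma pt_system_admissible (z : Cn) (p : nat * bool -> Cn) phi As :
  (forall i, i \in idx M N -> z != p i) ->
  admissible Om (pt_system [seq p i | i <- idx M N]) z phi As ->
  exists x : nat * bool -> C, [/\ hol_in Om phi, phi 0 = z, forall i, cmod (x i) <= 1,
    forall i, i \in idx M N -> cmod (x i) < 1 -> phi (x i) = p i &
    ((cost M N x)%:E <= \sum_(k < size (pt_system [seq p i | i <- idx M N]))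
       \sum_(alpha <- nth [::] As k)
         mult (pole_mass (nth (pole0 R n) (pt_system [seq p i | i <- idx M N]) k))
              (pole_ind (nth (pole0 R n) (pt_system [seq p i | i <- idx M N]) k)) phi
              (pole_pt (nth (pole0 R n) (pt_system [seq p i | i <- idx M N]) k)) alpha
         * elog (cmod alpha))%E].
Proof.
move=> zp [/hol_diskE hphi p0 sA HA].
set T := pt_system _ in sA HA *.
have sT : size T = size (idx M N) by rewrite /T /pt_system !size_map.
pose i0 := (0%N, true).
have nT k : (k < size (idx M N))%N -> nth (pole0 R n) T k = Pole (p (nth i0 (idx M N) k)) (@Psi_pt R n) 1.
  by move=> ks; rewrite /T /pt_system (nth_map 0) ?size_map// (nth_map i0).
pose x i := head 1 (nth [::] As (index i (idx M N))).
have key k : (k < size (idx M N))%N -> let i := nth i0 (idx M N) k in let A := nth [::] As k in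
    (A = [::] /\ x i = 1) \/ exists al, [/\ A = [:: al], x i = al, cmod al < 1, phi al = p i &
      mult (pole_mass (nth (pole0 R n) T k)) (pole_ind (nth (pole0 R n) T k)) phi
        (pole_pt (nth (pole0 R n) T k)) al = 1%:E].
  move=> ks i A; have := HA k; rewrite sT => /(_ ks).
  rewrite nT//= -/i -/A => -[uA pA mA].
  have xi : x i = head 1 A by rewrite /x /i index_uniq ?idx_uniq.
  have m1 al : al \in A -> mult 1 (@Psi_pt R n) phi (p i) al = 1%:E.
    by move=> /pA[al1 pal]; have [l dl] := hol_vcder hphi al1; apply: mult_pt dl pal.
  case EA : A xi uA pA mA m1 => [|al [|al' A']] xi uA pA mA m1; first by left.
    right; exists al; have [al1 pal] := pA al (mem_head _ _); split=> //.
    exact: m1 (mem_head _ _).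
  exfalso; move: mA; rewrite !big_cons m1 ?mem_head// m1 ?inE ?eqxx ?orbT// addeA -EFinD.
  have : (0 <= \sum_(j <- A') mult 1 (@Psi_pt R n) phi (p i) j)%E.
    rewrite big_seq; apply: sume_ge0 => j jA; rewrite m1 ?inE ?jA ?orbT//.
  case: (\sum_(j <- A') _)%E => [s| |]//; rewrite -?EFinD !lee_fin; lra.
have pos i : i \in idx M N -> exists2 k, (k < size (idx M N))%N & nth i0 (idx M N) k = i.
  by move=> ii; exists (index i (idx M N)); rewrite ?index_mem// nth_index.
exists (fun i => if i \in idx M N then x i else 1); split=> //.
- move=> i; case: ifP => ii; last by rewrite cmod1.
  have [k ks <-] := pos i ii; have /= := key k ks.
  by move=> [[_ ->]|[al [_ -> /ltW]]]; rewrite ?cmod1.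
- move=> i ii; rewrite ii; have [k ks <-] := pos i ii; have /= := key k ks.
  by move=> [[_ ->]|[al [_ -> _ ->]]]; rewrite ?cmod1 ?ltxx.
have -> : cost M N (fun i => if i \in idx M N then x i else 1) = \sum_(k < size (idx M N)) lcost (x (nth i0 (idx M N) k)).
  rewrite /cost big_seq (eq_bigr (fun i => lcost (x i))); last by move=> i ->.
  by rewrite -big_seq (big_nth i0) big_mkord.
rewrite -sumEFin -(big_mkord xpredT (fun k => (lcost (x (nth i0 (idx M N) k)))%:E)).
rewrite -(big_mkord xpredT (fun k => \sum_(alpha <- nth [::] As k)
         mult (pole_mass (nth (pole0 R n) T k)) (pole_ind (nth (pole0 R n) T k)) phi
              (pole_pt (nth (pole0 R n) T k)) alpha * elog (cmod alpha))%E).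
rewrite sT !big_mkord; apply: lee_sum => k _; have /= := key k (ltn_ord k).
case=> [[-> ->]|[al [-> -> al1 pal m1]]]; first by rewrite big_nil /lcost cmod1 ltxx.
have a0 : al != 0.
  by apply: contra (zp _ (mem_nth i0 (ltn_ord k))) => /eqP a0; rewrite -p0 -a0 pal.
by rewrite big_seq1 m1 mul1e elog_cmod// /lcost al1.
Qed.

End PointSystem.

(** * Lower bound through ultralimits of competitors *)

Section LowerBound.
Variables (R : realType) (n : nat) (Om : set 'rV[R[i]]_n) (M N : nat).
Local Notation C := (R[i]).
Local Notation Cn := 'rV[C]_n.
Variables (b v : nat -> Cn) (z : Cn) (K d : R) (p : C -> nat * bool -> Cn).
Implicit Types (phi : C -> Cn).
Hypothesis MN : (M <= N)%N.
Hypothesis OmK : forall y, Om y -> forall i, cmod (y 0 i) <= K.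
Hypothesis zb : forall j, (j < N)%N -> z != b j.
Hypothesis v1 : forall j, (M <= j < N)%N -> enorm (v j) = 1.
Hypothesis cO : convex_domain Om.
Hypothesis d0 : 0 < d.
Hypothesis zd : inside Om z d.
Hypothesis Hp : forall i, i \in idx M N -> forall e : R, 0 < e -> exists2 d : R, 0 < d &
  forall eps, 0 < cmod eps < d -> forall k, cmod (p eps i 0 k - b i.1 0 k) < e.
Hypothesis Hdir : forall j, (M <= j < N)%N -> exists mu : C -> C, (forall eps, mu eps != 0) /\
  forall e : R, 0 < e -> exists2 d : R, 0 < d & forall eps, 0 < cmod eps < d ->
    cmod (mu eps) <= e /\ forall k,
    cmod ((p eps (j, false) - p eps (j, true)) 0 k - mu eps * v j 0 k) <= e * cmod (mu eps).

(** In this form no jump occurs when a node crosses the unit circle. *)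
Lemma lcost_min (w : C) : lcost w = ln (Num.min 1 (cmod w)).
Proof.
by rewrite /lcost; case: ltP => h; rewrite ?ln1.
Qed.

(** Under the stated closeness, [min(1, |w|)] decreases at most by the factor [exp(-e)]. *)
Lemma lcost_lsc (w w' : C) (e : R) : w != 0 -> 0 < e ->
  cmod (w' - w) <= Num.min 1 (cmod w) * (1 - expR (- e)) -> lcost w <= lcost w' + e.
Proof.
move=> w0 e0; rewrite !lcost_min; set m := Num.min 1 (cmod w) => h.
have m0 : 0 < m by rewrite lt_min ltr01 cmod_gt0.
have E0 := expR_gt0 (- e).
have E1 : expR (- e) < 1 by rewrite expR_lt1 oppr_lt0.
have k : m * expR (- e) <= Num.min 1 (cmod w').
  have mw : m <= cmod w by rewrite ge_min lexx orbT.
  have m1 : m <= 1 by rewrite ge_min lexx.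
  rewrite le_min; apply/andP; split; first by nra.
  have := cmod_sub_ge w (w - w'); rewrite subKr cmod_distC; nra.
have k0 : 0 < m * expR (- e) by rewrite mulr_gt0.
rewrite -lerBlDr -[X in _ - X]opprK opprK -[- e]expRK -lnM ?posrE//.
by rewrite ler_ln ?posrE// (lt_le_trans k0).
Qed.

(* If all the derivatives of [phi] near [al] are nearly [D], a secant through
   nearby points whose direction tends to [vj] forces [D] to be parallel to [vj]. *)
Lemma secant_direction (vj D u : Cn) (h m : C) (e L : R) : enorm vj = 1 -> 0 < L -> 0 < e ->
  n%:R * e <= 1 / 2 -> h != 0 ->
  (forall k, cmod (u 0 k) <= L * cmod h) -> (forall k, cmod (u 0 k - D 0 k * h) <= e * cmod h) ->
  (forall k, cmod (u 0 k - m * vj 0 k) <= e * cmod m) ->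
  forall k, cmod (projperp vj D 0 k) <= (n%:R * (n%:R + 1) + 1) * (e * (1 + 2 * n%:R * L)).
Proof.
move=> vj1 L0 e0 ne h0 uL uD um k.
have hp : 0 < cmod h by rewrite cmod_gt0.
have mh : cmod m <= 2 * n%:R * L * cmod h.
  have : cmod m <= n%:R * (L * cmod h + e * cmod m).
    rewrite -[X in X <= _]mulr1 -{1}vj1.
    apply: (@le_trans _ _ (cmod m * \sum_k cmod (vj 0 k))); first by rewrite ler_wpM2l// enorm_le_sum.
    rewrite mulr_sumr; apply: (@le_trans _ _ (\sum_(k < n) (L * cmod h + e * cmod m))).
      apply: ler_sum => j _; rewrite -cmodM.
      have := cmodB (u 0 j) (u 0 j - m * vj 0 j); rewrite subKr => /le_trans; apply.
      by rewrite lerD.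
    by rewrite sumr_const card_ord -[X in X <= _]mulr_natl.
  rewrite mulrDr mulrA => H; have m0 := cmod_ge0 m.
  have : n%:R * e * cmod m <= 1 / 2 * cmod m by rewrite ler_wpM2r.
  by rewrite mulrA in H; lra.
have W j : cmod ((h *: D - m *: vj) 0 j) <= e * (1 + 2 * n%:R * L) * cmod h.
  rewrite (_ : (h *: D - m *: vj) 0 j = (u 0 j - m * vj 0 j) - (u 0 j - D 0 j * h)); last by rewrite !mxE; ring.
  apply: (le_trans (cmodB _ _)); have := uD j; have := um j.
  have : e * cmod m <= e * (2 * n%:R * L * cmod h) by rewrite ler_wpM2l// ltW.
  by lra.
have c0 : 0 <= e * (1 + 2 * n%:R * L) * cmod h.
  by rewrite mulr_ge0// mulr_ge0 ?(ltW e0)// addr_ge0// mulr_ge0 ?(ltW L0)// mulr_ge0.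
have [_ _ _ /(_ k)] := linear_bounds vj1 c0 W.
rewrite (_ : projperp vj (h *: D - m *: vj) = h *: projperp vj D).
  by rewrite mxE cmodM mulrA [leRHS]mulrC ler_pM2l.
by rewrite -scaleN1r scalerA projperpD !projperpZ projperp_self// scaler0 addr0.
Qed.

(** The compactness step: competitors of cost at most [c] at arbitrarily small parameters yield a
    configuration of cost at most [c] for the limit poles. *)
Lemma config_of_frequently (c : R) :
  (forall i, i \in idx M N -> forall j, j \in idx M N -> i != j ->
     exists2 d : R, 0 < d & forall eps, 0 < cmod eps < d -> p eps i != p eps j) ->
  (forall r : R, 0 < r -> exists2 eps, 0 < cmod eps < r &
     exists phi x, [/\ hol_in Om phi, phi 0 = z, forall i, cmod (x i) <= 1,
       forall i, i \in idx M N -> cmod (x i) < 1 -> phi (x i) = p eps i & cost M N x <= c]) ->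
  exists phi x, config Om M N b v z phi x /\ cost M N x <= c.
Proof.
move=> pinj freq.
pose Bad : set C := [set eps | exists phi x, [/\ hol_in Om phi, phi 0 = z, forall i, cmod (x i) <= 1,
       forall i, i \in idx M N -> cmod (x i) < 1 -> phi (x i) = p eps i & cost M N x <= c]].
(* Trace of the punctured neighbourhoods of 0 on the parameters that have a competitor; it is proper
   because these accumulate at 0. *)
pose F : set_system C := [set A | exists2 r : R, 0 < r & forall eps, 0 < cmod eps < r -> Bad eps -> A eps].
have FF : ProperFilter F.
  apply: Build_ProperFilter_ex.
    move=> A [r r0 H]; have [eps e1 e2] := freq r r0; exists eps; exact: H.
  split.
  - by exists 1.
  - move=> A B [r r0 H] [r' r'0 H']; exists (Num.min r r'); first by rewrite lt_min r0.
    by move=> eps /andP[e0]; rewrite lt_min => /andP[e1 e2] Be; split; [apply: H|apply: H']; rewrite ?e0.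
  - by move=> A B AB [r r0 H]; exists r => // eps e1 e2; apply: AB; apply: H.
have [G [GU FG]] := ultraFilterLemma FF.
have GI (A B : set C) : G A -> G B -> G (A `&` B) by move=> GA GB; exact: filterI.
have near_F (A : set C) (r : R) : 0 < r -> (forall eps, 0 < cmod eps < r -> A eps) -> G A.
  by move=> r0 H; apply: FG; exists r => // eps e1 _; apply: H.
have GBad : G Bad by apply: FG; exists 1.
have /choice[Phi HPhi] (eps : C) : exists phi, Bad eps -> exists x, [/\ hol_in Om phi, phi 0 = z, forall i, cmod (x i) <= 1,
       forall i, i \in idx M N -> cmod (x i) < 1 -> phi (x i) = p eps i & cost M N x <= c].
  have [[phi H]|nB] := pselect (Bad eps); first by exists phi.
  by exists (fun=> 0).
have /choice[X HX] (eps : C) : exists x, Bad eps -> [/\ hol_in Om (Phi eps), Phi eps 0 = z, forall i, cmod (x i) <= 1,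
       forall i, i \in idx M N -> cmod (x i) < 1 -> Phi eps (x i) = p eps i & cost M N x <= c].
  have [/HPhi[x H]|nB] := pselect (Bad eps); first by exists x.
  by exists (fun=> 0).
(* Derivatives are taken along as further families; their ultralimit [D] turns out to be the
   derivative of the limit map, by the uniform Taylor bound. *)
have /choice[Ld HLd] (ew : C * C) : exists l, Bad ew.1 -> cmod ew.2 < 1 -> vcder (Phi ew.1) ew.2 l.
  have [[B w1]|nB] := pselect (Bad ew.1 /\ cmod ew.2 < 1).
    by have [hP _ _ _ _] := HX _ B; have [l dl] := hol_vcder hP w1; exists l.
  by exists 0 => B w1; exfalso; apply: nB.
have fE (w : C) (k : 'I_n) : exists l, cmod w < 1 -> ucvg G (fun eps => Phi eps w 0 k) l.
  have [w1|w1] := ltP (cmod w) 1; last by exists 0.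
  have [l Hl] : exists l, ucvg G (fun eps => Phi eps w 0 k) l.
    apply: (@ultra_limit _ _ _ GU _ K); apply: filterS GBad => eps /HX[hP _ _ _ _] /=.
    exact: OmK (hP w w1).1 k.
  by exists l.
have /choice[f Hf] (w : C) : exists u : Cn, forall k, cmod w < 1 -> ucvg G (fun eps => Phi eps w 0 k) (u 0 k).
  by have /choice[l Hl] := fE w; exists (\row_k l k) => k; rewrite mxE; exact: Hl.
have /choice[D HD] (w : C) : exists u : Cn, forall k, cmod w < 1 -> ucvg G (fun eps => Ld (eps, w) 0 k) (u 0 k).
  have [w1|w1] := ltP (cmod w) 1; last by exists 0.
  have [q [L [q0 L0 _ HqL]]] := uniform_estimates OmK w1.
  have /choice[l Hl] (k : 'I_n) : exists l, ucvg G (fun eps => Ld (eps, w) 0 k) l.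
    apply: (@ultra_limit _ _ _ GU _ L); apply: filterS GBad => eps B /=.
    have [hP _ _ _ _] := HX _ B.
    by have [] := HqL _ hP w (lexx _) _ (HLd (eps, w) B w1) k.
  by exists (\row_k l k) => k _; rewrite mxE; exact: Hl.
have /choice[x Hx] i : exists l, ucvg G (fun eps => X eps i) l.
  by apply: (@ultra_limit _ _ _ GU _ 1); apply: filterS GBad => eps /HX[_ _ + _ _] /=; apply.
have fd w : cmod w < 1 -> vcder f w (D w).
  move=> w1 k e e0; have [q [L [q0 L0 wq HqL]]] := uniform_estimates OmK w1.
  exists (Num.min q (e / L)); first by rewrite lt_min q0 divr_gt0.
  move=> h; rewrite lt_min => /andP[hq he].
  have wh1 : cmod (w + h) < 1 by rewrite (le_lt_trans (cmodD _ _))//; lra.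
  apply: (@le_trans _ _ (L * cmod h ^+ 2)); last first.
    by rewrite expr2 mulrA ler_wpM2r// mulrC -ler_pdivlMr// ltW.
  rewrite [D w 0 k * h]mulrC.
  apply: (ucvg_bound GU (ucvgB GU (ucvgB GU (Hf _ k wh1) (Hf _ k w1)) (ucvgZ GU h (HD _ k w1)))).
  apply: filterS GBad => eps B /=; have [hP _ _ _ _] := HX _ B.
  have [_ /(_ h (ltW hq))[_]] := HqL _ hP w (lexx _) _ (HLd (eps, w) B w1) k.
  by rewrite [h * _]mulrC.
have f0 : f 0 = z.
  apply/rowP => k; apply/eqP; rewrite -subr_eq0 -cmod_eq0 eq_le cmod_ge0 andbT.
  have c01 : cmod (0 : C) < 1 by rewrite cmod0.
  apply: (ucvg_bound GU (ucvgB GU (Hf 0 k c01) (l := f 0 0 k) (m := z 0 k) (w := fun=> z 0 k) _)).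
    by move=> e e0; apply: filterS GBad => eps _ /=; rewrite subrr cmod0 ltW.
  by apply: filterS GBad => eps /HX[_ /= -> _ _ _]; rewrite subrr cmod0.
have hf : hol_in Om f.
  move=> w w1; split; last exact: vcder_vcdiff (fd w w1).
  have e0 : 0 < (1 - cmod w) / 8 * d / 2 by rewrite !divr_gt0// mulr_gt0// divr_gt0// subr_gt0.
  have H1 := ultra_forall GU (fun k => Hf w k w1 _ e0).
  have [eps [/= H2 B]] := ultra_meet GU H1 GBad.
  have [hP P0 _ _ _] := HX _ B.
  apply: (harnack cO hP OmK d0 _ w1) => [|k]; first by rewrite P0; exact: zd.
  rewrite cmod_distC; apply: (le_lt_trans (H2 k)); move: e0; lra.
have x1 i : cmod (x i) <= 1.
  by apply: (ucvg_bound GU (Hx i)); apply: filterS GBad => eps /HX[_ _ + _ _] /=; apply.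
have Gact i : cmod (x i) < 1 -> forall r : R, 0 < r ->
    G [set eps | [/\ Bad eps, cmod (X eps i) < 1 & cmod (X eps i - x i) <= r]].
  move=> xi r r0; have r'0 : 0 < Num.min r ((1 - cmod (x i)) / 2).
    by rewrite lt_min r0 divr_gt0// subr_gt0.
  apply: filterS (filterI GBad (Hx i _ r'0)) => eps /= [B]; rewrite le_min => /andP[h1 h2].
  split=> //; have := cmodD (X eps i - x i) (x i); rewrite subrK; lra.
have fx i : i \in idx M N -> cmod (x i) < 1 -> f (x i) = b i.1.
  move=> ii xi; apply/rowP => k; apply/eqP; rewrite -subr_eq0 -cmod_eq0 eq_le cmod_ge0 andbT.
  apply/ler_addgt0Pr => e e0; rewrite add0r.
  have [q [L [q0 L0 wq HqL]]] := uniform_estimates OmK xi.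
  have e3 : 0 < e / 3 by rewrite divr_gt0.
  have [r r0 Hr] := Hp ii e3.
  have s0 : 0 < Num.min q (e / 3 / L) by rewrite lt_min q0 divr_gt0.
  have [eps [[B Xi]]] := ultra_meet GU (Gact i xi _ s0) (GI _ _ (Hf _ k xi _ e3) (near_F _ r r0 Hr)).
  rewrite le_min => /andP[Xq XL] [/= h1 h2].
  have [hP P0 _ Pp _] := HX _ B.
  have [_ /(_ _ Xq)[h3 _]] := HqL _ hP (x i) (lexx _) _ (HLd (eps, x i) B xi) k.
  move: h3; rewrite [x i + _]addrC subrK Pp// => h3.
  have {}h3 : cmod (p eps i 0 k - Phi eps (x i) 0 k) <= e / 3.
    by apply: (le_trans h3); rewrite mulrC -ler_pdivlMr.
  have h4 := h2 k.
  have := cmodB (p eps i 0 k - b i.1 0 k) (p eps i 0 k - Phi eps (x i) 0 k).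
  rewrite (_ : _ - _ - _ = Phi eps (x i) 0 k - b i.1 0 k); last by ring.
  have := cmodB (Phi eps (x i) 0 k - b i.1 0 k) (Phi eps (x i) 0 k - f (x i) 0 k).
  rewrite (_ : _ - _ - _ = f (x i) 0 k - b i.1 0 k); last by ring.
  by move: h1 h3 h4; lra.
have cf : config Om M N b v z f x.
  split=> // j jMN xx xj; exists (D (x (j, true))); first exact: fd.
  set al := x (j, true) in xj xx *.
  have [jM jN] := andP jMN.
  have jc cc : (j, cc) \in idx M N by rewrite mem_idx//= jN jM orbT.
  apply/rowP => k; rewrite [RHS]mxE; apply/eqP; rewrite -cmod_eq0 eq_le cmod_ge0 andbT.
  have s1 : (1 + cmod al) / 2 < 1 by lra.
  have [q [L [q0 L0 wq HqL]]] := uniform_estimates OmK s1.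
  set s := (1 + cmod al) / 2 in s1 wq HqL.
  pose Q : R := (n%:R * (n%:R + 1) + 1) * (1 + 2 * n%:R * L).
  have Q0 : 0 < Q.
    have a1 : 0 <= n%:R * (n%:R + 1) :> R by rewrite mulr_ge0// addr_ge0.
    have a2 : 0 <= 2 * n%:R * L by rewrite !mulr_ge0// ltW.
    by rewrite /Q; apply: mulr_gt0; [rewrite ltr_wpDl|rewrite ltr_wpDr].
  have key e : 0 < e -> n%:R * e <= 1 / 2 -> cmod (projperp (v j) (D al) 0 k) <= Q * e.
    move=> e0 ne.
    (* Derivatives at the moving node [w1] and at [al] are compared through difference quotients of
       the fixed step [rho], with truncation error at most [e / 8] each. *)
    pose rho := Num.min (Num.min q ((1 - cmod al) / 2)) (e / (8 * L)).
    have rho0 : 0 < rho by rewrite !lt_min q0 !divr_gt0 ?mulr_gt0 ?subr_gt0.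
    have rhoq : rho <= q by rewrite !ge_min lexx.
    have rhoa : rho <= (1 - cmod al) / 2 by rewrite !ge_min lexx !orbT.
    have rhoe : L * rho <= e / 8.
      have : rho <= e / (8 * L) by rewrite ge_min lexx orbT.
      by rewrite ler_pdivlMr ?mulr_gt0// => ?; lra.
    have crho : cmod rho%:C%C = rho by rewrite cmod_real gtr0_norm.
    (* The nodes lie within [t] of [al], which is small even relative to [rho]: translating the
       difference quotient from [al] to [w1] costs at most [2 L t / rho <= e / 4]. *)
    pose t := Num.min (Num.min (q / 2) ((1 - cmod al) / 2)) (Num.min (e / (8 * L)) (e * rho / (8 * L))).
    have t0 : 0 < t.
      by rewrite !lt_min !divr_gt0 ?subr_gt0// ?mulr_gt0.
    have tq : t <= q / 2 by rewrite !ge_min lexx.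
    have ta : t <= (1 - cmod al) / 2 by rewrite !ge_min lexx orbT.
    have te : L * t <= e / 8.
      have : t <= e / (8 * L) by rewrite !ge_min lexx !orbT.
      by rewrite ler_pdivlMr ?mulr_gt0// => ?; lra.
    have ter : L * t <= e * rho / 8.
      have : t <= e * rho / (8 * L) by rewrite !ge_min lexx !orbT.
      by rewrite ler_pdivlMr ?mulr_gt0// => ?; lra.
    have [mu [mu0 Hmu]] := Hdir jMN; have [r r0 Hr] := Hmu e e0.
    have tf : (j, true) != (j, false) by apply/eqP => -[].
    have [r' r'0 Hr'] := pinj _ (jc true) _ (jc false) tf.
    have xjf : cmod (x (j, false)) < 1 by rewrite -xx.
    have e8 : 0 < e / 8 by rewrite divr_gt0.
    have G1 := GI _ _ (Gact _ xj _ t0) (Gact _ xjf _ t0).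
    have G2 := GI _ _ (near_F _ r r0 Hr) (near_F _ r' r'0 Hr').
    have G3 := ultra_forall GU (fun k => HD al k xj _ e8).
    have [eps [[[B X1 Xt] [_ X2 Xf]] [[[m1 m2] pne] /= H3]]] := ultra_meet GU G1 (GI _ _ G2 G3).
    rewrite -xx -/al in Xf; rewrite -/al in Xt.
    have [hP P0 _ Pp _] := HX _ B.
    set w1 := X eps (j, true) in X1 Xt *; set w2 := X eps (j, false) in X2 Xf *.
    have w1s : cmod w1 <= s.
      by have := cmodD (w1 - al) al; rewrite subrK /s; lra.
    have als : cmod al <= s by rewrite /s; lra.
    (* Distinct points for the same parameter force distinct nodes, so the secant is defined. *)
    have h0 : w2 - w1 != 0.
      by rewrite subr_eq0; apply: contra pne => /eqP ww; rewrite -!Pp ?jc// -/w1 -/w2 ww.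
    have hq : cmod (w2 - w1) <= 2 * t.
      by have := cmodB (w2 - al) (w1 - al); rewrite opprB addrA subrK; lra.
    have dE1 := HqL _ hP w1 w1s _ (HLd (eps, w1) B X1).
    have dE2 := HqL _ hP al als _ (HLd (eps, al) B xj).
    pose u := p eps (j, false) - p eps (j, true).
    have uE k' : u 0 k' = Phi eps (w1 + (w2 - w1)) 0 k' - Phi eps w1 0 k'.
      by rewrite [w1 + _]addrC subrK /w1 /w2 !Pp ?jc// !mxE.
    have hq' : cmod (w2 - w1) <= q by lra.
    have uL k' : cmod (u 0 k') <= L * cmod (w2 - w1).
      by rewrite uE; have [_ /(_ _ hq')[]] := dE1 k'.
    have Ldiff k' : cmod (Ld (eps, w1) 0 k' - Ld (eps, al) 0 k') <= e / 2.
      have [_ E1] := dE1 k'; have [_ E2] := dE2 k'.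
      have rq : cmod rho%:C%C <= q by rewrite crho.
      have [_ a1] := E1 _ rq; have [_ a2] := E2 _ rq.
      have wq' : cmod (w1 - al) <= q by lra.
      have [a3 _] := E2 _ wq'; rewrite [al + _]addrC subrK in a3.
      have ars : cmod (al + rho%:C%C) <= s by rewrite (le_trans (cmodD _ _))// crho /s; lra.
      have [_ /(_ _ wq')[a4 _]] := HqL _ hP _ ars _ (HLd (eps, al + rho%:C%C) B (le_lt_trans ars s1)) k'.
      rewrite (_ : al + rho%:C%C + (w1 - al) = w1 + rho%:C%C) in a4; last by ring.
      rewrite -(ler_pM2r rho0) -[X in _ * X <= _]crho -cmodM.
      move: a1 a2; rewrite crho => a1 a2.
      set A1 := Phi eps (w1 + _) 0 k' in a1 a4; set A2 := Phi eps (al + _) 0 k' in a2 a4.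
      set A3 := Phi eps w1 0 k' in a1 a3; set A4 := Phi eps al 0 k' in a2 a3.
      set D1 := Ld (eps, w1) 0 k' in a1 *; set D2 := Ld (eps, al) 0 k' in a2 *.
      rewrite (_ : (D1 - D2) * rho%:C%C = ((A2 - A4 - D2 * rho%:C%C) - (A1 - A3 - D1 * rho%:C%C)) + ((A1 - A2) - (A3 - A4))); last by ring.
      have c1 := cmodD ((A2 - A4 - D2 * rho%:C%C) - (A1 - A3 - D1 * rho%:C%C)) ((A1 - A2) - (A3 - A4)).
      have c2 := cmodB (A2 - A4 - D2 * rho%:C%C) (A1 - A3 - D1 * rho%:C%C).
      have c3 := cmodB (A1 - A2) (A3 - A4).
      have c4 : L * cmod (w1 - al) <= L * t by rewrite ler_wpM2l// ltW.
      have c5 : L * rho ^+ 2 <= e / 8 * rho by rewrite expr2 mulrA ler_wpM2r// ltW.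
      lra.
    have uD k' : cmod (u 0 k' - D al 0 k' * (w2 - w1)) <= e * cmod (w2 - w1).
      have [_ /(_ _ hq')[_ b1]] := dE1 k'; rewrite -uE in b1.
      rewrite (_ : _ - _ = (u 0 k' - Ld (eps, w1) 0 k' * (w2 - w1)) +
        (Ld (eps, w1) 0 k' - Ld (eps, al) 0 k' + (Ld (eps, al) 0 k' - D al 0 k')) * (w2 - w1)); last by ring.
      apply: (le_trans (cmodD _ _)).
      have b2 : L * cmod (w2 - w1) ^+ 2 <= e / 4 * cmod (w2 - w1).
        rewrite expr2 mulrA ler_wpM2r//.
        have : L * cmod (w2 - w1) <= L * (2 * t) by rewrite ler_wpM2l// ltW.
        by move: te; lra.
      have b3 : cmod ((Ld (eps, w1) 0 k' - Ld (eps, al) 0 k' + (Ld (eps, al) 0 k' - D al 0 k')) * (w2 - w1))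
          <= (e / 2 + e / 8) * cmod (w2 - w1).
        by rewrite cmodM ler_wpM2r// (le_trans (cmodD _ _))// lerD.
      have := cmod_ge0 (w2 - w1); have := e0; nra.
    rewrite (_ : Q * e = (n%:R * (n%:R + 1) + 1) * (e * (1 + 2 * n%:R * L))); last by rewrite /Q; ring.
    exact: (secant_direction (v1 jMN) L0 e0 ne h0 uL uD m2).
  apply/ler_addgt0Pr => e e0; rewrite add0r.
  pose e' := Num.min (e / Q) (1 / (2 * (n%:R + 1))).
  have n1 : 0 < n%:R + 1 :> R by rewrite ltr_wpDl ?ltr01.
  have e'0 : 0 < e' by rewrite lt_min; apply/andP; split; apply: divr_gt0 => //; apply: mulr_gt0.
  have e'1 : n%:R * e' <= 1 / 2.
    have : e' <= 1 / (2 * (n%:R + 1)) by rewrite ge_min lexx orbT.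
    rewrite ler_pdivlMr ?mulr_gt0// => h; have : 0 <= e' by exact: ltW.
    by lra.
  apply: (le_trans (key e' e'0 e'1)); rewrite mulrC -ler_pdivlMr//.
  by rewrite ge_min lexx.
exists f, x; split=> //; apply/ler_addgt0Pr => e e0.
pose e' := e / ((size (idx M N))%:R + 1).
have sz0 : 0 < (size (idx M N))%:R + 1 :> R by rewrite ltr_wpDl ?ltr01.
have e'0 : 0 < e' by rewrite divr_gt0.
(* Escaping nodes are included: their limit has modulus 1 and cost 0, while nearby costs are at
   least [- e']. *)
have H1 i : i \in idx M N -> G [set eps | lcost (x i) <= lcost (X eps i) + e'].
  move=> ii; have xi0 : x i != 0.
    have [xi|xi] := ltP (cmod (x i)) 1; first exact: (config_nodes_neq0 MN zb cf ii).
    by rewrite -cmod_gt0 (lt_le_trans ltr01).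
  have E0 : 0 < Num.min 1 (cmod (x i)) * (1 - expR (- e')).
    by rewrite mulr_gt0 ?lt_min ?ltr01 ?cmod_gt0// subr_gt0 expR_lt1 oppr_lt0.
  by apply: filterS (Hx i _ E0) => eps /= h; apply: lcost_lsc.
have [eps [B /= H2]] := ultra_meet GU GBad (ultra_seq GU H1).
have [_ _ _ _ Xc] := HX _ B.
apply: (@le_trans _ _ (\sum_(i <- idx M N) (lcost (X eps i) + e'))).
  by rewrite /cost big_seq [leRHS]big_seq; apply: ler_sum => i /H2.
rewrite big_split /= lerD// big_const_seq count_predT iter_addr_0 -[_ *+ _]mulr_natr.
by rewrite mulrAC ler_pdivrMr// ler_pM2l// lerDl.
Qed.

End LowerBound.

(** * Comparison of the two functions, and convergence in the extended reals *)

(** A competitor of Coman's problem is admissible with singleton node sets, each node having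
    multiplicity 1. *)
Lemma gen_lempert_pt_le_coman (R : realType) (n : nat) (Om : set 'rV[R[i]]_n)
    (s : seq 'rV[R[i]]_n) (z : 'rV[R[i]]_n) :
  (gen_lempert Om (pt_system s) z <= coman_lempert Om s z)%E.
Proof.
apply: le_ereal_inf_tmp => _ [phi [zs [hphi p0 sz Hz ->]]].
apply: ereal_inf_lbound; exists phi, [seq [:: w] | w <- zs].
have hol : hol_in Om phi by apply/hol_diskE.
have sT : size (pt_system s) = size s by rewrite size_map.
have m1 k : (k < size s)%N -> let P := nth (pole0 R n) (pt_system s) k in
    pole_pt P = nth 0 s k /\ mult (pole_mass P) (pole_ind P) phi (pole_pt P) (nth 0 zs k) = 1%:E.
  move=> ks /=; rewrite (nth_map 0)//=; split=> //.
  have [z1 pz] := Hz k ks; have [l dl] := hol_vcder hol z1; exact: mult_pt dl pz.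
split.
  split=> //; first by rewrite sT size_map.
  move=> k; rewrite sT => ks /=; rewrite (nth_map 0) ?sz//.
  have [/= pk mk] := m1 k ks; split=> //.
    by move=> al; rewrite inE => /eqP ->; rewrite pk; exact: Hz.
  by rewrite big_seq1 mk (nth_map 0).
rewrite (big_nth 0) sz big_mkord.
rewrite -(big_mkord xpredT (fun k => elog (cmod (nth 0 zs k)))).
rewrite -(big_mkord xpredT (fun k => \sum_(alpha <- nth [::] [seq [:: w] | w <- zs] k)
   mult (pole_mass (nth (pole0 R n) (pt_system s) k)) (pole_ind (nth (pole0 R n) (pt_system s) k)) phi
     (pole_pt (nth (pole0 R n) (pt_system s) k)) alpha * elog (cmod alpha))%E).
rewrite sT !big_mkord; apply: eq_bigr => k _.
rewrite (nth_map 0) ?sz// big_seq1.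
by have [/= _ ->] := m1 k (ltn_ord k); rewrite mul1e.
Qed.

Lemma uniq_map_inj_in (T1 T2 : eqType) (f : T1 -> T2) (s : seq T1) :
  uniq (map f s) -> {in s &, injective f}.
Proof.
elim: s => [|a s IH] //= /andP[fa us] i j; rewrite !inE.
move=> /orP[/eqP ->|si] /orP[/eqP ->|sj] E //.
- by rewrite E map_f in fa.
- by rewrite -E map_f in fa.
- exact: IH.
Qed.

(** Finite levels on either side of [l] suffice. The value [+oo] is excluded since the limit here is
    at most 0. *)
Lemma ereal_cvg0 (R : realType) (f : R[i] -> \bar R) (l : \bar R) : l != +oo%E ->
  (forall c : R, (l < c%:E)%E -> exists2 d : R, 0 < d &
     forall eps, 0 < cmod eps < d -> (f eps <= c%:E)%E) ->
  (forall c : R, (c%:E < l)%E -> exists2 d : R, 0 < d &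
     forall eps, 0 < cmod eps < d -> (c%:E <= f eps)%E) ->
  f eps @[eps --> (0 : R[i])^'] --> l.
Proof.
have near0 (P : R[i] -> Prop) (d : R) : 0 < d -> (forall eps, 0 < cmod eps < d -> P eps) ->
    \forall eps \near (0 : R[i])^', P eps.
  move=> d0 H; have d0' : 0 < d%:C%C :> R[i] by rewrite ltcR.
  exists d%:C%C => //= eps; rewrite /ball_ /= sub0r normrN cmodE ltcR => h e0.
  by apply: H; rewrite cmod_gt0 e0.
case: l => [l| |] // _ U L; last first.
  apply/cvgeNyPle => A; have [d d0 H] := U A (ltNyr A).
  exact: near0 d0 H.
have ll1 : (l%:E < (l + 1)%:E)%E by rewrite lte_fin ltrDl.
have ll2 : ((l - 1)%:E < l%:E)%E by rewrite lte_fin gtrBl.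
have [d1 d10 H1] := U _ ll1; have [d2 d20 H2] := L _ ll2.
apply/fine_cvgP; split.
  apply: (near0 _ (Num.min d1 d2)); first by rewrite lt_min d10.
  move=> eps /andP[e0]; rewrite lt_min => /andP[e1 e2].
  have := H1 eps; have := H2 eps; rewrite e0 e1 e2 => /(_ isT) h2 /(_ isT) h1.
  by case: (f eps) h1 h2.
apply/cvgrPdist_le => e e0.
have le1 : (l%:E < (l + e)%:E)%E by rewrite lte_fin ltrDl.
have le2 : ((l - e)%:E < l%:E)%E by rewrite lte_fin gtrBl.
have [d3 d30 H3] := U _ le1; have [d4 d40 H4] := L _ le2.
apply: (near0 _ (Num.min d3 d4)); first by rewrite lt_min d30.
move=> eps /andP[ep]; rewrite lt_min => /andP[e3 e4] /=.
have := H3 eps; have := H4 eps; rewrite ep e3 e4 => /(_ isT) h4 /(_ isT) h3.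
case: (f eps) h3 h4 => [r| |]//; rewrite !lee_fin /= => h3 h4.
by rewrite ler_norml; apply/andP; split; lra.
Qed.

(** * Assembly of the two bounds, with the case of a pole *)

Section Limit.
Variables (R : realType) (n : nat) (Om : set 'rV[R[i]]_n) (M N : nat).
Local Notation C := (R[i]).
Local Notation Cn := 'rV[C]_n.
Variables (b v : nat -> Cn) (z : Cn) (K d : R) (p : C -> nat * bool -> Cn).
Implicit Types (phi : C -> Cn).
Hypothesis MN : (M <= N)%N.
Hypothesis OmK : forall y, Om y -> forall i, cmod (y 0 i) <= K.
Hypothesis v1 : forall j, (M <= j < N)%N -> enorm (v j) = 1.
Hypothesis cO : convex_domain Om.
Hypothesis d0 : 0 < d.
Hypothesis zd : inside Om z d.
Hypothesis bd : forall j, (j < N)%N -> exists2 rho : R, 0 < rho & inside Om (b j) rho.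
Hypothesis binj : forall i j, (i < N)%N -> (j < N)%N -> b i = b j -> i = j.
Hypothesis Hp : forall i, i \in idx M N -> forall e : R, 0 < e -> exists2 d : R, 0 < d &
  forall eps, 0 < cmod eps < d -> forall k, cmod (p eps i 0 k - b i.1 0 k) < e.
Hypothesis Hdir : forall j, (M <= j < N)%N -> exists mu : C -> C, (forall eps, mu eps != 0) /\
  forall e : R, 0 < e -> exists2 d : R, 0 < d & forall eps, 0 < cmod eps < d ->
    cmod (mu eps) <= e /\ forall k,
    cmod ((p eps (j, false) - p eps (j, true)) 0 k - mu eps * v j 0 k) <= e * cmod (mu eps).
Hypothesis pinj : forall i, i \in idx M N -> forall j, j \in idx M N -> i != j ->
  exists2 d : R, 0 < d & forall eps, 0 < cmod eps < d -> p eps i != p eps j.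

Let L := gen_lempert Om (limit_system M N b v) z.
Let S eps := [seq p eps i | i <- idx M N].

Let zO : Om z. Proof. by apply: zd => k; rewrite subrr cmod0. Qed.

Lemma hol_cst : hol_in Om (fun=> z).
Proof. by move=> w _; split=> // k; exact: cdiff_cst. Qed.

Lemma limit_le0 : (L <= 0)%E.
Proof.
apply: ereal_inf_lbound; exists (fun=> z), (nseq N [::]); split.
  apply/(admissibleE Om b v z MN); split=> //; [exact: hol_cst|by rewrite size_nseq|].
  move=> k kN; rewrite nth_nseq kN; split=> //.
  by rewrite big_nil lee_fin; case: ifP.
rewrite (gen_sumE b v MN) big1// => k _.
by rewrite nth_nseq ltn_ord /seq_cost big_nil.
Qed.

Lemma limit_upper (c : R) : (forall j, (j < N)%N -> z != b j) -> (L < c%:E)%E ->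
  exists2 d1 : R, 0 < d1 & forall eps, 0 < cmod eps < d1 ->
    (coman_lempert Om (S eps) z <= c%:E)%E.
Proof.
move=> zb /ereal_inf_lt[_ [phi [As [adm ->]]]]; rewrite (gen_sumE b v MN) => sc.
have [x cf cx] := admissible_config MN zb v1 adm.
have xc : cost M N x < c by rewrite -lte_fin (le_lt_trans cx).
have e0 : 0 < c - cost M N x by rewrite subr_gt0.
have xn0 := config_nodes_neq0 MN zb cf.
have := coman_le_config MN OmK v1 cO d0 zd bd binj Hp Hdir cf xn0 e0.
by rewrite addrC subrK.
Qed.

(** If the bound failed for arbitrarily small parameters, competitors of cost below [c] would
    produce a configuration and, after perturbation, an admissible pair of cost at most [c + e] for
    every [e > 0], against [c < L]. *)
Lemma limit_lower (c : R) : (forall j, (j < N)%N -> z != b j) -> (c%:E < L)%E ->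
  exists2 d1 : R, 0 < d1 & forall eps, 0 < cmod eps < d1 ->
    (c%:E <= gen_lempert Om (pt_system (S eps)) z)%E.
Proof.
move=> zb cL; apply: contrapT => /forall2NP nex.
have [r0 r00 Hr0] : exists2 r : R, 0 < r & forall i, i \in idx M N ->
    forall eps, 0 < cmod eps < r -> z != p eps i.
  apply: common_radius => [i s s' _ ss' H eps /andP[h1 h2]|i ii].
    by apply: H; rewrite h1 (lt_le_trans h2).
  have iN : (i.1 < N)%N by move: ii; rewrite mem_idx// => /andP[].
  have [k zk] : exists k, z 0 k != b i.1 0 k.
    apply: contrapT => /forallNP H; move: (zb _ iN); apply/negP; rewrite negbK; apply/eqP/rowP => k.
    by apply/eqP; apply: contrapT => /negP; exact: H.
  have e0 : 0 < cmod (z 0 k - b i.1 0 k) by rewrite cmod_gt0 subr_eq0.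
  have [r r0 Hr] := Hp ii e0; exists r => // eps heps.
  by apply/eqP => zp; have := Hr eps heps k; rewrite -zp ltxx.
have freq r : 0 < r -> exists2 eps, 0 < cmod eps < r & exists phi x,
    [/\ hol_in Om phi, phi 0 = z, forall i, cmod (x i) <= 1,
       forall i, i \in idx M N -> cmod (x i) < 1 -> phi (x i) = p eps i & cost M N x <= c].
  move=> rp; have m0 : 0 < Num.min r r0 by rewrite lt_min rp.
  have [//|/existsNP[eps /not_implyP[/andP[e0]]]] := nex (Num.min r r0).
  rewrite lt_min => /andP[er er0] /negP; rewrite -ltNge => /ereal_inf_lt[_ [phi [As [adm ->]]]] sc.
  exists eps; first by rewrite e0.
  have zp i : i \in idx M N -> z != p eps i by move=> ii; apply: Hr0 => //; rewrite e0.
  have [x [h1 h2 h3 h4 h5]] := pt_system_admissible zp adm.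
  by exists phi, x; split=> //; rewrite -lee_fin (le_trans h5)// ltW.
have [phi [x [cf cx]]] := config_of_frequently MN OmK zb v1 cO d0 zd Hp Hdir pinj freq.
have : (L <= c%:E)%E; last by rewrite leNgt cL.
apply/lee_addgt0Pr => e e0.
have [psi [y [sy cy]]] := perturb MN OmK zb cO d0 zd binj cf e0.
have [As [adm sA]] := strong_config_admissible MN OmK zb v1 sy.
apply: (@le_trans _ _ (cost M N y)%:E); last by rewrite -EFinD lee_fin; lra.
apply: le_trans sA; apply: ereal_inf_lbound; exists psi, As; split=> //.
by rewrite (gen_sumE b v MN).
Qed.

(** The constant map [z] takes the value [b j] everywhere, so its node may be put at any small [t].
    Taking [ln t <= c - 1] absorbs the error 1 of [coman_le_config]. *)
Lemma pole_upper j (c : R) : (j < N)%N -> z = b j ->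
  exists2 d1 : R, 0 < d1 & forall eps, 0 < cmod eps < d1 ->
    (coman_lempert Om (S eps) z <= c%:E)%E.
Proof.
move=> jN zj; pose t := Num.min (1 / 2) (expR (c - 1)).
have t0 : 0 < t by rewrite lt_min divr_gt0// expR_gt0.
have t1 : t < 1 by rewrite gt_min; apply/orP; left; lra.
have ct : cmod t%:C%C = t by rewrite cmod_real gtr0_norm.
pose x (i : nat * bool) : C := if i == (j, true) then t%:C%C else 1.
have xi i : cmod (x i) < 1 -> i = (j, true).
  by rewrite /x; case: eqP => // _; rewrite cmod1 ltxx.
have xj : x (j, true) = t%:C%C by rewrite /x eqxx.
have cf : config Om M N b v z (fun=> z) x.
  split=> //; first exact: hol_cst.
    by move=> i _ /xi ->.
  have xf : x (j, false) = 1 by rewrite /x ifN//; apply/eqP => -[].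
  move=> k kMN xx h; exfalso; have [kj] := xi _ h; move: xx; rewrite kj xj xf => tE.
  by move: ct t1; rewrite tE cmod1 => <-; rewrite ltxx.
have xn0 i : i \in idx M N -> cmod (x i) < 1 -> x i != 0.
  by move=> _ /xi ->; rewrite xj -cmod_gt0 ct.
have [d1 d10 H] := coman_le_config MN OmK v1 cO d0 zd bd binj Hp Hdir cf xn0 ltr01.
exists d1 => // eps /H /le_trans; apply; rewrite lee_fin.
rewrite /cost (bigD1_seq (j, true)) ?idx_uniq ?mem_idx ?jN//= big1 => [|i ij]; last first.
  by rewrite /x (negbTE ij) /lcost cmod1 ltxx.
rewrite addr0 xj /lcost ct t1 -lerBrDr -[leRHS]expRK ler_ln ?posrE ?expR_gt0//.
by rewrite ge_min lexx orbT.
Qed.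

(** The node 0 of the constant map has positive multiplicity, so its term is really [-oo] and does
    not fall under the convention on [0 * oo]. *)
Lemma pole_limit j : (j < N)%N -> z = b j -> L = -oo%E.
Proof.
move=> jN zj; apply/eqP; rewrite -leeNy_eq; apply: ereal_inf_lbound.
have z01 : cmod (0 : C) < 1 by rewrite cmod0.
have [m [m0 mE ml]] : exists m : R, [/\ 0 < m,
    mult (pole_mass (if (j < M)%N then Pole (b j) (@Psi_pt R n) 1 else Pole (b j) (Psi_dir (v j)) 2))
      (pole_ind (if (j < M)%N then Pole (b j) (@Psi_pt R n) 1 else Pole (b j) (Psi_dir (v j)) 2)) (fun=> z)
      (pole_pt (if (j < M)%N then Pole (b j) (@Psi_pt R n) 1 else Pole (b j) (Psi_dir (v j)) 2)) 0 = m%:E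
    & m <= pole_mass (if (j < M)%N then Pole (b j) (@Psi_pt R n) 1 else Pole (b j) (Psi_dir (v j)) 2)].
  have [jM|jM] := ltnP j M.
    exists 1; split=> //; have := @mu_pt _ _ Om M b v (fun=> z) j 0 hol_cst jM z01 zj.
    by rewrite jM.
  have jMN : (M <= j < N)%N by rewrite jM jN.
  have [r /andP[r1 r2]] := @mu_dir _ _ Om M N b v v1 (fun=> z) j 0 hol_cst jMN z01 zj.
  by rewrite ltnNge jM /= => mr; exists r; split=> //; rewrite (lt_le_trans ltr01).
exists (fun=> z), (mkseq (fun k => if k == j then [:: 0] else [::]) N); split.
  apply/(admissibleE Om b v z MN); split=> //; [exact: hol_cst|by rewrite size_mkseq|].
  move=> k kN; rewrite nth_mkseq//; case: eqP => [->|_]; split=> //.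
  - by move=> al; rewrite inE => /eqP ->.
  - by rewrite big_seq1 mE lee_fin.
  - by rewrite big_nil lee_fin; case: ifP.
rewrite (gen_sumE b v MN) (bigD1 (Ordinal jN))//= nth_mkseq// eqxx.
have mN : (m%:E * -oo = -oo :> \bar R)%E by rewrite gt0_muleNy// lte_fin.
have e0 : elog (cmod (0 : C)) = -oo%E by rewrite /elog cmod0 eqxx.
have -> : seq_cost M b v (fun=> z) j [:: 0] = -oo%E by rewrite /seq_cost big_seq1 e0 mE mN.
by rewrite addNye.
Qed.

Theorem lempert_limit :
  (coman_lempert Om (S eps) z @[eps --> (0 : C)^'] --> L) /\
  (gen_lempert Om (pt_system (S eps)) z @[eps --> (0 : C)^'] --> L).
Proof.
have Ly : L != +oo%E by apply/eqP => E; have := limit_le0; rewrite E.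
have le eps := gen_lempert_pt_le_coman Om (S eps) z.
have [[j [jN zj]]|nz] := pselect (exists j, (j < N)%N /\ z = b j).
  have LN := pole_limit jN zj.
  (* For the limit [-oo] only upper bounds count, and that for Coman's function dominates the other
     one. *)
  split; apply: ereal_cvg0 => // c; rewrite LN ?ltNge ?leNye// => _;
    have [d1 d10 H] := pole_upper c jN zj; exists d1 => // eps /H // /(le_trans (le eps)) //.
have zb k : (k < N)%N -> z != b k by move=> kN; apply/eqP => zk; apply: nz; exists k.
split; apply: ereal_cvg0 => // c h.
- exact: limit_upper.
- by have [d1 d10 H] := limit_lower zb h; exists d1 => // eps /H /le_trans; apply.
- by have [d1 d10 H] := limit_upper zb h; exists d1 => // eps /H; apply: le_trans.
- exact: limit_lower.
Qed.

End Limit.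

Theorem theorem3p3 (R : realType) (n : nat) (Om : set 'rV[R[i]]_n)
  (M N : nat) (a a' a'' : nat -> R[i] -> 'rV[R[i]]_n) (b v : nat -> 'rV[R[i]]_n) :
  bounded_convex_domain Om ->
  (M <= N)%N ->
  (exists2 r : R, 0 < r & forall eps : R[i], 0 < cmod eps < r ->
     uniq (Seps M N a a' a'' eps) /\
     (forall p, p \in Seps M N a a' a'' eps -> Om p)) ->
  (forall j, (j < M)%N -> a j eps @[eps --> (0 : R[i])^'] --> b j) ->
  (forall j, (M <= j < N)%N ->
     a' j eps @[eps --> (0 : R[i])^'] --> b j /\
     a'' j eps @[eps --> (0 : R[i])^'] --> b j) ->
  (forall j, (j < N)%N -> Om (b j)) ->
  (forall i j, (i < N)%N -> (j < N)%N -> b i = b j -> i = j) ->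
  (forall j, (M <= j < N)%N ->
     enorm (v j) = 1 /\ proj_cvg0 (fun eps => a'' j eps - a' j eps) (v j)) ->
  forall z, Om z ->
    (coman_lempert Om (Seps M N a a' a'' eps) z @[eps --> (0 : R[i])^']
       --> gen_lempert Om (limit_system M N b v) z) /\
    (gen_lempert Om (pt_system (Seps M N a a' a'' eps)) z @[eps --> (0 : R[i])^']
       --> gen_lempert Om (limit_system M N b v) z).
Proof.
move=> [_ oO _ bO cO] MN [r0 r00 HS] Ha Hd bO' binj Hv z zO.
have [K K0 OmK] := bounded_coord bO.
have [d d0 zd] := open_coord oO zO.
have v1 j : (M <= j < N)%N -> enorm (v j) = 1 by move=> /Hv[].
have bd j : (j < N)%N -> exists2 rho : R, 0 < rho & inside Om (b j) rho.
  by move=> /bO'/(open_coord oO)[rho rho0 H]; exists rho.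
pose p := pt M a a' a''.
have Hp i : i \in idx M N -> forall e : R, 0 < e -> exists2 d : R, 0 < d &
    forall eps, 0 < cmod eps < d -> forall k, cmod (p eps i 0 k - b i.1 0 k) < e.
  rewrite mem_idx// => /andP[iN _] e e0; rewrite /p /pt.
  case: ltnP => iM; first exact: cvg_coord (Ha _ iM) _ e0.
  have [h1 h2] := Hd i.1 ltac:(by rewrite iM iN).
  by case: i.2; [exact: cvg_coord h1 _ e0|exact: cvg_coord h2 _ e0].
have pair j c : (M <= j < N)%N -> (j, c) \in idx M N.
  by move=> /andP[jM jN]; rewrite mem_idx//= jN jM orbT.
have Hdir j : (M <= j < N)%N -> exists mu : R[i] -> R[i], (forall eps, mu eps != 0) /\
    forall e : R, 0 < e -> exists2 d : R, 0 < d & forall eps, 0 < cmod eps < d ->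
    cmod (mu eps) <= e /\ forall k,
    cmod ((p eps (j, false) - p eps (j, true)) 0 k - mu eps * v j 0 k) <= e * cmod (mu eps).
  move=> jMN; have [v1j prj] := Hv j jMN.
  have pE eps : p eps (j, false) - p eps (j, true) = a'' j eps - a' j eps.
    by rewrite /p /pt /= ltnNge (proj1 (andP jMN)).
  have small (e : R) : 0 < e -> exists2 d : R, 0 < d & forall eps, 0 < cmod eps < d ->
      forall k, cmod ((a'' j eps - a' j eps) 0 k) < e.
    move=> e0; have e2 : 0 < e / 2 by rewrite divr_gt0.
    have [d1 d10 H1] := Hp _ (pair j true jMN) _ e2.
    have [d2 d20 H2] := Hp _ (pair j false jMN) _ e2.
    exists (Num.min d1 d2); first by rewrite lt_min d10.
    move=> eps /andP[ep]; rewrite lt_min => /andP[h1 h2] k; rewrite -pE.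
    have := H1 eps ltac:(by rewrite ep) k; have := H2 eps ltac:(by rewrite ep) k.
    have := cmodB (p eps (j, false) 0 k - b j 0 k) (p eps (j, true) 0 k - b j 0 k).
    have -> : p eps (j, false) 0 k - b j 0 k - (p eps (j, true) 0 k - b j 0 k) =
      (p eps (j, false) - p eps (j, true)) 0 k by rewrite !mxE; ring.
    by move=> /= *; lra.
  have [mu [mu0 Hmu]] := direction_rate v1j prj small.
  exists mu; split=> // e /Hmu[s s0 H]; exists s => // eps /H[h1 h2]; split=> // k.
  by rewrite pE.
have pinj i : i \in idx M N -> forall j, j \in idx M N -> i != j ->
    exists2 d : R, 0 < d & forall eps, 0 < cmod eps < d -> p eps i != p eps j.
  move=> ii j jj ij; exists r0 => // eps /HS[+ _]; rewrite Seps_map => /uniq_map_inj_in inj.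
  by apply: contra ij => /eqP/inj ->.
have E : Seps M N a a' a'' = fun eps => [seq p eps i | i <- idx M N].
  by apply/funext => eps; exact: Seps_map.
rewrite E.
exact: (lempert_limit MN OmK v1 cO d0 zd bd binj Hp Hdir pinj).
Qed.
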